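(* Let $h(t,0)=0$ for all $t\ge 0$. Assume that, for every $\varphi\in L^2(0,1)^n$ (resp., for every $\varphi\in C_h([0,1])^n$), the initial-boundary value problem $$\partial_t u+A(x,t)\partial_x u+B(x,t)u=0\ (0<x<1,\ t>0),\qquad u(x,0)=\varphi(x)\ (0\le x\le 1),\qquad u^{out}(t)=h(t,u^{in}(t))\ (t\ge 0)$$ has an $L^2$-generalized solution (resp., a continuous solution). Then this problem is Finite Time Stabilizable (in the $L^2$-generalized sense, resp. in the continuous sense) if and only if there exist $T>0$ and $k\in\mathbb{N}$ such that, for all $w\in C_h(\Pi)^n$ and all $x\in[0,1]$, $$[Q^k w](x,T)=0,\qquad\text{where } Q=Q_\varphi\text{ for }\varphi(x)=w(x,0).$$
   Context: Setting. Let $n\ge 2$, $0\le m\le n$, $\Pi=\{(x,t):0\le x\le 1,\ t\ge 0\}$, $\mathbb{R}_+=[0,\infty)$. The unknown $u=(u_1,\dots,u_n)$ is real vector valued; $A=\mathrm{diag}(a_1,\dots,a_n)$ and $B=\mathrm{diag}(b_1,\dots,b_n)$ are diagonal with real entries $a_j,b_j$ that are functions on $\Pi$. There is $a>0$ with $\inf_\Pi a_j\ge a$ for $j\le m$ and $\sup_\Pi a_j\le -a$ for $j>m$. Put $$u^{out}(t)=(u_1(0,t),\dots,u_m(0,t),u_{m+1}(1,t),\dots,u_n(1,t)),$$ $$u^{in}(t)=(u_1(1,t),\dots,u_m(1,t),u_{m+1}(0,t),\dots,u_n(0,t)),$$ and, for $\varphi:[0,1]\to\mathbb{R}^n$, $\varphi^{out}=(\varphi_1(0),\dots,\varphi_m(0),\varphi_{m+1}(1),\dots,\varphi_n(1))$,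 $\varphi^{in}=(\varphi_1(1),\dots,\varphi_m(1),\varphi_{m+1}(0),\dots,\varphi_n(0))$. The boundary function is $h=(h_1,\dots,h_n):[0,\infty)\times\mathbb{R}^n\to\mathbb{R}^n$. The functions $a_j,b_j,h_j$ are continuously differentiable in all their arguments. Growth condition: for each $T'>0$ there are $C(T')>0$ and a polynomial $H$ (such that the right-hand side below is well defined) with $\|\nabla_\xi h(t,\xi)\|_{\max}\le C(T')\,(\log\log H(\|\xi\|))^{1/4}$ for all $0\le t\le T'$, $\xi\in\mathbb{R}^n$, where $\|M\|_{\max}=\max_{j,k}|m_{jk}|$ for a matrix $M=(m_{jk})$. Function spaces. $C_h(\Pi)^n$ is the set of $u\in C(\Pi)^n$ with $u^{out}(0)=h(0,u^{in}(0))$; $C_h([0,1])^n$ is the set of $\varphi\in C([0,1])^n$ with $\varphi^{out}=h(0,\varphi^{in})$; $C^1_h([0,1])^n=C_h([0,1])^n\cap C^1([0,1])^n$. Characteristics. For $j\le n$ and $(x,t)\in\Pi$, the $j$-th characteristic through $(x,t)$ is the solution $\xi\mapsto\omega_j(\xi,x,t)$ of $\partial_\xi\omega_j(\xi,x,t)=1/a_j(\xi,\omega_j(\xi,x,t))$, $\omega_j(x,x,t)=t$ (followed as long as it stays in $\Pi$). The curve $\tau=\omega_j(\xi,x,t)$ reaches $\partial\Pi$ at two points with distinct ordinates (time coordinates); $x_j(x,t)$ is the abscissa of the one with the smaller ordinate. Put $c_j(\xi,x,t)=\exp\int_x^\xi (b_j/a_j)(\eta,\omega_j(\eta,x,t))\,d\eta$.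 Operators. $[Sv]_j(x,t)=c_j(x_j(x,t),x,t)\,v_j(\omega_j(x_j(x,t),x,t))$ for $v\in C(\mathbb{R}_+)^n$, and $[Ru]_j(t)=h_j(t,u^{in}(t))$ for $u\in C(\Pi)^n$, $j\le n$. For a continuous $\varphi:[0,1]\to\mathbb{R}^n$ the operator $Q=Q_\varphi$ with domain $D(Q_\varphi)=\{u\in C_h(\Pi)^n: u(x,0)=\varphi(x)\}$ and values in $C_h(\Pi)^n$ is $$[Qu]_j(x,t)=\begin{cases}[SRu]_j(x,t) & \text{if the backward }j\text{-th characteristic from }(x,t)\text{ ends on the inflow side}\\ & \ (x_j(x,t)=0\text{ for }j\le m,\ x_j(x,t)=1\text{ for }j>m),\\ c_j(x_j(x,t),x,t)\,\varphi_j(x_j(x,t)) & \text{otherwise (it ends on the initial axis } t=0).\end{cases}$$ It satisfies $[Q_\varphi u](x,0)=\varphi(x)$, so powers $Q_\varphi^k$ are defined on $D(Q_\varphi)$. Solutions. A continuous $u:\Pi\to\mathbb{R}^n$ with $u=Q_\varphi u$ in $\Pi$ is a continuous solution of the problem with initial function $\varphi$. A piecewise continuously differentiable solution is a continuous $u:\Pi\to\mathbb{R}^n$ that is continuously differentiable in $\Pi$ except on at most countably many characteristic curves and satisfies the differential system, the initial condition and the boundary condition in $\Pi$ except on those curves; since $\inf_\Pi a_j\ge a>0$ for $j\le m$ and $\sup_\Pi a_j\le -a$ for $j>m$, since $a_j,b_j,h_j$ are continuously differentiable in all their arguments, and since for each $T'>0$ one has $\|\nabla_\xi h(t,\xi)\|_{\max}\le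 C(T')\,(\log\log H(\|\xi\|))^{1/4}$ for all $0\le t\le T'$, $\xi\in\mathbb{R}^n$, with some $C(T')>0$ and some polynomial $H$, a unique such solution exists for every $\varphi\in C^1_h([0,1])^n$ (known result). For $\varphi\in L^2(0,1)^n$, a function $u\in C([0,\infty),L^2(0,1))^n$ is an $L^2$-generalized solution if, for any sequence $\varphi^l\in C^1_h([0,1])^n$ converging to $\varphi$ in $L^2(0,1)^n$, the piecewise continuously differentiable solutions $u^l$ with initial functions $\varphi^l$ satisfy $\|u^l(\cdot,t)-u(\cdot,t)\|_{L^2(0,1)^n}\to 0$ as $l\to\infty$, uniformly in $t\in[0,T']$, for each $T'>0$. In both senses solutions are unique when they exist. Finite Time Stabilizable. Suppose that for every $\varphi\in L^2(0,1)^n$ (resp., $\varphi\in C_h([0,1])^n$) the problem has an $L^2$-generalized (resp., continuous) solution. The problem is Finite Time Stabilizable (FTS) if there exists $T>0$ such that for every $\varphi\in L^2(0,1)^n$ (resp., $\varphi\in C_h([0,1])^n$) the $L^2$-generalized (resp., continuous) solution is identically zero for $t>T$. *)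

(* Defs.v *)
From HB Require Import structures.
From mathcomp Require Import all_boot all_order all_algebra.
From mathcomp Require Import all_classical all_reals all_analysis.
Import Order.TTheory GRing.Theory Num.Theory.
Import numFieldNormedType.Exports.

Set Implicit Arguments.
Unset Strict Implicit.
Unset Printing Implicit Defensive.

Local Open Scope classical_set_scope.
Local Open Scope ring_scope.

(* Functions on the half-strip Pi (resp. on [0,1], on [0,+oo[) are represented
   by total functions whose values outside that set are irrelevant: every
   notion below only inspects them on the set.  The component index j : 'I_n is
   0-based, so the components numbered 1, ..., m in 1-based notation are those with
   (j < m)%N. *)

Section Differentiability.
Variables (R : realType) (V W : normedModType R).

(* Frechet differentiability relative to D, with differential L; it gives
   one-sided derivatives at boundary points of D. *)
Definition diff_within (D : set V) (f : V -> W) (p : V) (L : V -> W) : Prop :=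
  forall e : R, 0 < e ->
    \forall q \near within D (nbhs p), `|f q - f p - L (q - p)| <= e * `|q - p|.

Definition C1_off_with (D E : set V) (f : V -> W) (df : V -> V -> W) : Prop :=
  (forall p, (D `\` E) p -> linear (df p) /\ diff_within D f p (df p)) /\
  (forall v, {within D `\` E, continuous (fun p => df p v)}).

Definition C1_on (D : set V) (f : V -> W) : Prop :=
  exists df, C1_off_with D set0 f df.

End Differentiability.

Section OrientedIntegral.
Variable R : realType.

Definition oriented_integral (f : R -> R) (x y : R) : R :=
  if x <= y then \int[lebesgue_measure]_(z in `[x, y]) f z
  else - \int[lebesgue_measure]_(z in `[y, x]) f z.

End OrientedIntegral.

Section Strip.
Variable R : realType.

Definition Pi : set (R * R) := [set p | 0 <= p.1 <= 1 /\ 0 <= p.2].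

Definition bdPi : set (R * R) :=
  [set p | Pi p /\ [\/ p.1 = 0, p.1 = 1 | p.2 = 0]].

End Strip.
Arguments Pi {R}.
Arguments bdPi {R}.

Section Characteristics.
Variable R : realType.
Variable aj : R * R -> R.

(* w solves the characteristic equation through p, and stays in Pi, on the
   segment with end points p.1 and xi. *)
Definition char_path (xi : R) (p : R * R) (w : R -> R) : Prop :=
  let J := [set` `[Num.min p.1 xi, Num.max p.1 xi]] in
  w p.1 = p.2 /\
  forall eta, J eta ->
    Pi (eta, w eta) /\
    diff_within J w eta (fun s => s * (1 / aj (eta, w eta))).

Definition char_dom (p : R * R) : set R :=
  [set xi | exists w, char_path xi p w].

(* omega xi (x, t) is omega_j(xi, x, t), for xi in char_dom (x, t). *)
Definition omega (xi : R) (p : R * R) : R :=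
  xget 0 [set s | exists2 w, char_path xi p w & w xi = s].

Definition char_curve (p : R * R) : set (R * R) :=
  [set q | char_dom p q.1 /\ q.2 = omega q.1 p].

(* x_j(x, t): abscissa of the point of least ordinate among the points where
   the characteristic through (x, t) meets the boundary of Pi.  Least ordinate
   (rather than the smaller of two) also makes sense for the characteristic
   that is reduced to a corner of Pi. *)
Definition low_abscissa (p : R * R) : R :=
  xget 0 [set y | char_curve p (y, omega y p) /\ bdPi (y, omega y p) /\
    forall q, char_curve p q -> bdPi q -> omega y p <= q.2].

Definition charfactor (bj : R * R -> R) (xi : R) (p : R * R) : R :=
  expR (oriented_integral
    (fun eta => bj (eta, omega eta p) / aj (eta, omega eta p)) p.1 xi).

End Characteristics.

Section Problem.
Variables (R : realType) (n m : nat).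

Definition out_side (j : 'I_n) : R := if (j < m)%N then 0 else 1.
Definition in_side (j : 'I_n) : R := if (j < m)%N then 1 else 0.

Definition trace_out (phi : R -> 'rV[R]_n) : 'rV[R]_n :=
  \row_j phi (out_side j) 0 j.
Definition trace_in (phi : R -> 'rV[R]_n) : 'rV[R]_n :=
  \row_j phi (in_side j) 0 j.

Definition u_out (u : R * R -> 'rV[R]_n) (t : R) : 'rV[R]_n :=
  trace_out (fun x => u (x, t)).
Definition u_in (u : R * R -> 'rV[R]_n) (t : R) : 'rV[R]_n :=
  trace_in (fun x => u (x, t)).

Variables (a b : 'I_n -> R * R -> R) (h : R * 'rV[R]_n -> 'rV[R]_n).

Definition dom_h : set (R * 'rV[R]_n) := [set p | 0 <= p.1].

(* nabla_xi h; its norm as an element of 'M[R]_n is the max norm. *)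
Definition grad_h (t : R) (xi : 'rV[R]_n) : 'M[R]_n :=
  \matrix_(j, k)
    ('D_(delta_mx 0 k) (fun y : 'rV[R]_n => h (t, y) 0 j : R^o) xi).

(* The first three conditions say that (log log H(|xi|))^(1/4) is defined;
   ln and powR are total functions. *)
Definition growth_condition : Prop :=
  forall T' : R, 0 < T' -> exists (C : R) (H : {poly R}), 0 < C /\
    forall (t : R) (xi : 'rV[R]_n), 0 <= t <= T' ->
      [/\ 0 < H.[`|xi|], 0 < ln H.[`|xi|], 0 <= ln (ln H.[`|xi|]) &
        `|grad_h t xi| <= C * (ln (ln H.[`|xi|])) `^ (4%:R^-1)].

Definition Ch_Pi : set (R * R -> 'rV[R]_n) :=
  [set u : R * R -> 'rV[R]_n | {within Pi, continuous u} /\ u_out u 0 = h (0, u_in u 0)].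

Definition Ch : set (R -> 'rV[R]_n) :=
  [set phi : R -> 'rV[R]_n | {within [set` `[0 : R, 1]], continuous phi} /\
             trace_out phi = h (0, trace_in phi)].

Definition C1h : set (R -> 'rV[R]_n) :=
  [set phi | Ch phi /\ @C1_on R R^o 'rV[R]_n [set` `[0 : R, 1]] phi].

Definition opS (v : R -> 'rV[R]_n) (p : R * R) : 'rV[R]_n :=
  \row_j (charfactor (a j) (b j) (low_abscissa (a j) p) p *
          v (omega (a j) (low_abscissa (a j) p) p) 0 j).

Definition opR (u : R * R -> 'rV[R]_n) (t : R) : 'rV[R]_n := h (t, u_in u t).

Definition opQ (phi : R -> 'rV[R]_n) (u : R * R -> 'rV[R]_n) (p : R * R) :
    'rV[R]_n :=
  \row_j (if low_abscissa (a j) p == out_side j then opS (opR u) p 0 j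
          else charfactor (a j) (b j) (low_abscissa (a j) p) p *
               phi (low_abscissa (a j) p) 0 j).

Definition domQ (phi : R -> 'rV[R]_n) : set (R * R -> 'rV[R]_n) :=
  [set u | Ch_Pi u /\ forall x : R, 0 <= x <= 1 -> u (x, 0) = phi x].

Definition continuous_solution (phi : R -> 'rV[R]_n)
    (u : R * R -> 'rV[R]_n) : Prop :=
  domQ phi u /\ forall p, Pi p -> u p = opQ phi u p.

(* E is the union of the at most countably many exceptional characteristics. *)
Definition piecewise_C1_solution (phi : R -> 'rV[R]_n)
    (u : R * R -> 'rV[R]_n) : Prop :=
  {within Pi, continuous u} /\
  exists K : set ('I_n * (R * R)),
    countable K /\ (forall k, K k -> Pi k.2) /\
    let E := \bigcup_(k in K) char_curve (a k.1) k.2 in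
    (exists du : R * R -> R * R -> 'rV[R]_n,
      C1_off_with Pi E u du /\
      forall p, (Pi `\` E) p -> forall j,
        du p (0, 1) 0 j + a j p * du p (1, 0) 0 j + b j p * u p 0 j = 0) /\
    (forall x : R, 0 <= x <= 1 -> ~ E (x, 0) -> u (x, 0) = phi x) /\
    (forall t : R, 0 <= t -> ~ E (0, t) -> ~ E (1, t) ->
      u_out u t = h (t, u_in u t)).

Definition L2norm (f : R -> 'rV[R]_n) : \bar R :=
  sqrte (\sum_(j < n)
    \int[lebesgue_measure]_(x in [set` `]0%R : R, 1%R[]) ((f x 0 j) ^+ 2)%:E)%E.

Definition L2dist (f g : R -> 'rV[R]_n) : \bar R :=
  L2norm (fun x => f x - g x).

Definition L2 : set (R -> 'rV[R]_n) :=
  [set f : R -> 'rV[R]_n |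
    (forall j, measurable_fun [set` `]0 : R, 1[] (fun x => f x 0 j)) /\
    (L2norm f < +oo)%E].

(* u t is (a representative of) the L^2-valued function u at time t. *)
Definition C_L2 : set (R -> R -> 'rV[R]_n) :=
  [set u : R -> R -> 'rV[R]_n | (forall t : R, 0 <= t -> L2 (u t)) /\
    forall s : R, 0 <= s ->
      (fun t => L2dist (u t) (u s))
        @ within [set t : R | 0 <= t] (nbhs s) --> 0%E].

Definition L2_generalized_solution (phi : R -> 'rV[R]_n)
    (u : R -> R -> 'rV[R]_n) : Prop :=
  C_L2 u /\
  forall (phil : nat -> R -> 'rV[R]_n) (ul : nat -> R * R -> 'rV[R]_n),
    (forall l, C1h (phil l)) ->
    (fun l => L2dist (phil l) phi) @ \oo --> 0%E ->
    (forall l, piecewise_C1_solution (phil l) (ul l)) ->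
    forall T' : R, 0 < T' -> forall e : R, 0 < e ->
      \forall l \near \oo, forall t : R, 0 <= t <= T' ->
        (L2dist (fun x => ul l (x, t)) (u t) <= e%:E)%E.

Definition FTS_L2 : Prop :=
  exists T : R, 0 < T /\
    forall phi u, L2 phi -> L2_generalized_solution phi u ->
      forall t : R, T < t -> L2norm (u t) = 0%E.

Definition FTS_continuous : Prop :=
  exists T : R, 0 < T /\
    forall phi u, Ch phi -> continuous_solution phi u ->
      forall x t : R, 0 <= x <= 1 -> T < t -> u (x, t) = 0.

Definition Qpow_vanishes : Prop :=
  exists (T : R) (k : nat), 0 < T /\
    forall w, Ch_Pi w -> forall x : R, 0 <= x <= 1 ->
      iter k (opQ (fun y => w (y, 0))) w (x, T) = 0.

End Problem.

(* Main.v *)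
(* Extend 1/a_j and b_j/a_j to the plane, so that every characteristic is
   global. Let Th_j(p) be the time at which the j-th characteristic through p
   meets the inflow side, and L_j(p) the integral of b_j/a_j from p to that
   point. Then [Q w]_j = exp(L_j) g_j(Th_j), where g_j(s) is h_j(s, w^in(s))
   for s >= 0 and comes from the initial data for s < 0. Crossing the strip
   takes a time bounded below on [0, T], so for k large Q^k w depends on [0, T]
   only on w(., 0), and it is the solution with these initial data. A solution
   that vanishes at time T has g_j = 0 on the labels of all characteristics
   crossing t = T, and h(t, 0) = 0 propagates this to all later times.

   In the L^2 case, C^1 initial data vanishing near 0 and 1 give C^1 solutions
   and are dense in L^2, so the vanishing of Q^k w(., T) passes to all
   generalized solutions. Conversely, FTS kills at time T the solutions with
   such data. Let phi in C_h be arbitrary. For x outside a countable set the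
   backward tree of characteristics from (x, T) avoids the corners of the strip,
   so u(x, T) only depends on phi at finitely many interior points; replacing
   phi by an interpolating C^1 function that vanishes near 0 and 1 gives
   u(x, T) = 0, and continuity in x does the rest. *)
Require Import Defs.
From HB Require Import structures.
From mathcomp Require Import all_boot all_order all_algebra.
From mathcomp Require Import all_classical all_reals all_analysis.
From mathcomp Require Import measurable_realfun ring lra.
Import Order.TTheory GRing.Theory Num.Theory.
Import numFieldNormedType.Exports.

Set Implicit Arguments.
Unset Strict Implicit.
Unset Printing Implicit Defensive.

Local Open Scope classical_set_scope.
Local Open Scope ring_scope.

(** The definition of [Q] splits Pi along the characteristics issuing from the corners. Labels
    remove the splitting: on the extended plane [Th] and [L] have continuous gradients, and the
    initial data become inflow data at negative labels. Existence, continuity and smoothness of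
    solutions thus turn into statements about functions of one real label, proved by induction over
    time steps that do not exceed a crossing time. The critical label is 0, that of the corner on
    the inflow side: continuity there amounts to the compatibility condition of C_h, and for data
    vanishing near 0 and 1 the inflow is zero around that label, so that no exceptional curve
    arises.

    The other obstacle is the nonlinearity of [h]. The continuous solution with data phi in C_h is
    not known to be the L^2-generalized one, and the proof has no pointwise estimate of how a
    solution depends on its data. Dependence on finitely many points replaces such an estimate:
    there phi is exchanged for smooth data exactly, not approximately. *)

(** * Derivatives, Gronwall's inequality and oriented integrals on the line *)

Section Calculus.
Context {R : realType}.
Implicit Types (f g F G w z : R -> R) (x y t s c d e : R).

(** The epsilon form has the shape of [diff_within], so that derivatives relative to a set can be
    compared with ordinary ones. *)
Lemma is_derive_epsP F t d : is_derive t 1 F d <->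
  forall e, 0 < e -> \forall s \near t, `|F s - F t - d * (s - t)| <= e * `|s - t|.
Proof.
split.
  move=> /is_derive1_caratheodory[g [gE gc <-]] e e0.
  have /cvgrPdist_le/(_ _ e0) := gc.
  apply: filterS => s se.
  by rewrite gE -mulrBl normrM ler_wpM2r// distrC.
move=> H; apply/is_derive1_caratheodory.
exists (fun u : R => if u == t then d else (F u - F t) / (u - t)); split.
- move=> u; case: eqP => [->|/eqP]; first by rewrite !subrr mulr0.
  by rewrite -subr_eq0 => zt; rewrite divfK.
- apply/cvgrPdist_le => e e0; rewrite eqxx.
  have := H _ e0; apply: filterS => s.
  case: eqP => [->|/eqP]; first by move=> _; rewrite subrr normr0 ltW.
  rewrite -subr_eq0 => st sE.
  have st0 : 0 < `|s - t| by rewrite normr_gt0.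
  rewrite -(ler_pM2r st0) -normrM mulrBl divfK// distrC.
  exact: sE.
- by rewrite eqxx.
Qed.

Lemma is_derive_continuous F t d : is_derive t 1 F d -> {for t, continuous F}.
Proof.
by move=> h; apply/differentiable_continuous/derivable1_diffP.
Qed.

Lemma diff_within_is_derive (J : set R) w t d : nbhs t J ->
  @diff_within R R^o R^o J w t (fun s => s * d) -> is_derive t 1 w d.
Proof.
move=> Jt H; apply/is_derive_epsP => e /H.
rewrite /diff_within near_withinE => h.
near=> s.
have -> : d * (s - t) = (s - t) * d by rewrite mulrC.
by apply: (near h s) => //; apply: (near Jt s).
Unshelve. all: by end_near. Qed.

Lemma diff_within_continuous (J : set R) w t d : J t ->
  @diff_within R R^o R^o J w t (fun s => s * d) ->
  w @ within J (nbhs t) --> w t.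
Proof.
move=> Jt H; apply/cvgrPdist_le => e e0.
have h1 := H _ (ltr01 : (0 : R) < 1).
have d0 : 0 < `|d| + 1 by rewrite ltr_pwDr.
have h2 : \forall q \near within J (nbhs t), `|q - t| <= e / (`|d| + 1).
  apply: cvg_within; near=> q; rewrite distrC.
  near: q; apply: cvgr_dist_le; first exact: cvg_id.
  by rewrite divr_gt0.
near=> q.
have q1 : `|w q - w t - (q - t) * d| <= `|q - t|.
  by rewrite -[leRHS]mul1r; near: q; exact: h1.
have q2 : `|q - t| <= e / (`|d| + 1) by near: q; exact: h2.
have : `|w q - w t| <= `|q - t| * (`|d| + 1).
  rewrite -[w q - w t](subrK ((q - t) * d)) mulrDr mulr1 addrC.
  by rewrite (le_trans (ler_normD _ _))// normrM lerD.
rewrite distrC => /le_trans; apply.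
by rewrite -ler_pdivlMr.
Unshelve. all: by end_near. Qed.

(** [G + F] and [G - F] have nonnegative derivatives. A general majorant [G], instead of a linear
    one, lets the Picard estimate use an exponential weight. *)
Lemma ler_dist_derive F G (f g : R -> R) x y : x <= y ->
  (forall s, x <= s <= y -> is_derive s 1 F (f s)) ->
  (forall s, x <= s <= y -> is_derive s 1 G (g s)) ->
  (forall s, x <= s <= y -> `|f s| <= g s) ->
  `|F y - F x| <= G y - G x.
Proof.
move=> xy dF dG fg.
have inP s : s \in `]x, y[%R -> x <= s <= y.
  by rewrite in_itv/= => /andP[a b]; rewrite !ltW.
have mono (H : R -> R) (h : R -> R) :
    (forall s, x <= s <= y -> is_derive s 1 H (h s)) ->
    (forall s, x <= s <= y -> 0 <= h s) -> H x <= H y.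
  move=> dH h0.
  have cH : {within `[x, y], continuous H}.
    apply: continuous_in_subspaceT => s; rewrite inE/= in_itv/= => sxy.
    exact: is_derive_continuous (dH _ sxy).
  have [c cxy Hc] := MVT_segment xy (fun s h => dH s (inP s h)) cH.
  - rewrite -subr_ge0 Hc mulr_ge0 ?subr_ge0//.
    by apply: h0; move: cxy; rewrite in_itv.
rewrite ler_norml; apply/andP; split.
- have := mono (F + G) (fun s => f s + g s).
  move=> /(_ (fun s h => is_deriveD (dF _ h) (dG _ h))) /=.
  have h0 s : x <= s <= y -> 0 <= f s + g s.
    by move=> /fg; rewrite ler_norml => /andP[]; rewrite -subr_ge0 opprK.
  by move=> /(_ h0); rewrite !fctE; lra.
- have := mono (G - F) (fun s => g s - f s).
  move=> /(_ (fun s h => is_deriveB (dG _ h) (dF _ h))) /=.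
  have h0 s : x <= s <= y -> 0 <= g s - f s.
    by move=> /fg; rewrite ler_norml => /andP[_]; rewrite -subr_ge0.
  by move=> /(_ h0); rewrite !fctE; lra.
Qed.

Lemma is_derive_within_nincr (a b : R) (F f : R -> R) :
  {within `[a, b], continuous F} ->
  (forall s, a < s < b -> is_derive s 1 F (f s)) ->
  (forall s, a < s < b -> f s <= 0) ->
  forall x y, a <= x -> x <= y -> y <= b -> F y <= F x.
Proof.
move=> cF dF f0; apply: ler0_derive1_nincr => //.
- by move=> s; rewrite in_itv/= => /dF[].
- move=> s; rewrite in_itv/= => h; rewrite derive1E.
  by have [_ ->] := dF _ h; exact: f0.
Qed.

(* [z] is only required to be continuous at the end points of the interval, as
   happens for a path defined on that interval. *)
Lemma gronwall (a b L : R) (z z' : R -> R) :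
  {within `[a, b], continuous z} ->
  (forall s, a < s < b -> is_derive s 1 z (z' s)) ->
  (forall s, a < s < b -> `|z' s| <= L * `|z s|) ->
  forall x y, a <= x <= b -> a <= y <= b ->
  `|z y| <= `|z x| * expR (L * `|y - x|).
Proof.
move=> cz dz zL.
have cE (k : R) : {within `[a, b], continuous (fun s => expR (k * s))}.
  apply: continuous_subspaceT => s.
  apply: (@continuous_comp _ _ _ (fun s : R => k * s) (@expR R)); last exact: continuous_expR.
  exact: mulrl_continuous.
(* The square of [z] replaces its absolute value, which need not be differentiable at a zero. With
   the weight exp(-2Ls) it decreases, with exp(2Ls) it increases. *)
have key (k : R) : {within `[a, b], continuous (fun s => z s * z s * expR (k * s))}.
  move=> s; apply: cvgM; last exact: cE.
  by apply: cvgM; exact: cz.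
have dE (k s : R) : is_derive s (1 : R) (fun u : R => expR (k * u)) (expR (k * s) * k).
  apply: (@is_derive1_comp _ (@expR R) (fun u : R => k * u)).
  have := @is_deriveZ _ _ _ (@id R) k s 1 1 (is_derive_id _ _).
  by rewrite /GRing.scale/= mulr1.
have dk (k s : R) : a < s < b ->
   is_derive s (1:R) (fun u : R => z u * z u * expR (k * u))
     ((2 * z s * z' s + k * (z s * z s)) * expR (k * s)).
  move=> h.
  have := is_deriveM (is_deriveM (dz _ h) (dz _ h)) (dE k s).
  move=> H; apply: is_derive_eq H _.
  by rewrite /GRing.scale/= !fctE; ring.
have bd s : a < s < b -> `|2 * z s * z' s| <= 2 * L * (z s * z s).
  move=> h; rewrite !normrM ger0_norm//.
  have -> : z s * z s = `|z s| * `|z s| by rewrite -normrM ger0_norm// -expr2 sqr_ge0.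
  by have := zL _ h; have := normr_ge0 (z s); nra.
have fin (x y : R) : z y * z y <= z x * z x * expR (2 * L * `|y - x|) ->
    `|z y| <= `|z x| * expR (L * `|y - x|).
  move=> h; rewrite -(@ler_pXn2r _ 2)// ?nnegrE ?mulr_ge0 ?expR_ge0// exprMn.
  have -> : expR (L * `|y - x|) ^+ 2 = expR (2 * L * `|y - x|).
    by rewrite expr2 -expRD; congr expR; ring.
  by rewrite !real_normK ?num_real// !expr2.
have aux (A B k x y : R) :
    A * expR (k * y) <= B * expR (k * x) -> A <= B * expR (k * (x - y)).
  by rewrite mulrBr expRD expRN mulrA ler_pdivlMr ?expR_gt0.
move=> x y /andP[ax xb] /andP[ay yb]; apply: fin.
have [xy|/ltW yx] := leP x y.
- have := is_derive_within_nincr (key (- (2 * L))) (fun s h => dk _ s h).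
  move=> /(_ _ x y ax xy yb) h.
  have : z y * z y * expR (- (2 * L) * y) <= z x * z x * expR (- (2 * L) * x).
    apply: h => s h; rewrite pmulr_lle0 ?expR_gt0//.
    by have := bd _ h; rewrite ler_norml => /andP[_]; nra.
  by move=> /aux; rewrite ger0_norm ?subr_ge0// mulNr -mulrN opprB.
- have := is_derive_within_nincr (F := fun s => - (z s * z s * expR (2 * L * s)))
    (f := fun s => - ((2 * z s * z' s + (2 * L) * (z s * z s)) * expR ((2 * L) * s))).
  move=> /(_ a b _ (fun s h => is_deriveN (dk _ s h)) _ y x ay yx xb) h.
  have : - (z x * z x * expR (2 * L * x)) <= - (z y * z y * expR (2 * L * y)).
    apply: h; first by move=> s; apply: cvgN; exact: key.
    move=> s h; rewrite oppr_le0 mulr_ge0 ?expR_ge0//.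
    by have := bd _ h; rewrite ler_norml => /andP[+ _]; nra.
  by rewrite lerN2 => /aux; rewrite ler0_norm ?subr_le0// opprB.
Qed.

Lemma oriented_integral_ext f g x y :
  (forall s, Num.min x y <= s <= Num.max x y -> f s = g s) ->
  oriented_integral f x y = oriented_integral g x y.
Proof.
move=> fg; rewrite /oriented_integral; case: ifPn => [xy|].
  apply: eq_Rintegral => s; rewrite inE/= in_itv/= => h; apply: fg.
  by rewrite (min_idPl xy) (max_idPr xy).
rewrite -ltNge => /ltW yx; congr (- _).
apply: eq_Rintegral => s; rewrite inE/= in_itv/= => h; apply: fg.
by rewrite (min_idPr yx) (max_idPl yx).
Qed.

Lemma oriented_integral_base g a x y : continuous g -> a <= x -> a <= y ->
  oriented_integral g x y =
  (\int[lebesgue_measure]_(s in `[a, y]) g s -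
   \int[lebesgue_measure]_(s in `[a, x]) g s)%R.
Proof.
move=> cg ax ay.
have ig u v : lebesgue_measure.-integrable `[u, v] (EFin \o g).
  apply: continuous_compact_integrable; first exact: segment_compact.
  exact: continuous_subspaceT.
have main u v : a <= u -> u <= v ->
  (\int[lebesgue_measure]_(s in `[u, v]) g s =
   \int[lebesgue_measure]_(s in `[a, v]) g s -
   \int[lebesgue_measure]_(s in `[a, u]) g s)%R.
  move=> au uv; rewrite (@Rintegral_itvB _ g (BLeft a) (BRight v) u)//.
  rewrite Rintegral_itv_obnd_cbnd//.
  apply: integrableS (ig u v) => //.
  by move=> s/=; rewrite !in_itv/= => /andP[/ltW -> ->].
rewrite /oriented_integral; case: ifPn => [xy|]; first exact: main.
by rewrite -ltNge => /ltW yx; rewrite main// opprB.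
Qed.

Definition primitive g : R -> R := oriented_integral g 0.

Lemma oriented_integralE g x y : continuous g ->
  oriented_integral g x y = primitive g y - primitive g x.
Proof.
move=> cg; pose a := Num.min 0 (Num.min x y).
have [a0 ax ay] : [/\ a <= 0, a <= x & a <= y].
  by rewrite !ge_min !lexx ?orbT.
rewrite /primitive (oriented_integral_base cg ax ay).
rewrite (oriented_integral_base cg a0 ax) (oriented_integral_base cg a0 ay).
by rewrite opprB addrA subrK.
Qed.

Lemma is_derive_primitive g x : continuous g -> is_derive x 1 (primitive g) (g x).
Proof.
(* The fundamental theorem needs a fixed left end strictly before [x]; staying below 0 as well makes
   the change of base point from 0 a constant. *)
move=> cg; pose a := Num.min 0 x - 1.
have a0 : a <= 0 by rewrite /a lerBlDr ge_min add0r ler01.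
have ax : a < x by rewrite /a ltrBlDr (@le_lt_trans _ _ x) ?ge_min ?lexx ?orbT// ltrDl.
have ig : lebesgue_measure.-integrable `[a, x + 1] (EFin \o g).
  apply: continuous_compact_integrable; first exact: segment_compact.
  exact: continuous_subspaceT.
have xx1 : x < x + 1 by rewrite ltrDl.
have [dF F'] := continuous_FTC1_closed xx1 ig ax (cg x).
pose F y := (\int[lebesgue_measure]_(s in `[a, y]) g s)%R.
have FD : is_derive x 1 (fun y => F y - F 0) (g x).
  have h : is_derive x 1 F (g x) by apply: DeriveDef; rewrite -?derive1E.
  by have := is_deriveB h (is_derive_cst (F 0) x 1); rewrite subr0.
apply: near_eq_is_derive FD; near=> y.
rewrite /primitive (oriented_integral_base cg a0)//.
by near: y; exact: (@cvgr_ge _ _ _ _ id x cvg_id).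
Unshelve. all: by end_near. Qed.

End Calculus.

Section Tube.
Context {R : realType}.

(** Compactness of the segment makes the closeness uniform in the first variable. *)
Lemma tube (T : topologicalType) (g : R * T -> R) (p : T) (c d e : R) :
  continuous g -> 0 < e ->
  \forall q \near p, forall s, c <= s <= d -> `|g (s, q) - g (s, p)| <= e.
Proof.
move=> cg e0.
have /compact_near_coveringP/(_ _ (nbhs p)
    (fun q s => `|g (s, q) - g (s, p)| <= e)) := @segment_compact R c d.
move=> /(_ _ _)/[!near_simpl] h.
have H (x : R) : `[c, d]%classic x ->
    \forall x' \near x & i \near p, `|g (x', i) - g (x', p)| <= e.
  move=> _.
  have e2 : 0 < e / 2 by rewrite divr_gt0.
  have /cvgrPdist_le/(_ _ e2) h1 := cg (x, p).
  have [[A B] /= [Ax Bp] AB] := h1.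
  exists (A, B) => // -[x' i] [/= Ax' Bi].
  have hh1 : `|g (x, p) - g (x', i)| <= e / 2 by apply: (AB (x', i)).
  have hh2 : `|g (x, p) - g (x', p)| <= e / 2.
    by apply: (AB (x', p)); split => //=; exact: nbhs_singleton.
  rewrite -[leLHS]normrN opprB.
  have -> : g (x', p) - g (x', i) =
      (g (x, p) - g (x', i)) - (g (x, p) - g (x', p)) by lra.
  by rewrite (le_trans (ler_normB _ _))// [leRHS]splitr lerD.
have := h H; apply: filterS => q hq s hs; apply: hq.
by rewrite /= in_itv.
Unshelve. all: by end_near. Qed.

End Tube.

Section Misc.
Context {R : realType}.

Lemma continuous_pair (T U V : topologicalType) (g : T -> U) (h : T -> V) (x : T) :
  {for x, continuous g} -> {for x, continuous h} ->
  {for x, continuous (fun y => (g y, h y))}.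
Proof. by move=> cg ch; exact: cvg_pair cg ch. Qed.

Lemma geometric_squeeze (x C : R) : (forall n, `|x| <= C * 2^-1 ^+ n) -> x = 0.
Proof.
move=> h; apply/eqP; rewrite -normr_eq0 eq_le normr_ge0 andbT leNgt.
apply/negP => x0.
have C0 : 0 <= C by have := h 0%N; rewrite expr0 mulr1; exact: le_trans.
have := archi_boundP (divr_ge0 C0 (ltW x0)); set N := Num.bound _.
rewrite ltr_pdivrMr// => CN.
have := h N; rewrite exprVn ler_pdivlMr ?exprn_gt0// => h1.
rewrite leNgt in h1; move/negP: h1; apply.
rewrite mulrC (lt_le_trans CN)// ler_wpM2r// -natrX ler_nat ltnW//.
exact: ltn_expl.
Qed.

(** With [g n] the tail of the geometric series, [v n - g n] increases, [v n + g n] decreases, and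
    the limit is the supremum of the former. *)
Lemma geometric_limit (v : nat -> R) (B : R) :
  (forall n, `|v n.+1 - v n| <= B * 2^-1 ^+ n) ->
  exists l, forall n, `|l - v n| <= (2 * B) * 2^-1 ^+ n.
Proof.
move=> h; pose g n : R := (2 * B) * 2^-1 ^+ n.
have gS n : g n - g n.+1 = B * 2^-1 ^+ n by rewrite /g exprS; lra.
have B0 : 0 <= B by have := h 0%N; rewrite expr0 mulr1; exact: le_trans.
have g0 n : 0 <= g n by rewrite !mulr_ge0// exprn_ge0.
have up n m : v (n + m)%N + g (n + m)%N <= v n + g n.
  elim: m => [|m IH]; first by rewrite addn0.
  rewrite addnS (le_trans _ IH)//.
  by have := h (n + m)%N; rewrite -gS ler_norml => /andP[_]; lra.
have dn n m : v n - g n <= v (n + m)%N - g (n + m)%N.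
  elim: m => [|m IH]; first by rewrite addn0.
  rewrite addnS (le_trans IH)//.
  by have := h (n + m)%N; rewrite -gS ler_norml => /andP[+ _]; lra.
have cross n m : v n - g n <= v m + g m.
  have [/subnKC <-|/ltnW/subnKC <-] := leqP n m.
    by rewrite (le_trans (dn _ (m - n)%N))// lerD2l (@le_trans _ _ 0)// oppr_le0.
  by rewrite (le_trans _ (up _ (n - m)%N))// lerD2l (@le_trans _ _ 0)// oppr_le0.
pose S := [set x | exists n, x = v n - g n].
have S0 : S !=set0 by exists (v 0%N - g 0%N), 0%N.
have Sb : has_ubound S.
  by exists (v 0%N + g 0%N) => _ [n ->]; exact: cross.
exists (sup S) => n; rewrite ler_distl; apply/andP; split.
  by apply: ub_le_sup => //; exists n.
by apply: ge_sup => // _ [m ->]; exact: cross.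
Qed.

Lemma lipschitz_continuous (w : R -> R) (M : R) :
  (forall x y, `|w x - w y| <= M * `|x - y|) -> continuous w.
Proof.
move=> h x; apply/cvgrPdist_le => e e0.
have M1 : 0 < `|M| + 1 by rewrite ltr_pwDr.
near=> y; rewrite (le_trans (h _ _))//.
have : `|x - y| <= e / (`|M| + 1).
  by near: y; apply: cvgr_dist_le; [exact: cvg_id|rewrite divr_gt0].
rewrite ler_pdivlMr// mulrC; apply: le_trans.
rewrite ler_wpM2r// (le_trans (ler_norm _))// lerDl//.
Unshelve. all: by end_near. Qed.

Lemma ler_dist_derive_abs (F G f g : R -> R) (x y : R) :
  (forall s, Num.min x y <= s <= Num.max x y -> is_derive s 1 F (f s)) ->
  (forall s, Num.min x y <= s <= Num.max x y -> is_derive s 1 G (g s)) ->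
  (forall s, Num.min x y <= s <= Num.max x y -> `|f s| <= g s) ->
  `|F y - F x| <= `|G y - G x|.
Proof.
move=> dF dG fg; have [xy|/ltW yx] := leP x y.
  rewrite (min_idPl xy) (max_idPr xy) in dF dG fg.
  by rewrite (le_trans (ler_dist_derive xy dF dG fg))// ler_norm.
rewrite (min_idPr yx) (max_idPl yx) in dF dG fg.
rewrite distrC [leRHS]distrC.
by rewrite (le_trans (ler_dist_derive yx dF dG fg))// ler_norm.
Qed.

Lemma ler_dist_derive_cst (F f : R -> R) (M x y : R) :
  (forall s, Num.min x y <= s <= Num.max x y -> is_derive s 1 F (f s)) ->
  (forall s, Num.min x y <= s <= Num.max x y -> `|f s| <= M) ->
  `|F y - F x| <= M * `|y - x|.
Proof.
move=> dF fM; have M0 : 0 <= M.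
  have h : Num.min x y <= x <= Num.max x y by rewrite ge_min le_max !lexx.
  exact: le_trans (normr_ge0 _) (fM _ h).
have dG (s : R) : is_derive s (1 : R) (fun u : R => M * u) M.
  have := @is_deriveZ _ _ _ (@id R) M s 1 1 (is_derive_id _ _).
  by rewrite /GRing.scale/= mulr1.
have := ler_dist_derive_abs dF (fun s _ => dG s) fM.
by rewrite -mulrBr normrM ger0_norm.
Qed.

Lemma norm_between (x y s r : R) : `|x| <= r -> `|y| <= r ->
  Num.min x y <= s <= Num.max x y -> `|s| <= r.
Proof.
rewrite !ler_norml => /andP[a b] /andP[c d] /andP[e f]; apply/andP; split.
  by rewrite (le_trans _ e)// le_min a c.
by rewrite (le_trans f)// ge_max b d.
Qed.

Lemma dist_between (x y s : R) :
  Num.min x y <= s <= Num.max x y -> `|s - x| <= `|y - x|.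
Proof.
have [xy|yx] := leP x y => /andP[a b].
  by rewrite !ger0_norm ?subr_ge0// lerD2r.
by rewrite !ler0_norm ?subr_le0 ?(ltW yx)// !opprB lerD2l lerN2.
Qed.

Lemma bounded_rectangle (k : R * R -> R) (r : R) : continuous k ->
  exists2 L, 0 < L & forall x t, `|x| <= r -> `|t| <= r -> `|k (x, t)| <= L.
Proof.
move=> ck.
have cK : compact (`[- r, r] `*` `[- r, r] : set (R * R)).
  by apply: compact_setX; exact: segment_compact.
have /continuous_compact/(_ cK)/compact_bounded[L [_ hL]] :
    {within `[- r, r] `*` `[- r, r], continuous k} by exact: continuous_subspaceT.
exists (`|L| + 1) => [|x t xr tr]; first by rewrite ltr_pwDr.
apply: hL; first by rewrite (le_lt_trans (ler_norm _))// ltrDl.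
exists (x, t) => //=; rewrite !in_itv/=.
by rewrite -!ler_norml.
Qed.

End Misc.

(** * Global solutions of scalar differential equations *)

Section Ode.
Context {R : realType}.
Variables (f k : R * R -> R) (M : R).
Hypothesis f_cont : continuous f.
Hypothesis k_cont : continuous k.
Hypothesis f_deriv : forall x t : R, is_derive t 1 (fun s => f (x, s)) (k (x, t)).
Hypothesis f_le : forall p, `|f p| <= M.

Lemma f_lipschitz (r : R) : exists2 L, 0 < L &
  forall x s t, `|x| <= r -> `|s| <= r -> `|t| <= r ->
    `|f (x, s) - f (x, t)| <= L * `|s - t|.
Proof.
have [L L0 kL] := bounded_rectangle r k_cont; exists L => // x s t xr sr tr.
rewrite distrC [`|s - t|]distrC.
apply: (ler_dist_derive_cst (f := fun u => k (x, u))) => u us //.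
by apply: kL => //; exact: (norm_between sr tr us).
Qed.

Lemma continuous_along (g : R * R -> R) (w : R -> R) :
  continuous g -> continuous w -> continuous (fun s => g (s, w s)).
Proof.
move=> cg cw s; apply: (@continuous_comp _ _ _ (fun s => (s, w s)) g); last exact: cg.
apply: (@continuous_pair R R R id w s); [exact: cvg_id|exact: cw].
Qed.

Section Picard.
Variables (x0 t0 : R).

Fixpoint picard n : R -> R :=
  if n is m.+1
  then fun x => t0 + oriented_integral (fun s => f (s, picard m s)) x0 x
  else fun=> t0.

(** The global bound on [f] gives all iterates the same Lipschitz constant. Over a bounded range of
    abscissas they stay in one rectangle, where [f_lipschitz] provides a single constant. *)
Lemma picard_lip n x y : `|picard n x - picard n y| <= M * `|x - y|.
Proof.
have M0 : 0 <= M by exact: le_trans (normr_ge0 _) (f_le 0).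
elim: n x y => [|n IH] x y /=; first by rewrite subrr normr0 mulr_ge0.
have cn : continuous (fun s => f (s, picard n s)).
  by apply: continuous_along => //; exact: lipschitz_continuous IH.
rewrite !oriented_integralE// opprD addrACA subrr add0r opprB addrA subrK.
apply: (ler_dist_derive_cst (f := fun s => f (s, picard n s))) => s _ //.
exact: is_derive_primitive.
Qed.

Lemma picard_cont n : continuous (picard n).
Proof. exact: lipschitz_continuous (picard_lip n). Qed.

Lemma picard_along n : continuous (fun s => f (s, picard n s)).
Proof. by apply: continuous_along => //; exact: picard_cont. Qed.

Lemma picard_init n : picard n x0 = t0.
Proof.
by case: n => //= n; rewrite oriented_integralE ?subrr ?addr0//; exact: picard_along.
Qed.

Lemma is_derive_shift_primitive (g : R -> R) (x : R) : continuous g ->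
  is_derive x 1 (fun y => t0 + oriented_integral g x0 y) (g x).
Proof.
move=> cg.
have := is_deriveD (is_derive_cst (t0 - primitive g x0) x 1) (is_derive_primitive x cg).
rewrite add0r; apply: near_eq_is_derive; near=> y.
by rewrite /= oriented_integralE// addrA addrAC.
Unshelve. all: by end_near. Qed.

Lemma picard_deriv n (x : R) : is_derive x 1 (picard n.+1) (f (x, picard n x)).
Proof. exact: (is_derive_shift_primitive x (@picard_along n)). Qed.

(* The weight [exp (2L(x-x0)) + exp (-2L(x-x0))] makes the Picard map a
   contraction of ratio 1/2, on both sides of [x0]. *)
Lemma picard_step (rho : R) : 0 <= rho -> exists B : R,
  forall n x, `|x - x0| <= rho ->
    `|picard n.+1 x - picard n x| <= B * 2^-1 ^+ n.
Proof.
move=> rho0.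
have M0 : 0 <= M by exact: le_trans (normr_ge0 _) (f_le 0).
pose r := `|x0| + `|t0| + rho + M * rho.
have Mr : 0 <= M * rho by exact: mulr_ge0.
have [L L0 fL] := f_lipschitz r.
have inr x : `|x - x0| <= rho -> `|x| <= r.
  move=> h; rewrite -[x](subrK x0) (le_trans (ler_normD _ _))//.
  by rewrite /r; have := normr_ge0 t0; have := normr_ge0 x0; lra.
have pr n x : `|x - x0| <= rho -> `|picard n x| <= r.
  move=> h; rewrite -[picard n x](subrK t0) (le_trans (ler_normD _ _))//.
  have := picard_lip n x x0; rewrite picard_init => h1.
  have : M * `|x - x0| <= M * rho by rewrite ler_wpM2l.
  by rewrite /r; have := normr_ge0 t0; have := normr_ge0 x0; lra.
pose V x : R := expR (2 * L * (x - x0)) - expR (- (2 * L) * (x - x0)).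
pose W x : R := expR (2 * L * (x - x0)) + expR (- (2 * L) * (x - x0)).
have dE (c x : R) : is_derive x (1 : R) (fun y : R => expR (c * (y - x0))) (expR (c * (x - x0)) * c).
  apply: (@is_derive1_comp _ (@expR R) (fun y : R => c * (y - x0))).
  have h1 := is_deriveB (is_derive_id x (1 : R)) (is_derive_cst x0 x (1 : R)).
  have := is_deriveZ c h1.
  by rewrite /GRing.scale/= subr0 mulr1.
have dV (x : R) : is_derive x 1 V (2 * L * W x).
  have := is_deriveB (dE (2 * L) x) (dE (- (2 * L)) x) => h.
  by apply: is_derive_eq h _; rewrite /W; ring.
have VW x : `|V x| <= W x.
  rewrite /V /W ler_norml; have := expR_gt0 (2 * L * (x - x0)).
  by have := expR_gt0 (- (2 * L) * (x - x0)); lra.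
have V0 : V x0 = 0 by rewrite /V subrr !mulr0 subrr.
have W1 x : 1 <= W x.
  rewrite /W; have [h|/ltW h] := leP 0 (x - x0).
    have : 1 <= expR (2 * L * (x - x0)).
      by rewrite -expR0 ler_expR !mulr_ge0// ltW.
    by have := expR_gt0 (- (2 * L) * (x - x0)); lra.
  have : 1 <= expR (- (2 * L) * (x - x0)).
    by rewrite -expR0 ler_expR mulNr -mulrN !mulr_ge0// ?oppr_ge0// ltW.
  by have := expR_gt0 ((2 * L) * (x - x0)); lra.
have key n x : `|x - x0| <= rho ->
    `|picard n.+1 x - picard n x| <= (M * rho) * 2^-1 ^+ n * W x.
  elim: n x => [|n IH] x xr.
    have := picard_lip 1 x x0; rewrite picard_init expr0 mulr1 => h.
    rewrite (le_trans h)// (@le_trans _ _ (M * rho))//; first by rewrite ler_wpM2l.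
    by rewrite ler_peMr.
  pose D y := picard n.+2 y - picard n.+1 y.
  have dD (y : R) : is_derive y 1 D (f (y, picard n.+1 y) - f (y, picard n y)).
    by apply: is_deriveB; exact: picard_deriv.
  have D0 : D x0 = 0 by rewrite /D !picard_init subrr.
  (* Since [V] has derivative [2 * L * W], the Lipschitz bound for the derivative of [D] is exactly
     the derivative of [c * V]; the factor 2 gives the ratio 1/2. *)
  pose c : R := (M * rho) * 2^-1 ^+ n / 2.
  have c0 : 0 <= c by rewrite !mulr_ge0// exprn_ge0.
  have dcV (y : R) : is_derive y 1 (fun y => c * V y) (c * (2 * L * W y)).
    exact: (is_deriveZ c (dV y)).
  have := ler_dist_derive_abs (x := x0) (y := x) (fun y _ => dD y) (fun y _ => dcV y).
  rewrite D0 V0 mulr0 !subr0 normrM (ger0_norm c0) => h.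
  have -> : M * rho * 2^-1 ^+ n.+1 = c by rewrite exprS /c; lra.
  rewrite (le_trans (h _))// => [y yx|]; last by rewrite ler_wpM2l.
  have yr : `|y - x0| <= rho by rewrite (le_trans (dist_between yx)).
  rewrite (le_trans (fL _ _ _ (inr _ yr) (pr _ _ yr) (pr _ _ yr)))//.
  have -> : c * (2 * L * W y) = L * (M * rho * 2^-1 ^+ n * W y).
    by rewrite /c; field.
  by rewrite ler_wpM2l ?(ltW L0)// IH.
exists (M * rho * (2 * expR (2 * L * rho))) => n x xr.
rewrite (le_trans (key _ _ xr))// mulrAC ler_wpM2r ?exprn_ge0//.
rewrite ler_wpM2l// /W; set c := 2 * L.
have -> : 2 * expR (c * rho) = expR (c * rho) + expR (c * rho) by lra.
have c0 : 0 < c by rewrite mulr_gt0.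
move: xr; rewrite ler_norml => /andP[a b].
apply: lerD; rewrite ler_expR.
  by rewrite ler_pM2l.
by rewrite mulNr -mulrN ler_pM2l// lerNl.
Qed.

Lemma ode_exists : exists w : R -> R,
  w x0 = t0 /\ forall x : R, is_derive x 1 w (f (x, w x)).
Proof.
have M0 : 0 <= M by exact: le_trans (normr_ge0 _) (f_le 0).
have lim x : exists l, exists C, forall n, `|l - picard n x| <= C * 2^-1 ^+ n.
  have [B hB] := picard_step (normr_ge0 (x - x0)).
  by have [l hl] := geometric_limit (fun n => hB n x (lexx _)); exists l, (2 * B).
pose w x := projT1 (cid (lim x)).
have wC x : exists C, forall n, `|w x - picard n x| <= C * 2^-1 ^+ n.
  by rewrite /w; case: cid.
have uniq x l C : (forall n, `|l - picard n x| <= C * 2^-1 ^+ n) -> l = w x.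
  move=> h; have [C' h'] := wC x; apply/subr0_eq.
  apply: (@geometric_squeeze _ _ (C + C')) => n.
  have -> : l - w x = (l - picard n x) - (w x - picard n x) by lra.
  by rewrite (le_trans (ler_normB _ _))// mulrDl lerD.
have wlip x y : `|w x - w y| <= M * `|x - y|.
  have [C hC] := wC x; have [C' hC'] := wC y.
  apply/ler_addgt0Pr => e e0.
  have [n hn] : exists n, (C + C') * 2^-1 ^+ n <= e.
    apply: contrapT => /forallNP H.
    have : e = 0; last by move=> e00; rewrite e00 ltxx in e0.
    apply: (@geometric_squeeze _ _ (C + C')) => n; rewrite gtr0_norm//.
    by have /negP := H n; rewrite -ltNge => /ltW.
  have -> : w x - w y = (picard n x - picard n y) + ((w x - picard n x) - (w y - picard n y)) by lra.
  rewrite (le_trans (ler_normD _ _))// lerD ?picard_lip//.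
  by rewrite (le_trans (ler_normB _ _))// (le_trans _ hn)// mulrDl lerD.
have wc := lipschitz_continuous wlip.
have fwc : continuous (fun s => f (s, w s)) by exact: continuous_along.
(* The defect of the integral equation is geometrically small: it is the distance from [w] to the
   iterate n + 1, plus the integral of the Lipschitz bound for the distance to the iterate n. *)
have wE x : w x = t0 + oriented_integral (fun s => f (s, w s)) x0 x.
  pose rho := `|x - x0|; have rho0 : 0 <= rho by exact: normr_ge0.
  have [B hB] := picard_step rho0.
  have wB n y : `|y - x0| <= rho -> `|w y - picard n y| <= 2 * B * 2^-1 ^+ n.
    move=> yr; have [l hl] := geometric_limit (fun n => hB n y yr).
    by rewrite -(uniq _ _ _ hl).
  pose r := `|x0| + `|t0| + rho + M * rho.
  have Mr : 0 <= M * rho by exact: mulr_ge0.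
  have [L L0 fL] := f_lipschitz r.
  have inr y : `|y - x0| <= rho -> `|y| <= r.
    move=> h; rewrite -[y](subrK x0) (le_trans (ler_normD _ _))//.
    by rewrite /r; have := normr_ge0 t0; have := normr_ge0 x0; lra.
  have w0 : w x0 = t0.
    by apply/esym; apply: (uniq _ _ 0) => n; rewrite picard_init subrr normr0 mul0r.
  have br (v : R -> R) y : v x0 = t0 -> (forall x y, `|v x - v y| <= M * `|x - y|) ->
      `|y - x0| <= rho -> `|v y| <= r.
    move=> v0 vl h; rewrite -[v y](subrK t0) (le_trans (ler_normD _ _))//.
    have := vl y x0; rewrite v0 => h1.
    have : M * `|y - x0| <= M * rho by rewrite ler_wpM2l.
    by rewrite /r; have := normr_ge0 t0; have := normr_ge0 x0; lra.
  apply/subr0_eq/(@geometric_squeeze _ _ (B + L * (2 * B) * rho)) => n.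
  have -> : w x - (t0 + oriented_integral (fun s => f (s, w s)) x0 x) =
    (w x - picard n.+1 x) +
    ((primitive (fun s => f (s, picard n s)) x - primitive (fun s => f (s, w s)) x) -
     (primitive (fun s => f (s, picard n s)) x0 - primitive (fun s => f (s, w s)) x0)).
    by rewrite /= !oriented_integralE//; [lra|exact: picard_along].
  rewrite (le_trans (ler_normD _ _))// mulrDl lerD//.
    by rewrite (le_trans (wB _ _ (lexx _)))// exprS; lra.
  have -> : L * (2 * B) * rho * 2^-1 ^+ n = (L * (2 * B * 2^-1 ^+ n)) * `|x - x0|.
    by rewrite /rho; ring.
  apply: (ler_dist_derive_cst
    (F := fun y => primitive (fun s => f (s, picard n s)) y - primitive (fun s => f (s, w s)) y)
    (f := fun y => f (y, picard n y) - f (y, w y))) => y yx.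
    by apply: is_deriveB; apply: is_derive_primitive => //; exact: picard_along.
  have yr : `|y - x0| <= rho by exact: dist_between yx.
  rewrite (le_trans (fL _ _ _ (inr _ yr) _ _))//.
  - by apply: br => //; [exact: picard_init|exact: picard_lip].
  - exact: br.
  - by rewrite ler_pM2l// distrC wB.
exists w; split; first by rewrite wE oriented_integralE// subrr addr0.
move=> x; have := is_derive_shift_primitive x fwc.
by apply: near_eq_is_derive; near=> y; rewrite [RHS]wE.
Unshelve. all: by end_near. Qed.

End Picard.

(** Gronwall for the difference of the solutions. Only continuity is asked at the end points,
    because a [char_path] has one-sided derivatives there. *)
Lemma ode_unique (c d : R) (w1 w2 : R -> R) :
  {within `[c, d], continuous w1} -> {within `[c, d], continuous w2} ->
  (forall x : R, c < x < d -> is_derive x 1 w1 (f (x, w1 x))) ->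
  (forall x : R, c < x < d -> is_derive x 1 w2 (f (x, w2 x))) ->
  forall x y, c <= x <= d -> c <= y <= d -> w1 x = w2 x -> w1 y = w2 y.
Proof.
move=> c1 c2 d1 d2 x y xcd ycd w12.
have cd : c <= d by case/andP: xcd; exact: le_trans.
have bd (w : R -> R) : {within `[c, d], continuous w} ->
    exists r, forall s, c <= s <= d -> `|w s| <= r.
  move=> cw; have [|e ecd he] := @EVT_max _ (fun s => `|w s|) c d cd.
    by move=> s; apply: cvg_norm; exact: cw.
  by exists `|w e| => s scd; apply: he; rewrite in_itv.
have [r1 b1] := bd _ c1; have [r2 b2] := bd _ c2.
pose r := Num.max (Num.max `|c| `|d|) (Num.max r1 r2).
have [L L0 fL] := f_lipschitz r.
have inr s : c <= s <= d -> `|s| <= r.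
  move=> scd; apply: (@norm_between _ c d); [by rewrite !le_max lexx ?orbT|by rewrite !le_max lexx ?orbT|].
  by rewrite (min_idPl cd) (max_idPr cd).
have := @gronwall _ c d L (fun s => w1 s - w2 s) (fun s => f (s, w1 s) - f (s, w2 s)).
have cc : {within `[c, d], continuous (fun s => w1 s - w2 s)}.
  by move=> s; apply: cvgB; [exact: c1|exact: c2].
move=> /(_ cc (fun s h => is_deriveB (d1 s h) (d2 s h))) h.
have : `|w1 y - w2 y| <= `|w1 x - w2 x| * expR (L * `|y - x|).
  apply: h => // s /andP[/ltW cs /ltW sd].
  have scd : c <= s <= d by rewrite cs.
  apply: fL; first exact: inr.
    by rewrite (le_trans (b1 _ scd))// /r !le_max lexx ?orbT.
  by rewrite (le_trans (b2 _ scd))// /r !le_max lexx ?orbT.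
by rewrite w12 subrr normr0 mul0r normr_le0 subr_eq0 => /eqP.
Qed.

End Ode.

(** * The flow: semigroup property, order, joint continuity *)

Section Flow.
Context {R : realType}.
Variables (f k : R * R -> R) (M : R).
Hypothesis f_cont : continuous f.
Hypothesis k_cont : continuous k.
Hypothesis f_deriv : forall x t : R, is_derive t 1 (fun s => f (x, s)) (k (x, t)).
Hypothesis f_le : forall p, `|f p| <= M.

(* [Om xi p] is the ordinate at abscissa [xi] of the integral curve of [f]
   through [p]. *)
Variable Om : R -> R * R -> R.
Hypothesis Om_init : forall p, Om p.1 p = p.2.
Hypothesis Om_deriv : forall p (x : R), is_derive x 1 (fun s => Om s p) (f (x, Om x p)).

Lemma Om_lip p x y : `|Om x p - Om y p| <= M * `|x - y|.
Proof.
rewrite distrC [`|x - y|]distrC.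
by apply: (ler_dist_derive_cst (F := fun s => Om s p) (f := fun s => f (s, Om s p))).
Qed.

Lemma Om_cont p : continuous (fun s => Om s p).
Proof. exact: lipschitz_continuous (Om_lip p). Qed.

Lemma Om_unique (c d : R) (w : R -> R) p :
  {within `[c, d], continuous w} ->
  (forall x : R, c < x < d -> is_derive x 1 w (f (x, w x))) ->
  c <= p.1 <= d -> w p.1 = p.2 -> forall y, c <= y <= d -> w y = Om y p.
Proof.
move=> cw dw pcd wp y ycd.
have cO : {within `[c, d], continuous (fun s => Om s p)}.
  by apply: continuous_subspaceT; exact: Om_cont.
apply: (ode_unique k_cont f_deriv cw cO dw (fun s _ => Om_deriv p s) pcd ycd).
by rewrite Om_init.
Qed.

Lemma Om_semigroup p x y : Om y (x, Om x p) = Om y p.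
Proof.
apply/esym; pose c := Num.min x y; pose d := Num.max x y.
apply: (@Om_unique c d (fun s => Om s p) (x, Om x p)) => //=.
- by apply: continuous_subspaceT; exact: Om_cont.
- by rewrite /c /d ge_min le_max !lexx.
- by rewrite /c /d ge_min le_max !lexx !orbT.
Qed.

Lemma Om_eq p q x y : Om x p = Om x q -> Om y p = Om y q.
Proof. by move=> h; rewrite -(Om_semigroup p x) h Om_semigroup. Qed.

(** If the order changed, the difference would vanish somewhere by the intermediate value theorem,
    and the two curves would coincide. *)
Lemma Om_lt p q x y : Om x p < Om x q -> Om y p < Om y q.
Proof.
move=> lt; rewrite ltNge; apply/negP => ge.
pose z s := Om s q - Om s p.
have cz : continuous z by move=> s; apply: cvgB; exact: Om_cont.
have [s _ zs] : exists2 s, s \in `[Num.min x y, Num.max x y] & z s = 0.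
  apply: IVT; first by rewrite ge_min le_max lexx.
    exact: continuous_subspaceT.
  have zx : 0 < z x by rewrite subr_gt0.
  have zy : z y <= 0 by rewrite subr_le0.
  have [xy|yx] := leP x y; rewrite ge_min le_max zy (ltW zx) ?orbT//.
by move/subr0_eq/(@Om_eq _ _ _ x): zs => e; rewrite e ltxx in lt.
Qed.

(** Gronwall started at the abscissa [q.1], where the two curves are [q.2 - Om q.1 p] apart. As [f]
    is bounded, the curves through all [q] near [p] stay in one rectangle, so [C] does not depend on
    [q]. *)
Lemma Om_lip_init p (rho : R) : exists2 C, 0 < C &
  forall q, `|q - p| <= 1 -> forall x, `|x| <= rho -> `|q.1| <= rho ->
    `|Om x q - Om x p| <= C * `|q.2 - Om q.1 p|.
Proof.
have M0 : 0 <= M by exact: le_trans (normr_ge0 _) (f_le 0).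
pose r := `|p.2| + 1 + M * (`|p.1| + `|rho| + `|rho|) + `|rho|.
have [L L0 fL] := f_lipschitz k_cont f_deriv r.
exists (expR (L * (`|rho| + `|rho|))) => [|q qp x xr qr]; first exact: expR_gt0.
have bd (u : R * R) s : `|u.2| <= `|p.2| + 1 -> `|u.1| <= `|p.1| + `|rho| ->
    `|s| <= rho -> `|Om s u| <= r.
  move=> u2 u1 sr; have := Om_lip u s u.1; rewrite Om_init => h.
  rewrite -[Om s u](subrK u.2) (le_trans (ler_normD _ _))//.
  have : M * `|s - u.1| <= M * (`|p.1| + `|rho| + `|rho|).
    rewrite ler_wpM2l// (le_trans (ler_normB _ _))// addrC lerD//.
    by rewrite (le_trans sr)// ler_norm.
  by rewrite /r; have := normr_ge0 rho; lra.
have q2 : `|q.2| <= `|p.2| + 1.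
  rewrite -[q.2](subrK p.2) (le_trans (ler_normD _ _))// addrC lerD2l.
  apply: le_trans qp; rewrite prod_normE/= le_max; apply/orP; right; exact: lexx.
have := @gronwall _ (- rho) rho L (fun s => Om s q - Om s p)
   (fun s => f (s, Om s q) - f (s, Om s p)).
have cc : {within `[- rho, rho], continuous (fun s => Om s q - Om s p)}.
  by apply: continuous_subspaceT => s; apply: cvgB; exact: Om_cont.
move=> /(_ cc (fun s _ => is_deriveB (Om_deriv q s) (Om_deriv p s))) h.
have : `|Om x q - Om x p| <= `|Om q.1 q - Om q.1 p| * expR (L * `|x - q.1|).
  apply: h; rewrite -?ler_norml// => s /andP[/ltW s1 /ltW s2].
  have sr : `|s| <= rho by rewrite ler_norml s1.
  apply: fL.
  - rewrite (le_trans sr)// (le_trans (ler_norm _))// lerDr.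
    by rewrite !addr_ge0// mulr_ge0// !addr_ge0.
  - by apply: bd => //; rewrite (le_trans qr)// (le_trans (ler_norm _))// lerDr.
  - by apply: bd => //; rewrite lerDl.
rewrite Om_init mulrC => /le_trans; apply.
rewrite ler_wpM2r// ler_expR ler_pM2l// (le_trans (ler_normB _ _))//.
by rewrite lerD// (le_trans _ (ler_norm _)).
Qed.

Lemma Om_jcont : continuous (fun q : R * (R * R) => Om q.1 q.2).
Proof.
have M0 : 0 <= M by exact: le_trans (normr_ge0 _) (f_le 0).
move=> [x p] /=; pose rho := `|x| + `|p.1| + 1.
have [C C0 hC] := Om_lip_init p rho.
apply/cvgrPdist_le => e e0.
(* Changing the curve costs at most [C * (1 + M) * d], changing the abscissa at most [M * d]. *)
pose d := Num.min 1 (e / (M + C * (1 + M) + 1)).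
have K0 : 0 < M + C * (1 + M) + 1.
  by rewrite ltr_wpDl// addr_ge0// mulr_ge0 ?addr_ge0// ltW.
have d0 : 0 < d by rewrite lt_min ltr01 divr_gt0.
have : \forall q \near nbhs (x, p), `|(x, p) - q| <= d.
  by apply: cvgr_dist_le => //; exact: cvg_id.
apply: filterS => -[y q] /=; rewrite distrC => qd.
have [yd qpd] : `|y - x| <= d /\ `|q - p| <= d.
  by move: qd; rewrite prod_normE/= ge_max => /andP[].
have [q1d q2d] : `|q.1 - p.1| <= d /\ `|q.2 - p.2| <= d.
  by move: qpd; rewrite prod_normE/= ge_max => /andP[].
have d1 : d <= 1 by rewrite ge_min lexx.
have dE : d * (M + C * (1 + M) + 1) <= e.
  by rewrite -ler_pdivlMr// ge_min lexx orbT.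
have yr : `|y| <= rho.
  rewrite -[y](subrK x) (le_trans (ler_normD _ _))// /rho.
  by have := normr_ge0 p.1; lra.
have xr : `|x| <= rho by rewrite /rho; have := normr_ge0 p.1; lra.
have qr : `|q.1| <= rho.
  rewrite -[q.1](subrK p.1) (le_trans (ler_normD _ _))// /rho.
  by have := normr_ge0 x; lra.
have := hC q (le_trans qpd d1) _ yr qr.
have h1 : `|q.2 - Om q.1 p| <= d * (1 + M).
  rewrite -[q.2](subrK p.2) -addrA (le_trans (ler_normD _ _))// mulrDr mulr1 lerD//.
  rewrite -[X in X - _]Om_init (le_trans (Om_lip _ _ _))// mulrC ler_wpM2r//.
  by rewrite distrC.
have h2 : C * `|q.2 - Om q.1 p| <= C * (d * (1 + M)) by rewrite ler_pM2l.
have h3 : `|Om y p - Om x p| <= M * d.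
  by rewrite (le_trans (Om_lip _ _ _))// ler_wpM2l.
move=> h4; rewrite distrC -[Om y q](subrK (Om y p)) -addrA.
rewrite (le_trans (ler_normD _ _))// (le_trans _ dE)//.
apply: (@le_trans _ _ (C * (d * (1 + M)) + M * d)).
  by apply: lerD => //; exact: le_trans h4 h2.
by have := ltW d0; lra.
Qed.

End Flow.

(** * Differentiability of the flow in both variables *)

Section PlaneDiff.
Context {R : realType}.
Implicit Types (F G : R * R -> R) (p q : R * R).

(** Frechet differentiability at [p] with gradient [(gx, gt)]. *)
Definition plane_diff F p (gx gt : R) := forall e : R, 0 < e ->
  \forall q \near p,
    `|F q - F p - gx * (q.1 - p.1) - gt * (q.2 - p.2)| <= e * `|q - p|.

Lemma norm_fst_le p : `|p.1| <= `|p|.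
Proof. by case: p => x t; rewrite prod_normE/= le_max lexx. Qed.

Lemma norm_snd_le p : `|p.2| <= `|p|.
Proof. by case: p => x t; rewrite prod_normE/= le_max lexx orbT. Qed.

Lemma norm_fstB_le p q : `|q.1 - p.1| <= `|q - p|.
Proof. exact: (norm_fst_le (q - p)). Qed.

Lemma norm_sndB_le p q : `|q.2 - p.2| <= `|q - p|.
Proof. exact: (norm_snd_le (q - p)). Qed.

Lemma near_dist p (d : R) : 0 < d -> \forall q \near p, `|q - p| <= d.
Proof.
move=> d0; have : \forall q \near nbhs p, `|p - q| <= d.
  by apply: cvgr_dist_le => //; exact: cvg_id.
by apply: filterS => q; rewrite distrC.
Qed.

Lemma continuous_near (T : topologicalType) (g : T -> R) (x : T) (e : R) :
  {for x, continuous g} -> 0 < e -> \forall y \near x, `|g y - g x| <= e.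
Proof. by move=> /cvgrPdist_le cg /cg; apply: filterS => y; rewrite distrC. Qed.

Lemma near_continuous (T : topologicalType) (g : T -> R) (x : T) :
  (forall e : R, 0 < e -> \forall y \near x, `|g y - g x| <= e) ->
  {for x, continuous g}.
Proof.
move=> h; apply/cvgrPdist_le => e /h.
by apply: filterS => y; rewrite distrC.
Qed.

Lemma near_fst p (P : R -> Prop) :
  (\forall x \near p.1, P x) -> \forall q \near p, P q.1.
Proof.
by move=> h; exists (P, setT) => [|q []//]; split => //; exact: filterT.
Qed.

End PlaneDiff.

Section ParametricIntegral.
Context {R : realType}.

Definition pint (g : R * (R * R) -> R) (x : R) (p : R * R) : R :=
  oriented_integral (fun s => g (s, p)) p.1 x.

Lemma continuous_slice (T : topologicalType) (g : R * T -> R) (p : T) :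
  continuous g -> continuous (fun s => g (s, p)).
Proof.
move=> cg s; apply: (@continuous_comp _ _ _ (fun s => (s, p)) g); last exact: cg.
by apply: (@continuous_pair _ _ _ id (cst p) s); [exact: cvg_id|exact: cvg_cst].
Qed.

(** The moving end points are absorbed by the primitive [G] at the fixed parameter [p]; the change
    of parameter is controlled by [tube] on the segment |s| <= rho. *)
Lemma pint_jcont (g : R * (R * R) -> R) : continuous g ->
  continuous (fun q : R * (R * R) => pint g q.1 q.2).
Proof.
move=> cg [x p]; apply: near_continuous => e e0 /=.
have cs q : continuous (fun s => g (s, q)) by exact: continuous_slice.
pose rho := `|x| + `|p.1| + 1.
have rho0 : 0 < rho by rewrite ltr_wpDl// addr_ge0.
have e4 : 0 < e / 2 / (rho + rho) by rewrite !divr_gt0// addr_gt0.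
have hT := tube p (- rho) rho cg e4.
pose G := primitive (fun s => g (s, p)).
have cG : continuous G by move=> s; exact: is_derive_continuous (is_derive_primitive s (cs p)).
have e5 : 0 < e / 4 by rewrite divr_gt0.
have h1 := continuous_near (cG x) e5.
have h2 := continuous_near (cG p.1) e5.
have h3 : \forall y \near x, `|y - x| <= 1.
  by apply: (continuous_near (g := id)); [exact: cvg_id|].
have h4 := near_dist p ltr01.
have hx : \forall q \near (x, p), `|G q.1 - G x| <= e / 4 /\ `|q.1 - x| <= 1.
  exists ([set y | `|G y - G x| <= e / 4 /\ `|y - x| <= 1], setT) => /=.
    by split; [exact: filterI|exact: filterT].
  by move=> [y q] [].
have hp : \forall q \near (x, p), (forall s, - rho <= s <= rho -> `|g (s, q.2) - g (s, p)| <= e / 2 / (rho + rho))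
   /\ `|G q.2.1 - G p.1| <= e / 4 /\ `|q.2 - p| <= 1.
  exists (setT, [set q | (forall s, - rho <= s <= rho -> `|g (s, q) - g (s, p)| <= e / 2 / (rho + rho))
   /\ `|G q.1 - G p.1| <= e / 4 /\ `|q - p| <= 1]) => /=.
    split; first exact: filterT.
    apply: filterI; first exact: hT.
    by apply: filterI; [exact: (near_fst h2)|exact: h4].
  by move=> [y q] [].
near=> q.
have [Gx qx] : `|G q.1 - G x| <= e / 4 /\ `|q.1 - x| <= 1 by near: q.
have [gq [Gp qp]] : (forall s, - rho <= s <= rho -> `|g (s, q.2) - g (s, p)| <= e / 2 / (rho + rho))
   /\ `|G q.2.1 - G p.1| <= e / 4 /\ `|q.2 - p| <= 1 by near: q.
rewrite /pint !oriented_integralE// -/G.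
set H := primitive _.
have yr : `|q.1| <= rho.
  rewrite -[q.1](subrK x) (le_trans (ler_normD _ _))// /rho.
  by have := normr_ge0 p.1; lra.
have qr : `|q.2.1| <= rho.
  rewrite -[q.2.1](subrK p.1) (le_trans (ler_normD _ _))// /rho.
  by have := normr_ge0 x; have := norm_fstB_le p q.2; lra.
have hD : `|(H q.1 - G q.1) - (H q.2.1 - G q.2.1)| <= e / 2.
  apply: (@le_trans _ _ (e / 2 / (rho + rho) * `|q.1 - q.2.1|)).
    apply: (ler_dist_derive_cst (F := fun s => H s - G s)
      (f := fun s => g (s, q.2) - g (s, p))) => s sq.
      by apply: is_deriveB; apply: is_derive_primitive.
    by apply: gq; rewrite -ler_norml; exact: (norm_between qr yr sq).
  apply: (@le_trans _ _ (e / 2 / (rho + rho) * (rho + rho))).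
    by rewrite ler_pM2l// (le_trans (ler_normB _ _))// lerD.
  by rewrite divfK// gt_eqF// addr_gt0.
have -> : H q.1 - H q.2.1 - (G x - G p.1) =
  ((H q.1 - G q.1) - (H q.2.1 - G q.2.1)) + ((G q.1 - G x) - (G q.2.1 - G p.1)) by lra.
rewrite (le_trans (ler_normD _ _))//.
have := ler_normB (G q.1 - G x) (G q.2.1 - G p.1).
lra.
Unshelve. all: by end_near. Qed.

End ParametricIntegral.

Section Transport.
Context {R : realType}.
Variables (f k : R * R -> R) (M : R).
Hypothesis f_cont : continuous f.
Hypothesis k_cont : continuous k.
Hypothesis f_deriv : forall x t : R, is_derive t 1 (fun s => f (x, s)) (k (x, t)).
Hypothesis f_le : forall p, `|f p| <= M.
Variable Om : R -> R * R -> R.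
Hypothesis Om_init : forall p, Om p.1 p = p.2.
Hypothesis Om_deriv : forall p (x : R), is_derive x 1 (fun s => Om s p) (f (x, Om x p)).

Let Om_jc := Om_jcont k_cont f_deriv f_le Om_init Om_deriv.

Lemma continuous_along_flow (g : R * R -> R) : continuous g ->
  continuous (fun q : R * (R * R) => g (q.1, Om q.1 q.2)).
Proof.
move=> cg q; apply: (@continuous_comp _ _ _ (fun q : R * (R * R) => (q.1, Om q.1 q.2)) g); last exact: cg.
by apply: (@continuous_pair _ _ _ fst _ q); [exact: cvg_fst|exact: Om_jc].
Qed.

(** Solution of the linearized equation along the curve through [p]: the derivative of [Om x p] with
    respect to the ordinate [p.2]. *)
Definition stretch (x : R) (p : R * R) : R :=
  expR (pint (fun q => k (q.1, Om q.1 q.2)) x p).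

Lemma stretch_jcont : continuous (fun q : R * (R * R) => stretch q.1 q.2).
Proof.
move=> q; apply: (@continuous_comp _ _ _ (fun q => pint _ q.1 q.2) (@expR R)).
  by apply: pint_jcont; exact: continuous_along_flow.
exact: continuous_expR.
Qed.

(** The remainder is to be integrated along the curve, so it must be small uniformly in the
    abscissa; compactness gives this for the increments of [kb] around the curve. *)
Lemma uniform_diff (b kb : R * R -> R) (p : R * R) (rho e : R) :
  continuous kb -> (forall x t : R, is_derive t 1 (fun s => b (x, s)) (kb (x, t))) ->
  0 < e -> exists2 d, 0 < d & forall x s, `|x| <= rho -> `|s - Om x p| <= d ->
  `|b (x, s) - b (x, Om x p) - kb (x, Om x p) * (s - Om x p)| <= e * `|s - Om x p|.
Proof.
move=> ckb bd e0.
have cg : continuous (fun q : R * R => kb (q.1, Om q.1 p + q.2)).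
  move=> q; apply: (@continuous_comp _ _ _ (fun q : R * R => (q.1, Om q.1 p + q.2)) kb); last exact: ckb.
  apply: (@continuous_pair _ _ _ fst _ q); first exact: cvg_fst.
  apply: cvgD; last exact: cvg_snd.
  apply: (@continuous_comp _ _ _ fst (fun s => Om s p)); first exact: cvg_fst.
  exact: (Om_cont f_le Om_deriv (p := p)).
have /= := tube (0 : R) (- rho) rho cg e0.
move=> /nbhs_ballP[d /= d0 hd]; exists (d / 2); first by rewrite divr_gt0.
move=> x s xr sd.
have := @ler_dist_derive_cst _ (fun u => b (x, u) - kb (x, Om x p) * u)
  (fun u => kb (x, u) - kb (x, Om x p)) e (Om x p) s.
have -> : b (x, s) - kb (x, Om x p) * s - (b (x, Om x p) - kb (x, Om x p) * Om x p) =
   b (x, s) - b (x, Om x p) - kb (x, Om x p) * (s - Om x p) by ring.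
apply => u us.
  apply: is_deriveB.
  have := @is_deriveZ _ _ _ (@id R) (kb (x, Om x p)) u 1 1 (is_derive_id _ _).
  by rewrite /GRing.scale/= mulr1.
have := hd (u - Om x p); rewrite /ball/= sub0r normrN.
have ud : `|u - Om x p| < d.
  by rewrite (le_lt_trans (dist_between us))// (le_lt_trans sd)// ltr_pdivrMr// ltr_pMr// ltr1n.
by move=> /(_ ud x); rewrite -ler_norml => /(_ xr); rewrite addr0 [Om x p + _]addrC subrK.
Qed.

Section Along.
Variables (b kb : R * R -> R) (o : R).
Hypothesis b_cont : continuous b.
Hypothesis kb_cont : continuous kb.
Hypothesis b_deriv : forall x t : R, is_derive t 1 (fun s => b (x, s)) (kb (x, t)).

Definition along (p : R * R) : R := pint (fun q => b (q.1, Om q.1 q.2)) o p.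

(** Differentiation of [along] under the integral sign with respect to the ordinate, [stretch] being
    the derivative of the inner flow. *)
Definition along_t (p : R * R) : R :=
  pint (fun q => kb (q.1, Om q.1 q.2) * stretch q.1 q.2) o p.

Lemma along_cont : continuous along.
Proof.
move=> p; apply: (@continuous_comp _ _ _ (fun p => (o, p)) (fun q => pint _ q.1 q.2)).
  by apply: (@continuous_pair _ _ _ (cst o) id); [exact: cvg_cst|exact: cvg_id].
by apply: pint_jcont; exact: continuous_along_flow.
Qed.

Lemma along_t_cont : continuous along_t.
Proof.
move=> p; apply: (@continuous_comp _ _ _ (fun p => (o, p)) (fun q => pint _ q.1 q.2)).
  by apply: (@continuous_pair _ _ _ (cst o) id); [exact: cvg_cst|exact: cvg_id].
apply: pint_jcont => q; apply: cvgM; last exact: stretch_jcont.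
exact: continuous_along_flow.
Qed.

(** Moving along the curve through [p], [along] changes at the rate [- b], so its derivative in the
    direction [(1, f p)] is [- b p]; this dictates the first component of the gradient. As [b] is
    differentiable in the ordinate only, [q] is compared with the point of the curve of [p] at
    abscissa [q.1], and the vertical gap between them is propagated by the linearized flow. *)
Lemma along_diff (p : R * R) :
  plane_diff along p (- b p - f p * along_t p) (along_t p).
Proof.
have alg2 (Bqo Bq1 Bpo Bp1 Bpp bp fp n q1 q2 p1 p2 ei Jo J1 O : R) :
    Bqo - Bq1 - (Bpo - Bpp) - (- bp - fp * n) * (q1 - p1) - n * (q2 - p2) =
    ((Bqo - Bpo - (q2 - O) * ei * Jo) - (Bq1 - Bp1 - (q2 - O) * ei * J1)) +
    (q2 - O) * (ei * (Jo - J1) - n) +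
    (- (n * (O - p2 - fp * (q1 - p1))) - (Bp1 - Bpp - bp * (q1 - p1))) by ring.
have sum4 (X Y Z W x : R) : `|X| <= x / 4 -> `|Y| <= x / 4 -> `|Z| <= x / 4 ->
    `|W| <= x / 4 -> `|X + Y + (- Z - W)| <= x.
  move=> hX hY hZ hW; rewrite (le_trans (ler_normD _ _))//.
  by have := ler_normD X Y; have := ler_normB (- Z) W; rewrite normrN; lra.
have alg (X kk zu y w : R) : y != 0 ->
    X - w * (kk * y) = (X - kk * zu) + kk * y * (zu / y - w).
  by move=> y0; field.
have M0 : 0 <= M by exact: le_trans (normr_ge0 _) (f_le 0).
have cOm u : continuous (fun s => Om s u) by exact: (Om_cont f_le Om_deriv (p := u)).
pose rho := `|p.1| + `|o| + 1.
have rho0 : 0 < rho by rewrite ltr_wpDl// addr_ge0.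
have [C C0 hC] := Om_lip_init k_cont f_deriv f_le Om_init Om_deriv p rho.
have ck : continuous (fun s => k (s, Om s p)) by exact: continuous_along.
have cb u : continuous (fun s => b (s, Om s u)) by exact: continuous_along.
pose K := primitive (fun s => k (s, Om s p)).
have dK (s : R) : is_derive s 1 K (k (s, Om s p)) by exact: is_derive_primitive.
pose E s := expR (K s).
have dE (s : R) : is_derive s 1 E (E s * k (s, Om s p)).
  exact: (@is_derive1_comp _ (@expR R) K).
have cE : continuous E by move=> s; exact: is_derive_continuous (dE s).
have E0 s : 0 < E s by exact: expR_gt0.
pose jj s := kb (s, Om s p) * E s.
have cjj : continuous jj.
  by move=> s; apply: cvgM; [exact: continuous_along|exact: cE].
pose J := primitive jj.
have dJ (s : R) : is_derive s 1 J (jj s) by exact: is_derive_primitive.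
(* [N x] is the value of [along_t] at the point of abscissa [x] on the curve of [p]. *)
pose N x := (E x)^-1 * (J o - J x).
have NE : along_t p = N p.1.
  rewrite /along_t /pint /N.
  rewrite (@oriented_integral_ext _ _ (fun s => (E p.1)^-1 * jj s)); last first.
    move=> s _ /=; rewrite /stretch /pint oriented_integralE// expRD expRN -/K.
    by rewrite /jj /E; ring.
  rewrite oriented_integralE; last by move=> s; apply: cvgM; [exact: cvg_cst|exact: cjj].
  have := @ler_dist_derive_cst _
    (fun x => primitive (fun s => (E p.1)^-1 * jj s) x - (E p.1)^-1 * J x) (fun=> 0) 0 p.1 o.
  rewrite mul0r => h.
  suff /h : forall s : R, Num.min p.1 o <= s <= Num.max p.1 o ->
     is_derive s 1 (fun x => primitive (fun s => (E p.1)^-1 * jj s) x - (E p.1)^-1 * J x) 0.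
    move=> /(_ (fun s _ => ltac:(by rewrite normr0))).
    by rewrite normr_le0 => /eqP; lra.
  move=> s _; rewrite -(subrr ((E p.1)^-1 * jj s)); apply: is_deriveB.
    apply: is_derive_primitive.
    by move=> s'; apply: cvgM; [exact: cvg_cst|exact: cjj].
have cN : {for p.1, continuous N}.
  apply: cvgM.
    by apply: cvgV; [rewrite gt_eqF|exact: cE].
  by apply: cvgB; [exact: cvg_cst|exact: is_derive_continuous (dJ _)].
pose Bp := primitive (fun s => b (s, Om s p)).
have dBp (s : R) : is_derive s 1 Bp (b (s, Om s p)) by exact: is_derive_primitive.
have bound (g : R -> R) : continuous g -> exists2 c, 0 < c & forall s, `|s| <= rho -> `|g s| <= c.
  move=> cg; have cg1 : continuous (fun q : R * R => g q.1).
    by move=> q; apply: (@continuous_comp _ _ _ fst g); [exact: cvg_fst|exact: cg].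
  have [c c0 hc] := bounded_rectangle rho cg1.
  by exists c => // s sr; apply: (hc s 0) => //; rewrite normr0 ltW.
have [E2 E20 hE2] := bound (fun s => (E s)^-1) (fun s => cvgV (lt0r_neq0 (E0 s)) (cE s)).
have [J2 J20 hJ2] := bound jj cjj.
(* [C1] measures the variation of the rescaled gap [r] in units of [e1 * |zeta|], and [C2] the
   resulting error of [D] in units of [e1 * |q - p|]. *)
pose C1 := C * E2 * (rho + rho).
have C10 : 0 < C1 by rewrite !mulr_gt0// addr_gt0.
pose C2 := (C + J2 * C1) * (rho + rho) * (1 + M).
have M1 : 0 < 1 + M by rewrite ltr_pwDl.
have C20 : 0 < C2.
  by apply: mulr_gt0 => //; apply: mulr_gt0; apply: addr_gt0 => //; exact: mulr_gt0.
move=> e e0; rewrite NE.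
pose e1 := e / 4 / C2.
have e10 : 0 < e1 by rewrite !divr_gt0.
have [d1 d10 hd1] := uniform_diff p rho k_cont f_deriv e10.
have [d2 d20 hd2] := uniform_diff p rho kb_cont b_deriv e10.
pose d := Num.min 1 (Num.min d1 d2 / (C * (1 + M))).
have d0 : 0 < d by rewrite lt_min ltr01 divr_gt0 ?lt_min ?d10// mulr_gt0.
have h1 := near_dist p d0.
have h2 := near_fst (continuous_near cN (divr_gt0 (divr_gt0 e0 (ltr0n R 4)) M1)).
have h3 : \forall q \near p, `|Om q.1 p - p.2 - f p * (q.1 - p.1)| <=
     e / 4 / (`|N p.1| + 1) * `|q.1 - p.1|.
  have /is_derive_epsP := Om_deriv p p.1; rewrite Om_init -surjective_pairing => h.
  have e3 : 0 < e / 4 / (`|N p.1| + 1) by rewrite !divr_gt0// ltr_pwDr.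
  exact: (near_fst (h _ e3)).
have h4 : \forall q \near p, `|Bp q.1 - Bp p.1 - b p * (q.1 - p.1)| <= e / 4 * `|q.1 - p.1|.
  have /is_derive_epsP := dBp p.1; rewrite Om_init -surjective_pairing => h.
  have e3 : 0 < e / 4 by rewrite divr_gt0.
  exact: (near_fst (h _ e3)).
near=> q.
have qd : `|q - p| <= d by near: q.
have hN : `|N q.1 - N p.1| <= e / 4 / (1 + M) by near: q.
have hO : `|Om q.1 p - p.2 - f p * (q.1 - p.1)| <=
     e / 4 / (`|N p.1| + 1) * `|q.1 - p.1| by near: q.
have hB : `|Bp q.1 - Bp p.1 - b p * (q.1 - p.1)| <= e / 4 * `|q.1 - p.1| by near: q.
have q1le := norm_fstB_le p q; have q2le := norm_sndB_le p q.
have qp1 : `|q - p| <= 1 by rewrite (le_trans qd)// ge_min lexx.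
have qr : `|q.1| <= rho.
  rewrite -[q.1](subrK p.1) (le_trans (ler_normD _ _))// /rho.
  by have := normr_ge0 o; lra.
have or : `|o| <= rho by rewrite /rho; have := normr_ge0 p.1; lra.
pose zeta := q.2 - Om q.1 p.
have zle : `|zeta| <= (1 + M) * `|q - p|.
  rewrite /zeta -[q.2](subrK p.2) -addrA (le_trans (ler_normD _ _))// mulrDl mul1r lerD//.
  rewrite -[X in X - _]Om_init (le_trans (Om_lip f_le Om_deriv _ _ _))// ler_wpM2l//.
  by rewrite distrC.
pose z s := Om s q - Om s p.
have zC s : `|s| <= rho -> `|z s| <= C * `|zeta| by move=> sr; exact: hC.
have zd s : `|s| <= rho -> `|z s| <= d1 /\ `|z s| <= d2.
  move=> sr; have : `|z s| <= Num.min d1 d2; last by rewrite le_min => /andP.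
  rewrite (le_trans (zC _ sr))// (@le_trans _ _ (C * ((1 + M) * d)))//.
    by rewrite ler_pM2l// (le_trans zle)// ler_pM2l.
  have : d <= Num.min d1 d2 / (C * (1 + M)) by rewrite ge_min lexx orbT.
  by rewrite ler_pdivlMr ?mulr_gt0//; lra.
(* [E] solves the linearized equation, so the derivative of [r] contains only the Taylor remainder
   of [f], and [r] is almost constant. *)
pose r s := z s * (E s)^-1.
have dz (s : R) : is_derive s 1 z (f (s, Om s q) - f (s, Om s p)).
  exact: (is_deriveB (Om_deriv q s) (Om_deriv p s)).
have dr (s : R) : is_derive s 1 r
    ((f (s, Om s q) - f (s, Om s p) - k (s, Om s p) * z s) * (E s)^-1).
  have := is_deriveM (dz s) (@is_deriveV _ E s (E s * k (s, Om s p)) 1 (lt0r_neq0 (E0 s)) (dE s)).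
  move=> h; apply: is_derive_eq h _.
  rewrite /GRing.scale/= -/(z s); have := lt0r_neq0 (E0 s) => E00; field.
  exact: E00.
have inr u s : `|u| <= rho -> Num.min q.1 u <= s <= Num.max q.1 u -> `|s| <= rho.
  by move=> ur; exact: norm_between.
have len u : `|u| <= rho -> `|u - q.1| <= rho + rho.
  by move=> ur; rewrite (le_trans (ler_normB _ _))// lerD.
have hr s : `|s| <= rho -> `|r s - r q.1| <= e1 * C1 * `|zeta|.
  move=> sr; apply: (@le_trans _ _ (e1 * (C * `|zeta|) * E2 * `|s - q.1|)).
    apply: (ler_dist_derive_cst (F := r)) => u us.
    have ur := inr _ _ sr us; have [zd1 _] := zd _ ur.
    rewrite normrM ler_pM//; last exact: hE2.
    rewrite (le_trans (hd1 _ _ ur _))// ler_pM2l//; exact: zC.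
  have -> : e1 * C1 * `|zeta| = e1 * (C * `|zeta|) * E2 * (rho + rho) by rewrite /C1; ring.
  apply: ler_wpM2l; last exact: len.
  exact: mulr_ge0 (mulr_ge0 (ltW e10) (mulr_ge0 (ltW C0) (normr_ge0 _))) (ltW E20).
pose Bq := primitive (fun s => b (s, Om s q)).
pose D s := Bq s - Bp s - zeta * (E q.1)^-1 * J s.
have dD (s : R) : is_derive s 1 D
    (b (s, Om s q) - b (s, Om s p) - zeta * (E q.1)^-1 * jj s).
  apply: is_deriveB; last exact: is_deriveZ (dJ s).
  by apply: is_deriveB; apply: is_derive_primitive.
have zq : z q.1 = zeta by rewrite /z /zeta Om_init.
have hD : `|D o - D q.1| <= e / 4 * `|q - p|.
  apply: (@le_trans _ _ (e1 * (C + J2 * C1) * `|zeta| * `|o - q.1|)).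
    apply: (ler_dist_derive_cst (F := D)) => u us.
    have ur := inr _ _ or us; have [_ zd2] := zd _ ur.
    have -> : b (u, Om u q) - b (u, Om u p) - zeta * (E q.1)^-1 * jj u =
      (b (u, Om u q) - b (u, Om u p) - kb (u, Om u p) * z u) + jj u * (r u - r q.1).
      by rewrite /r zq; apply: (alg _ _ _ (E u)); rewrite gt_eqF.
    have -> : e1 * (C + J2 * C1) * `|zeta| = e1 * C * `|zeta| + e1 * (J2 * C1) * `|zeta| by ring.
    rewrite (le_trans (ler_normD _ _))// lerD//.
      by rewrite (le_trans (hd2 _ _ ur _))// -mulrA ler_pM2l//; exact: zC.
    rewrite normrM; have -> : e1 * (J2 * C1) * `|zeta| = J2 * (e1 * C1 * `|zeta|) by ring.
    by rewrite ler_pM//; [exact: hJ2|exact: hr].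
  apply: (@le_trans _ _ (e1 * (C + J2 * C1) * ((1 + M) * `|q - p|) * (rho + rho))).
    rewrite ler_pM//; last exact: len.
      apply: mulr_ge0 => //; apply: mulr_ge0; first exact: ltW.
      by apply: addr_ge0; [exact: ltW|apply: mulr_ge0; exact: ltW].
    by rewrite ler_pM2l// mulr_gt0// addr_gt0// mulr_gt0.
  have -> : e1 * (C + J2 * C1) * ((1 + M) * `|q - p|) * (rho + rho) = e1 * C2 * `|q - p|.
    by rewrite /C2; ring.
  by rewrite /e1 divfK// gt_eqF.
have alongE u : along u = primitive (fun s => b (s, Om s u)) o - primitive (fun s => b (s, Om s u)) u.1.
  by rewrite /along /pint (oriented_integralE _ _ (cb u)).
rewrite !alongE -/Bq -/Bp.
(* Four errors of at most a quarter each: the linearization [D], the variation of [N] between [p.1]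
   and [q.1], and the first order expansions at [p.1] of the curve of [p] and of [Bp]. *)
rewrite (alg2 _ _ _ (Bp q.1) _ _ _ _ _ _ _ _ (E q.1)^-1 (J o) (J q.1) (Om q.1 p)).
have t2 : `|zeta * (N q.1 - N p.1)| <= e / 4 * `|q - p|.
  rewrite normrM (le_trans (ler_pM (normr_ge0 _) (normr_ge0 _) zle hN))//.
  rewrite [leLHS](_ : _ = e / 4 * `|q - p|)//; field; exact: lt0r_neq0.
have t3 : `|N p.1 * (Om q.1 p - p.2 - f p * (q.1 - p.1))| <= e / 4 * `|q - p|.
  rewrite normrM (@le_trans _ _ ((`|N p.1| + 1) * (e / 4 / (`|N p.1| + 1) * `|q - p|)))//.
    apply: ler_pM => //; first by rewrite lerDl.
    by rewrite (le_trans hO)// ler_wpM2l// !divr_ge0 ?ltW// ltr_pwDr.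
  rewrite [leLHS](_ : _ = e / 4 * `|q - p|)//; field.
  by rewrite gt_eqF// ltr_pwDr.
have t4 : `|Bp q.1 - Bp p.1 - b p * (q.1 - p.1)| <= e / 4 * `|q - p|.
  by rewrite (le_trans hB)// ler_wpM2l// divr_ge0// ltW.
by apply: sum4; rewrite [leRHS]mulrAC.
Unshelve. all: by end_near. Qed.

End Along.

End Transport.

Lemma near_comp (T U : topologicalType) (f : T -> U) (x : T) (P : U -> Prop) :
  {for x, continuous f} -> (\forall y \near f x, P y) -> \forall s \near x, P (f s).
Proof. by move=> cf /cf. Qed.

(** * Extension of the coefficients to the plane *)

Section HalfLine.
Context {R : realType}.
Implicit Types (F G : R -> R).

Definition half_diff G (G' : R -> R) := forall t : R, 0 <= t ->
  forall e : R, 0 < e -> \forall s \near t, 0 <= s ->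
    `|G s - G t - G' t * (s - t)| <= e * `|s - t|.

Lemma is_derive_glue (F F1 F2 : R -> R) (t d : R) :
  (forall s, t <= s -> F s = F1 s) -> (forall s, s <= t -> F s = F2 s) ->
  is_derive t 1 F1 d -> is_derive t 1 F2 d -> is_derive t 1 F d.
Proof.
move=> E1 E2 /is_derive_epsP D1 /is_derive_epsP D2; apply/is_derive_epsP => e e0.
near=> s; have [st|/ltW st] := leP t s.
  by rewrite !E1//; near: s; exact: D1.
by rewrite !E2//; near: s; exact: D2.
Unshelve. all: by end_near. Qed.

Lemma maxN_ge0 (t : R) : 0 <= t -> Num.max (- t) 0 = 0.
Proof. by move=> t0; apply/max_idPr; rewrite oppr_le0. Qed.

Lemma maxN_le0 (t : R) : t <= 0 -> Num.max (- t) 0 = - t.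
Proof. by move=> t0; apply/max_idPl; rewrite oppr_ge0. Qed.

(** Reflection of the graph through the point (0, G 0), which turns the derivative into [G' |t|]. A
    single formula with maxima shows at once that the extension depends continuously on
    parameters. *)
Definition odd_ext G (t : R) : R := G (Num.max t 0) + G 0 - G (Num.max (- t) 0).

Lemma odd_ext_ge0 G t : 0 <= t -> odd_ext G t = G t.
Proof.
by move=> t0; rewrite /odd_ext (max_idPl t0) maxN_ge0// addrK.
Qed.

Lemma odd_ext_le0 G t : t <= 0 -> odd_ext G t = 2 * G 0 - G (- t).
Proof.
move=> t0; rewrite /odd_ext (max_idPr t0) maxN_le0//.
by congr (_ - _); ring.
Qed.

Lemma odd_ext_deriv G G' (t : R) : half_diff G G' ->
  is_derive t 1 (odd_ext G) (G' `|t|).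
Proof.
move=> H.
have pos (u : R) : 0 <= u -> forall e : R, 0 < e -> \forall s \near u, 0 <= s ->
    `|odd_ext G s - odd_ext G u - G' u * (s - u)| <= e * `|s - u|.
  move=> u0 e e0; have := H _ u0 _ e0; apply: filterS => s hs s0.
  by rewrite !odd_ext_ge0//; exact: hs.
have neg (u : R) : u <= 0 -> forall e : R, 0 < e -> \forall s \near u, s <= 0 ->
    `|odd_ext G s - odd_ext G u - G' (- u) * (s - u)| <= e * `|s - u|.
  move=> u0 e e0; have u0' : 0 <= - u by rewrite oppr_ge0.
  have h := H _ u0' _ e0.
  have : \forall s \near u, 0 <= - s -> `|G (- s) - G (- u) - G' (- u) * (- s - - u)| <= e * `|- s - - u|.
    have co : {for u, continuous (fun s : R => - s)} by apply: cvgN; exact: cvg_id.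
    exact: (near_comp co h).
  apply: filterS => s hs s0; rewrite !odd_ext_le0//.
  have := hs; rewrite oppr_ge0 => /(_ s0).
  have -> : 2 * G 0 - G (- s) - (2 * G 0 - G (- u)) - G' (- u) * (s - u) =
    - (G (- s) - G (- u) - G' (- u) * (- s - - u)) by ring.
  have -> : `|s - u| = `|- s - - u| by rewrite -normrN; congr (`|_|); ring.
  by rewrite normrN.
have [t0|t0|<-] := ltrgtP 0 t.
- apply/is_derive_epsP => e e0; rewrite gtr0_norm//.
  near=> s; have s0 : 0 <= s.
    by near: s; apply: (@cvgr_ge _ _ _ _ id t cvg_id).
  by move: s0; near: s; exact: (pos _ (ltW t0)).
- apply/is_derive_epsP => e e0; rewrite ltr0_norm//.
  near=> s; have s0 : s <= 0.
    by near: s; apply: (@cvgr_le _ _ _ _ id t cvg_id).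
  by move: s0; near: s; exact: (neg _ (ltW t0)).
- apply/is_derive_epsP => e e0; rewrite normr0; near=> s.
  have [s0|/ltW s0] := leP 0 s.
    by move: s0; near: s; exact: (pos _ (lexx _)).
  by move: s0; near: s; have := neg _ (lexx 0) _ e0; rewrite oppr0.
Unshelve. all: by end_near. Qed.

Lemma half_diff_of_derive G G' :
  (forall t : R, 0 <= t -> exists F, is_derive t 1 F (G' t) /\
     forall s, 0 <= s -> F s = G s) -> half_diff G G'.
Proof.
move=> h t t0 e e0; have [F [/is_derive_epsP dF FG]] := h t t0.
by have := dF _ e0; apply: filterS => s + s0; rewrite !FG.
Qed.

(* Unlike the odd extension it keeps the sign of [G], and it is bounded. *)
Definition pos_ext G (t : R) : R :=
  G (Num.max t 0) * expR (1 - G (Num.max (- t) 0) / G 0).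

Lemma pos_ext_ge0 G t : G 0 != 0 -> 0 <= t -> pos_ext G t = G t.
Proof.
move=> G0 t0; rewrite /pos_ext (max_idPl t0) maxN_ge0//.
by rewrite divff// subrr expR0 mulr1.
Qed.

(** On the negative side [pos_ext G] is [G 0 * expR (odd_ext G t / G 0 - 1)], whose derivative comes
    from the odd extension and matches at 0. *)
Lemma pos_ext_deriv G G' (t : R) : G 0 != 0 -> half_diff G G' ->
  is_derive t 1 (pos_ext G) (G' `|t| * expR (1 - G (Num.max (- t) 0) / G 0)).
Proof.
move=> G0 H; pose F2 s := G 0 * expR (odd_ext G s / G 0 - 1).
have F2E s : s <= 0 -> pos_ext G s = F2 s.
  move=> s0; rewrite /pos_ext /F2 odd_ext_le0// (max_idPr s0) maxN_le0//.
  by congr (_ * expR _); field.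
have dF2 (s : R) : is_derive s 1 F2 (expR (odd_ext G s / G 0 - 1) * G' `|s|).
  have d1 : is_derive s 1 (fun u => odd_ext G u / G 0 - 1) (G' `|s| / G 0).
    have := is_deriveB (is_deriveM (odd_ext_deriv s H) (is_derive_cst (G 0)^-1 s (1 : R)))
      (is_derive_cst (1 : R) s (1 : R)).
    by move=> h; apply: is_derive_eq h _; rewrite /GRing.scale/= mulr0 add0r subr0 mulrC.
  have d2 := @is_derive1_comp _ (@expR R) _ s _ _ (is_derive_expR _) d1.
  apply: is_derive_eq (is_deriveZ (G 0) d2) _.
  by rewrite /GRing.scale/=; field.
have [t0|t0|t0] := ltrgtP 0 t.
- rewrite maxN_ge0 ?ltW// divff// subrr expR0 mulr1.
  apply: near_eq_is_derive (odd_ext_deriv t H); near=> s.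
  have s0 : 0 <= s by near: s; apply: (@cvgr_ge _ _ _ _ id t cvg_id).
  by rewrite odd_ext_ge0// pos_ext_ge0.
- have -> : G' `|t| * expR (1 - G (Num.max (- t) 0) / G 0) = expR (odd_ext G t / G 0 - 1) * G' `|t|.
    rewrite mulrC odd_ext_le0 ?(ltW t0)// maxN_le0 ?(ltW t0)//.
    by congr (expR _ * _); field.
  apply: near_eq_is_derive (dF2 t); near=> s.
  have s0 : s <= 0 by near: s; apply: (@cvgr_le _ _ _ _ id t cvg_id).
  by rewrite F2E.
- rewrite -t0 in dF2 *; rewrite oppr0 maxxx divff// subrr expR0 mulr1.
  apply: (@is_derive_glue _ (odd_ext G) F2).
  + by move=> s s0; rewrite odd_ext_ge0// pos_ext_ge0.
  + exact: F2E.
  + exact: odd_ext_deriv.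
  + apply: is_derive_eq (dF2 0) _.
    by rewrite odd_ext_ge0// divff// subrr expR0 mul1r.
Unshelve. all: by end_near. Qed.

(** Odd extensions turn the one-sided derivatives into two-sided ones, to which the usual product
    rule applies. *)
Lemma half_diffM G G' F F' : half_diff G G' -> half_diff F F' ->
  half_diff (fun t => G t * F t) (fun t => G' t * F t + G t * F' t).
Proof.
move=> hG hF; apply: half_diff_of_derive => t t0.
exists (fun s => odd_ext G s * odd_ext F s); split; last first.
  by move=> s s0; rewrite !odd_ext_ge0.
apply: is_derive_eq (is_deriveM (odd_ext_deriv t hG) (odd_ext_deriv t hF)) _.
by rewrite /GRing.scale/= !odd_ext_ge0// ger0_norm//; ring.
Qed.

Lemma half_diffV G G' : (forall t, 0 <= t -> G t != 0) -> half_diff G G' ->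
  half_diff (fun t => (G t)^-1) (fun t => - G' t / (G t ^+ 2)).
Proof.
move=> G0 hG; apply: half_diff_of_derive => t t0.
exists (fun s => (odd_ext G s)^-1); split; last first.
  by move=> s s0; rewrite !odd_ext_ge0.
have Gt : odd_ext G t != 0 by rewrite odd_ext_ge0// G0.
apply: is_derive_eq (is_deriveV Gt (odd_ext_deriv t hG)) _.
rewrite /GRing.scale/= odd_ext_ge0// ger0_norm// mulNr mulrC mulNr -exprVn.
by rewrite exprVn.
Qed.

End HalfLine.

Section Retract.
Context {R : realType}.

(** Retraction onto [0, 1]. In the abscissa the coefficients are extended continuously without
    smoothness, which suffices because the flow is only differentiated in the ordinate of its
    right-hand side. *)
Definition clamp01 (x : R) : R := Num.max 0 (Num.min x 1).

Lemma clamp01_in x : 0 <= clamp01 x <= 1.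
Proof. by rewrite /clamp01 le_max lexx/= ge_max ler01 ge_min lexx orbT. Qed.

Lemma clamp01_id x : 0 <= x <= 1 -> clamp01 x = x.
Proof. by move=> /andP[x0 x1]; rewrite /clamp01 (min_idPl x1) (max_idPr x0). Qed.

Lemma clamp01_cont : continuous clamp01.
Proof.
move=> x; apply: (@continuous_max R R (cst 0) (fun y => Num.min y 1) x).
  exact: cvg_cst.
by apply: (@continuous_min R R id (cst 1) x); [exact: cvg_id|exact: cvg_cst].
Qed.

Lemma Pi_comp (g : R * R -> R) (r1 r2 : R -> R) : {within Pi, continuous g} ->
  continuous r1 -> continuous r2 ->
  (forall x, 0 <= r1 x <= 1) -> (forall t, 0 <= r2 t) ->
  continuous (fun p => g (r1 p.1, r2 p.2)).
Proof.
move=> /subspace_continuousP cg c1 c2 h1 h2 p.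
have rPi q : Pi (r1 q.1, r2 q.2) by split; [exact: h1|exact: h2].
apply: cvg_trans (cg _ (rPi p)).
move=> P; rewrite /= /within/= => hP.
have cr : {for p, continuous (fun q : R * R => (r1 q.1, r2 q.2))}.
  apply: (@continuous_pair _ _ _ (fun q => r1 q.1) (fun q => r2 q.2)).
    by apply: (@continuous_comp _ _ _ fst r1); [exact: cvg_fst|exact: c1].
  by apply: (@continuous_comp _ _ _ snd r2); [exact: cvg_snd|exact: c2].
by have := near_comp cr hP; apply: filterS => q; apply; exact: rPi.
Qed.

End Retract.

Section Extension.
Context {R : realType}.

Lemma linear_fun0 (V W : lmodType R) (L : V -> W) : linear L -> L 0 = 0.
Proof.
move=> lL; have := lL 1 0 0; rewrite !scale1r addr0 => /eqP.
by rewrite -subr_eq0 opprD addNKr oppr_eq0 => /eqP.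
Qed.

Lemma linear_funZ (V W : lmodType R) (L : V -> W) (k : R) (v : V) :
  linear L -> L (k *: v) = k *: L v.
Proof. by move=> lL; have := lL k v 0; rewrite (linear_fun0 lL) !addr0. Qed.

Lemma linear_pair (W : lmodType R) (L : R * R -> W) (x t : R) : linear L ->
  L (x, t) = x *: L (1, 0) + t *: L (0, 1).
Proof.
move=> lL.
have -> : (x, t) = x *: ((1, 0) : R * R) + t *: ((0, 1) : R * R).
  by congr pair; rewrite /= /GRing.scale/= ?mulr1 ?mulr0 ?addr0 ?add0r.
by rewrite lL (linear_funZ _ _ lL).
Qed.

Variable a : R * R -> R.
Hypothesis a_C1 : C1_on (W := R^o) Pi a.

Lemma C1_on_Pi_within : {within Pi, continuous a}.
Proof.
have [da [hd _]] := a_C1.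
apply/subspace_continuousP => p Pp; have [dl dw] := hd p (conj Pp id).
apply/cvgrPdist_le => e e0.
pose c := `|da p (1, 0)| + `|da p (0, 1)| + 1.
have c0 : 0 < c by rewrite ltr_pwDr.
have h1 : \forall q \near within Pi (nbhs p), `|q - p| <= e / c.
  by apply: cvg_within; apply: near_dist; rewrite divr_gt0.
have h2 := dw _ ltr01.
near=> q.
have qp : `|q - p| <= e / c by near: q.
have : `|a q - a p - da p (q - p)| <= `|q - p|.
  by rewrite -[leRHS]mul1r; near: q.
have -> : da p (q - p) = (q.1 - p.1) * da p (1, 0) + (q.2 - p.2) * da p (0, 1).
  exact: (linear_pair (q.1 - p.1) (q.2 - p.2) dl).
move=> h; rewrite distrC.
have -> : a q - a p = (a q - a p - ((q.1 - p.1) * da p (1, 0) + (q.2 - p.2) * da p (0, 1)))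
   + (q.1 - p.1) * da p (1, 0) + (q.2 - p.2) * da p (0, 1) by ring.
have k1 : `|(q.1 - p.1) * da p (1, 0)| <= `|q - p| * `|da p (1, 0)|.
  by rewrite normrM ler_wpM2r// norm_fstB_le.
have k2 : `|(q.2 - p.2) * da p (0, 1)| <= `|q - p| * `|da p (0, 1)|.
  by rewrite normrM ler_wpM2r// norm_sndB_le.
move: qp; rewrite ler_pdivlMr// => qp.
rewrite (le_trans (ler_normD _ _))// (le_trans (lerD (ler_normD _ _) (lexx _)))//.
rewrite (le_trans _ qp)// /c !mulrDr mulr1 [leRHS]addrC !addrA.
by apply: lerD => //; apply: lerD.
Unshelve. all: by end_near. Qed.

Lemma C1_on_Pi_t : exists at_ : R * R -> R, {within Pi, continuous at_} /\
  forall x, 0 <= x <= 1 -> half_diff (fun t => a (x, t)) (fun t => at_ (x, t)).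
Proof.
have [da [hd hc]] := a_C1; exists (fun p => da p (0, 1)); split.
  by have := hc (0, 1); rewrite setD0.
move=> x x01 t t0 e e0.
have Pp : Pi (x, t) by split.
have [dl dw] := hd (x, t) (conj Pp id).
have := dw _ e0; rewrite near_withinE => h.
have : \forall s \near t, (Pi `\` set0) (x, s) -> `|a (x, s) - a (x, t) - da (x, t) ((x, s) - (x, t))| <=
         e * `|(x, s) - (x, t)|.
  have cs : {for t, continuous (fun s : R => (x, s))}.
    by apply: (@continuous_pair _ _ _ (cst x) id); [exact: cvg_cst|exact: cvg_id].
  by have := near_comp cs h; apply: filterS => s; rewrite setD0.
apply: filterS => s + s0; rewrite setD0 => /(_ (conj x01 s0)).
have -> : (x, s) - (x, t) = (0, s - t) :> R * R by congr pair; rewrite /= subrr.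
rewrite (linear_pair _ _ dl) scale0r add0r [_ *: _]mulrC.
by rewrite prod_normE/= normr0 (max_idPr _).
Qed.

End Extension.

Section CharacteristicData.
Context {R : realType}.
Variables (a b : R * R -> R) (a0 sg : R).
Hypothesis a_C1 : C1_on (W := R^o) Pi a.
Hypothesis b_C1 : C1_on (W := R^o) Pi b.
Hypothesis a0_gt0 : 0 < a0.
Hypothesis sg1 : sg ^+ 2 = 1.
Hypothesis a_sg : forall p, Pi p -> a0 <= sg * a p.

Let a_neq0 p : Pi p -> a p != 0.
Proof.
move=> /a_sg h; apply/eqP => ap.
by move: h; rewrite ap mulr0 leNgt a0_gt0.
Qed.

(** [1 / a] must keep its sign and stay bounded, so that characteristics are global and cross the
    strip in one direction; hence [pos_ext]. The quotient [b / a] is merely integrated along them;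
    hence [odd_ext]. *)
Lemma char_data : exists f k bb kb : R * R -> R,
  [/\ [/\ continuous f, continuous k, continuous bb & continuous kb],
      (forall x t : R, is_derive t 1 (fun s => f (x, s)) (k (x, t))),
      (forall x t : R, is_derive t 1 (fun s => bb (x, s)) (kb (x, t))),
      (exists M, forall p, `|f p| <= M) /\ (forall p, 0 < sg * f p) &
      (forall p, Pi p -> f p = (a p)^-1 /\ bb p = b p / a p)].
Proof.
have ca := C1_on_Pi_within a_C1; have cb := C1_on_Pi_within b_C1.
have [a' [ca' da]] := C1_on_Pi_t a_C1; have [b' [cb' db]] := C1_on_Pi_t b_C1.
pose g p := (a p)^-1; pose g' p := - a' p / a p ^+ 2.
pose c p := b p * g p; pose c' p := b' p * g p + b p * g' p.
have cg : {within Pi, continuous g}.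
  apply/subspace_continuousP => p Pp; apply: cvgV; first exact: a_neq0.
  by move/subspace_continuousP: ca; apply.
have cg' : {within Pi, continuous g'}.
  apply/subspace_continuousP => p Pp; apply: cvgM.
    by apply: cvgN; move/subspace_continuousP: ca'; apply.
  apply: cvgV; first by rewrite expf_neq0// a_neq0.
  by apply: cvgM; move/subspace_continuousP: ca; apply.
have cc : {within Pi, continuous c}.
  by move=> p; apply: cvgM; [exact: cb|exact: cg].
have cc' : {within Pi, continuous c'}.
  move=> p; apply: cvgD; apply: cvgM; [exact: cb'|exact: cg|exact: cb|exact: cg'].
have inPi (x t : R) : 0 <= t -> Pi (clamp01 x, t) by move=> t0; split; [exact: clamp01_in|].
have dg x : half_diff (fun t => g (clamp01 x, t)) (fun t => g' (clamp01 x, t)).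
  apply: half_diffV; last exact: da (clamp01_in x).
  by move=> t t0; rewrite a_neq0//; exact: inPi.
have dc x : half_diff (fun t => c (clamp01 x, t)) (fun t => c' (clamp01 x, t)).
  apply: half_diffM (dg x); exact: db (clamp01_in x).
have g0 x : g (clamp01 x, 0) != 0 by rewrite invr_eq0 a_neq0//; exact: inPi.
have cmax : continuous (fun t : R => Num.max t 0).
  by move=> t; apply: (@continuous_max R R id (cst 0) t); [exact: cvg_id|exact: cvg_cst].
have cmaxN : continuous (fun t : R => Num.max (- t) 0).
  move=> t; apply: (@continuous_max R R (fun t => - t) (cst 0) t); last exact: cvg_cst.
  by apply: cvgN; exact: cvg_id.
have cabs : continuous (fun t : R => `|t|) by move=> t; apply: cvg_norm; exact: cvg_id.
have max0 (t : R) : 0 <= Num.max t 0 by rewrite le_max lexx orbT.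
have cE : continuous (fun p : R * R => expR (1 - g (clamp01 p.1, Num.max (- p.2) 0) / g (clamp01 p.1, 0))).
  move=> p; apply: (@continuous_comp _ _ _ (fun p : R * R => 1 - g (clamp01 p.1, Num.max (- p.2) 0) / g (clamp01 p.1, 0)) (@expR R)); last exact: continuous_expR.
  apply: cvgB; first exact: cvg_cst.
  apply: cvgM; first exact: (Pi_comp cg clamp01_cont cmaxN clamp01_in (fun t => max0 (- t))).
  apply: cvgV; first exact: g0.
  apply: (Pi_comp (r2 := cst 0) cg clamp01_cont) => //.
  + by move=> ?; exact: cvg_cst.
  + exact: clamp01_in.
exists (fun p => pos_ext (fun t => g (clamp01 p.1, t)) p.2),
  (fun p => g' (clamp01 p.1, `|p.2|) * expR (1 - g (clamp01 p.1, Num.max (- p.2) 0) / g (clamp01 p.1, 0))),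
  (fun p => odd_ext (fun t => c (clamp01 p.1, t)) p.2),
  (fun p => c' (clamp01 p.1, `|p.2|)).
have sgg p : Pi p -> 0 < sg * g p /\ `|g p| <= a0^-1.
  move=> Pp; have h := a_sg Pp; have h0 := lt_le_trans a0_gt0 h.
  have ab : `|a p| = sg * a p.
    have s1 : `|sg| = 1 by apply/eqP; rewrite -(@eqrXn2 _ 2)// ?expr1n// real_normK ?num_real ?sg1.
    by rewrite -[LHS]mul1r -s1 -normrM gtr0_norm.
  split; last by rewrite normfV ab lef_pV2 ?posrE.
  have -> : sg * g p = (sg * a p) / (a p ^+ 2).
    by rewrite /g; field; exact: a_neq0.
  by rewrite divr_gt0// exprn_even_gt0//= a_neq0.
split.
- split.
  + move=> p; apply: cvgM; last exact: cE.
    by apply: (Pi_comp cg clamp01_cont cmax) => //; exact: clamp01_in.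
  + move=> p; apply: cvgM; last exact: cE.
    by apply: (Pi_comp cg' clamp01_cont cabs) => //; exact: clamp01_in.
  + move=> p; apply: cvgB; last first.
      by apply: (Pi_comp cc clamp01_cont cmaxN) => //; exact: clamp01_in.
    apply: cvgD; first by apply: (Pi_comp cc clamp01_cont cmax) => //; exact: clamp01_in.
    apply: (Pi_comp (r2 := cst 0) cc clamp01_cont) => //.
    * by move=> ?; exact: cvg_cst.
    * exact: clamp01_in.
  + by apply: (Pi_comp cc' clamp01_cont cabs) => //; exact: clamp01_in.
- by move=> x t; exact: (pos_ext_deriv t (g0 x) (dg x)).
- by move=> x t; exact: (odd_ext_deriv t (dc x)).
- split.
    (* Two values of [g] have the same sign, so their ratio is positive and the exponent in
       [pos_ext] is at most 1. *)
    exists (a0^-1 * expR 1) => p; rewrite /pos_ext normrM.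
    have [_ h1] := sgg _ (inPi p.1 _ (max0 p.2)).
    rewrite ler_pM// ger0_norm ?expR_ge0// ler_expR lerBlDr lerDl.
    have [h2 _] := sgg _ (inPi p.1 _ (max0 (- p.2))).
    have [h3 _] := sgg _ (inPi p.1 0 (lexx _)).
    have sn : sg != 0 by apply/eqP => s0; rewrite s0 mul0r ltxx in h3.
    rewrite (_ : _ / _ = (sg * g (clamp01 p.1, Num.max (- p.2) 0)) / (sg * g (clamp01 p.1, 0))).
      by rewrite ltW// divr_gt0.
    by field; rewrite sn g0.
  move=> p; rewrite /pos_ext mulrA mulr_gt0 ?expR_gt0//.
  by have [] := sgg _ (inPi p.1 _ (max0 p.2)).
- move=> [x t] [/= x01 t0]; rewrite pos_ext_ge0//= ?odd_ext_ge0//.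
  by rewrite clamp01_id.
Qed.

End CharacteristicData.

(* [Th p] is the ordinate at which the extended characteristic through [p]
   meets the inflow side [x = o]; it is negative when the characteristic enters
   Pi through the initial axis. [L p] is the integral of [b / a] from [p] to
   that point, along the characteristic. *)
Record transport {R : realType} (a b : R * R -> R) (o i : R)
    (Th L Tht Lt f bb : R * R -> R) : Prop := Transport {
  tr_out : forall t, Th (o, t) = t;
  tr_Lout : forall t, L (o, t) = 0;
  tr_lt : forall x s t, s < t -> Th (x, s) < Th (x, t);
  tr_side : forall x y t, 0 < (i - o) * (y - x) -> Th (y, t) < Th (x, t);
  tr_cont : [/\ continuous Th, continuous L, continuous Tht & continuous Lt];
  tr_cont_coef : continuous f /\ continuous bb;
  tr_diff : forall p, plane_diff Th p (- f p * Tht p) (Tht p);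
  tr_Ldiff : forall p, plane_diff L p (- bb p - f p * Lt p) (Lt p);
  tr_Tht : forall p, 0 < Tht p;
  tr_f : forall p, f p != 0;
  tr_Pi : forall p, Pi p -> f p = (a p)^-1 /\ bb p = b p / a p;
  tr_side_hit : forall p, Pi p -> 0 <= Th p ->
    [/\ low_abscissa a p = o, omega a o p = Th p & charfactor a b o p = expR (L p)];
  tr_axis_hit : forall p, Pi p -> Th p < 0 ->
    exists y, [/\ 0 <= y <= 1, y != o, Th (y, 0) = Th p, low_abscissa a p = y &
                  charfactor a b y p = expR (L p - L (y, 0))]
}.

Lemma oriented_integral_FTC {R : realType} (F g : R -> R) (x y : R) : continuous g ->
  (forall s : R, is_derive s 1 F (g s)) -> oriented_integral g x y = F y - F x.
Proof.
move=> cg dF; rewrite oriented_integralE//.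
have := is_derive_0_is_cst (f := fun s => primitive g s - F s) x y.
suff h (s : R) : is_derive s 1 (fun s => primitive g s - F s) 0 by move=> /(_ h); lra.
by rewrite -(subrr (g s)); apply: is_deriveB; exact: is_derive_primitive.
Qed.

(** * Characteristics of one component in the strip *)

Section Component.
Context {R : realType}.
Variables (a b : R * R -> R) (a0 o i : R).
Hypothesis oi : (o = 0 /\ i = 1) \/ (o = 1 /\ i = 0).
Hypothesis a_C1 : C1_on (W := R^o) Pi a.
Hypothesis b_C1 : C1_on (W := R^o) Pi b.
Hypothesis a0_gt0 : 0 < a0.
Hypothesis a_sg : forall p, Pi p -> a0 <= (i - o) * a p.

Lemma side_sq : (i - o) ^+ 2 = 1.
Proof. by case: oi => -[-> ->]; ring. Qed.

Lemma side_mul_ge0 x : 0 <= x <= 1 -> 0 <= (i - o) * (x - o).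
Proof. by case: oi => -[-> ->] /andP[]; lra. Qed.

Section Flow.
Variables (f k bb kb : R * R -> R) (M : R).
Hypothesis f_cont : continuous f.
Hypothesis k_cont : continuous k.
Hypothesis bb_cont : continuous bb.
Hypothesis kb_cont : continuous kb.
Hypothesis f_deriv : forall x t : R, is_derive t 1 (fun s => f (x, s)) (k (x, t)).
Hypothesis bb_deriv : forall x t : R, is_derive t 1 (fun s => bb (x, s)) (kb (x, t)).
Hypothesis f_le : forall p, `|f p| <= M.
Hypothesis f_sg : forall p, 0 < (i - o) * f p.
Hypothesis f_Pi : forall p, Pi p -> f p = (a p)^-1 /\ bb p = b p / a p.
Variable Om : R -> R * R -> R.
Hypothesis Om_init : forall p, Om p.1 p = p.2.
Hypothesis Om_deriv : forall p (x : R), is_derive x 1 (fun s => Om s p) (f (x, Om x p)).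

Let Om_cont p : continuous (fun s => Om s p) := Om_cont f_le Om_deriv (p := p).

(** [o] is the side where characteristics enter and [i] the one where they leave. The factor [i - o]
    is the sign of the speed, so time increases from [o] to [i], and one statement covers both
    families of components. *)
Lemma Om_side p x y : 0 < (i - o) * (y - x) -> Om x p < Om y p.
Proof.
move=> h.
have mvt (u v : R) : u < v -> exists2 c, c \in `]u, v[ & Om v p - Om u p = f (c, Om c p) * (v - u).
  move=> uv; apply: (@MVT _ (fun s => Om s p) (fun s => f (s, Om s p))) => //.
  exact: continuous_subspaceT.
have [xy|xy|xy] := ltrgtP x y.
- have [c _ E] := mvt _ _ xy; rewrite -subr_gt0 E.
  have := f_sg (c, Om c p).
  have yx : 0 < y - x by rewrite subr_gt0.
  have sg0 : 0 < i - o by rewrite -(pmulr_lgt0 _ yx).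
  by rewrite pmulr_rgt0// => f0; rewrite mulr_gt0.
- have [c _ E] := mvt _ _ xy; rewrite -subr_lt0.
  have -> : Om x p - Om y p = f (c, Om c p) * (x - y) by exact: E.
  have := f_sg (c, Om c p).
  have yx : y - x < 0 by rewrite subr_lt0.
  have sg0 : i - o < 0 by rewrite -(nmulr_lgt0 _ yx).
  by rewrite nmulr_rgt0// => f0; rewrite nmulr_rlt0// subr_gt0.
- by rewrite xy subrr mulr0 ltxx in h.
Qed.

Lemma Om_side_le p x y : 0 <= (i - o) * (y - x) -> Om x p <= Om y p.
Proof.
rewrite le_eqVlt => /predU1P[/esym/eqP|/Om_side/ltW//].
have s0 : i - o != 0 by apply/eqP => h; have := side_sq; rewrite h expr0n => /eqP; rewrite eq_sym oner_eq0.
by rewrite mulf_eq0 (negbTE s0)/= subr_eq0 => /eqP ->.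
Qed.

Lemma Om_inj p x y : Om x p = Om y p -> x = y.
Proof.
have s0 : i - o != 0 by apply/eqP => h; have := side_sq; rewrite h expr0n => /eqP; rewrite eq_sym oner_eq0.
move=> e; apply/eqP; case: (ltrgtP 0 ((i - o) * (y - x))) => [/(Om_side p)|h|/esym/eqP].
- by rewrite e ltxx.
- have : 0 < (i - o) * (x - y) by rewrite -[x - y]opprB mulrN oppr_gt0.
  by move/(Om_side p); rewrite e ltxx.
- by rewrite mulf_eq0 (negbTE s0)/= subr_eq0 eq_sym.
Qed.

(** By monotonicity an intermediate ordinate is at least one of the end ordinates; hence a curve
    whose end points lie in Pi stays in Pi between them. *)
Lemma Om_between p x y s : Num.min x y <= s <= Num.max x y ->
  Num.min (Om x p) (Om y p) <= Om s p.
Proof.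
wlog xy : x y / 0 <= (i - o) * (y - x).
  move=> H; have [|/ltW h] := leP 0 ((i - o) * (y - x)); first exact: H.
  rewrite minC maxC => sxy; rewrite minC; apply: H => //.
  by rewrite -[x - y]opprB mulrN oppr_ge0.
move=> sxy; rewrite ge_min; apply/orP; left; apply: Om_side_le.
have := oi; have [h|h] := leP x y; rewrite ?(min_idPl h) ?(max_idPr h)
  ?(min_idPr (ltW h)) ?(max_idPl (ltW h)) in sxy; case/andP: sxy => s1 s2.
  by case=> -[? ?]; subst o i; move: xy; nra.
by case=> -[? ?]; subst o i; move: xy; nra.
Qed.

(** Inside the open segment the relative derivative is a true one, and [f] is [1 / a] on Pi, so
    uniqueness applies; continuity takes care of the end points. *)
Lemma char_path_Om (xi : R) p w : char_path a xi p w ->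
  forall s, Num.min p.1 xi <= s <= Num.max p.1 xi -> w s = Om s p.
Proof.
move=> [w0 hw] s hs.
have hw' u : Num.min p.1 xi <= u <= Num.max p.1 xi -> Pi (u, w u) /\
    @diff_within R R^o R^o [set` `[Num.min p.1 xi, Num.max p.1 xi]] w u (fun s => s * (1 / a (u, w u))).
  by move=> hu; apply: hw; rewrite /= in_itv.
apply: (Om_unique k_cont f_deriv f_le Om_init Om_deriv (w := w) _ _ _ _ hs) => //.
- apply/subspace_continuousP => u; rewrite /= in_itv/= => hu.
  by apply: (diff_within_continuous _ (hw' _ hu).2); rewrite /= in_itv.
- move=> u hu.
  have hu' : Num.min p.1 xi <= u <= Num.max p.1 xi by case/andP: hu => /ltW -> /ltW ->.
  have [Pu du] := hw' u hu'.
  rewrite (f_Pi Pu).1 -div1r; apply: diff_within_is_derive du.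
  have : u \in `]Num.min p.1 xi, Num.max p.1 xi[ by rewrite in_itv.
  move=> /near_in_itvoo; apply: filterS => v.
  by rewrite /= !in_itv/= => /andP[/ltW -> /ltW ->].
- by rewrite ge_min le_max !lexx.
Qed.

Lemma char_dom_in (xi : R) p : char_dom a p xi ->
  omega a xi p = Om xi p /\ Pi (xi, Om xi p).
Proof.
move=> [w hw]; have inxi : Num.min p.1 xi <= xi <= Num.max p.1 xi.
  by rewrite ge_min le_max !lexx !orbT.
split; last first.
  have [_ /(_ xi)] := hw; rewrite (char_path_Om hw inxi) => h.
  by apply: (h _).1; rewrite /= in_itv.
have : [set s | exists2 w, char_path a xi p w & w xi = s] (omega a xi p).
  by apply: xgetPex; exists (w xi), w.
by move=> /= [v hv <-]; exact: char_path_Om hv _ inxi.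
Qed.

Lemma char_domI (xi : R) p : Pi p -> 0 <= xi <= 1 -> 0 <= Om xi p -> char_dom a p xi.
Proof.
move=> Pp xi01 Oxi; exists (fun s => Om s p); split; first exact: Om_init.
move=> s; rewrite /= in_itv/= => hs.
have Ps : Pi (s, Om s p).
  split => /=.
    case: Pp => /andP[p0 p1] _; case/andP: xi01 => x0 x1; case/andP: hs => s1 s2.
    apply/andP; split; first by rewrite (le_trans _ s1)// le_min p0.
    by rewrite (le_trans s2)// ge_max p1.
  rewrite (le_trans _ (Om_between p hs))// le_min Oxi Om_init andbT.
  by case: Pp.
split => // e e0; rewrite near_withinE.
have /is_derive_epsP/(_ _ e0) := Om_deriv p s; rewrite (f_Pi Ps).1.
by apply: filterS => u hu _; rewrite div1r [_ * _^-1]mulrC.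
Qed.

Lemma char_dom_between (xi s : R) p : Pi p -> char_dom a p xi ->
  Num.min p.1 xi <= s <= Num.max p.1 xi -> char_dom a p s.
Proof.
move=> Pp /char_dom_in[_ [/= xi01 Oxi]] hs; apply: char_domI => //.
  case: Pp => /andP[p0 p1] _; case/andP: xi01 => x0 x1; case/andP: hs => s1 s2.
  apply/andP; split; first by rewrite (le_trans _ s1)// le_min p0.
  by rewrite (le_trans s2)// ge_max p1.
rewrite (le_trans _ (Om_between p hs))// le_min Oxi Om_init andbT.
by case: Pp.
Qed.

Lemma charfactorE (xi : R) p : Pi p -> char_dom a p xi ->
  charfactor a b xi p = expR (oriented_integral (fun s => bb (s, Om s p)) p.1 xi).
Proof.
move=> Pp dxi; rewrite /charfactor; congr expR; apply: oriented_integral_ext => s hs.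
have [-> Ps] := char_dom_in (char_dom_between Pp dxi hs).
by rewrite (f_Pi Ps).2.
Qed.

Let low_set p : set R := [set y | char_curve a p (y, omega a y p) /\
  bdPi (y, omega a y p) /\
  forall q, char_curve a p q -> bdPi q -> omega a y p <= q.2].

Lemma low_abscissaE p y : low_set p y ->
  (forall z, low_set p z -> z = y) -> low_abscissa a p = y.
Proof. by move=> hy; apply; apply: xgetPex; exists y. Qed.

Lemma out_in01 : 0 <= o <= 1.
Proof. by case: oi => -[-> _]; rewrite ?lexx ?ler01. Qed.

(** Ordinates increase away from [o], so the point on the side [o] is the lowest one of the curve,
    and injectivity along the curve makes it the only candidate for [low_abscissa]. *)
Lemma low_side p : Pi p -> 0 <= Om o p ->
  [/\ low_abscissa a p = o, omega a o p = Om o p &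
      charfactor a b o p = expR (along Om bb o p)].
Proof.
move=> Pp Oo; have dO := char_domI Pp out_in01 Oo.
have [oE Po] := char_dom_in dO.
have cO : char_curve a p (o, omega a o p) by [].
have bO : bdPi (o, omega a o p).
  rewrite oE; split => //=; case: oi => -[-> _]; [exact: Or31|exact: Or32].
split; [|exact: oE|by rewrite charfactorE].
apply: low_abscissaE.
  split => //; split => // q [dq q2] _.
  have [qE [/= q01 _]] := char_dom_in dq.
  by rewrite q2 qE oE; apply: Om_side_le; exact: side_mul_ge0.
move=> z [[/= dz _] [_ hz]].
have [zE [/= z01 _]] := char_dom_in dz.
have := hz _ cO bO; rewrite /= zE oE => le; apply: (@Om_inj p).
apply/eqP; rewrite eq_le le/=.
by apply: Om_side_le; exact: side_mul_ge0.
Qed.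

(** The ordinate is negative at [o] and nonnegative at [p.1], so the curve meets the initial axis in
    between; no point of Pi lies lower. *)
Lemma low_axis p : Pi p -> Om o p < 0 ->
  exists y, [/\ 0 <= y <= 1, y != o, Om o (y, 0) = Om o p, low_abscissa a p = y &
    charfactor a b y p = expR (along Om bb o p - along Om bb o (y, 0))].
Proof.
move=> Pp Oo; have [/= p01 p20] := Pp.
have [y yin y0] : exists2 y, y \in `[Num.min o p.1, Num.max o p.1] & Om y p = 0.
  apply: (@IVT _ (fun s => Om s p)); first by rewrite ge_min le_max lexx.
    exact: continuous_subspaceT.
  have O1 : 0 <= Om p.1 p by rewrite Om_init.
  have [h|h] := leP o p.1; rewrite ?(min_idPl h) ?(max_idPr h)
    ?(min_idPr (ltW h)) ?(max_idPl (ltW h)) ge_min le_max (ltW Oo) O1 ?orbT//.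
have y01 : 0 <= y <= 1.
  move: yin; rewrite in_itv/= => /andP[h1 h2].
  have /andP[d0 d1] := out_in01; case/andP: p01 => q0 q1.
  apply/andP; split; first by rewrite (le_trans _ h1)// le_min d0.
  by rewrite (le_trans h2)// ge_max d1.
have dy : char_dom a p y by apply: char_domI => //; rewrite y0.
have [yE Py] := char_dom_in dy.
have cy : char_curve a p (y, omega a y p) by [].
have by_ : bdPi (y, omega a y p).
  by rewrite yE; split => //=; rewrite y0; exact: Or33.
have Oy s : Om s (y, 0) = Om s p.
  by rewrite -[in LHS]y0 (Om_semigroup k_cont f_deriv f_le Om_init Om_deriv).
exists y; split => //.
- by apply/eqP => yo; rewrite yo in y0; rewrite y0 ltxx in Oo.
- apply: low_abscissaE.
    by split => //; split => // q cq [[_ q2] _]; rewrite yE y0.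
  move=> z [[/= dz _] [_ hz]].
  have [zE [/= z01 z0]] := char_dom_in dz.
  have := hz _ cy by_; rewrite /= zE yE y0 => le; apply: (@Om_inj p).
  by apply/eqP; rewrite y0 eq_le le.
- rewrite charfactorE//; congr expR; rewrite /along /pint /=.
  have cb : continuous (fun s => bb (s, Om s p)) by exact: continuous_along.
  rewrite (@oriented_integral_ext _ (fun s => bb (s, Om s (y, 0))) (fun s => bb (s, Om s p))).
    by rewrite !oriented_integralE//; lra.
  by move=> s _; rewrite Oy.
Qed.

Lemma transport_flow : transport a b o i (Om o) (along Om bb o)
  (stretch k Om o) (along_t k Om kb o) f bb.
Proof.
have s0 : i - o != 0 by apply/eqP => h; have := side_sq; rewrite h expr0n => /eqP; rewrite eq_sym oner_eq0.
have cbOm p : continuous (fun s => bb (s, Om s p)) by exact: continuous_along.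
have ckOm p : continuous (fun s => k (s, Om s p)) by exact: continuous_along.
split.
- by move=> t; rewrite -[LHS]/(Om (o, t).1 (o, t)) Om_init.
- by move=> t; rewrite /along /pint (oriented_integralE _ _ (cbOm _)) subrr.
- move=> x s t st; apply: (Om_lt k_cont f_deriv f_le Om_init Om_deriv (x := x)).
  by rewrite -[x in Om x]/((x, s).1) Om_init -[(x, s).1]/((x, t).1) Om_init.
- move=> x y t h; apply: (Om_lt k_cont f_deriv f_le Om_init Om_deriv (x := x)).
  rewrite [ltRHS](Om_init (x, t)) /= -[ltRHS](Om_init (y, t)) /=.
  exact: Om_side.
- split.
  + move=> p; apply: (@continuous_comp _ _ _ (fun p => (o, p)) (fun q => Om q.1 q.2)).
      by apply: (@continuous_pair _ _ _ (cst o) id); [exact: cvg_cst|exact: cvg_id].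
    exact: (Om_jcont k_cont f_deriv f_le Om_init Om_deriv).
  + exact: (along_cont k_cont f_deriv f_le Om_init Om_deriv).
  + move=> p; apply: (@continuous_comp _ _ _ (fun p => (o, p)) (fun q => stretch k Om q.1 q.2)).
      by apply: (@continuous_pair _ _ _ (cst o) id); [exact: cvg_cst|exact: cvg_id].
    exact: (stretch_jcont k_cont f_deriv f_le Om_init Om_deriv).
  + exact: (along_t_cont k_cont f_deriv f_le Om_init Om_deriv).
- by [].
- move=> p.
  (* The gradient of [Th] is another instance of [along_diff]: the integral of [f] along its own
     curve is [Om o q - q.2], and the corresponding [along_t] is [stretch - 1]. *)
  have d := along_diff k_cont f_deriv f_le Om_init Om_deriv o f_cont k_cont f_deriv p.
  have Oint q : along Om f o q = Om o q - q.2.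
    rewrite /along /pint -[X in _ = _ - X]Om_init.
    have cf : continuous (fun s => f (s, Om s q)) by exact: continuous_along.
    exact: (oriented_integral_FTC (F := fun s => Om s q) _ _ cf).
  have St : along_t k Om k o p = stretch k Om o p - 1.
    pose K := primitive (fun s => k (s, Om s p)).
    pose F s := expR (K s - K p.1).
    have FE s : stretch k Om s p = F s by rewrite /stretch /pint (oriented_integralE _ _ (ckOm p)).
    have dF (s : R) : is_derive s 1 F (k (s, Om s p) * stretch k Om s p).
      have dK := is_deriveB (is_derive_primitive s (ckOm p)) (is_derive_cst (K p.1) s (1 : R)).
      have := @is_derive1_comp _ (@expR R) _ s _ _ (is_derive_expR _) dK.
      by move=> h; apply: is_derive_eq h _; rewrite FE subr0 mulrC.
    have cF : continuous (fun s => k (s, Om s p) * stretch k Om s p).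
      move=> s; apply: cvgM; first exact: ckOm.
      apply: (@continuous_comp _ _ _ (fun s => (s, p)) (fun q => stretch k Om q.1 q.2)).
        by apply: (@continuous_pair _ _ _ id (cst p)); [exact: cvg_id|exact: cvg_cst].
      exact: (stretch_jcont k_cont f_deriv f_le Om_init Om_deriv).
    have F1 : F p.1 = 1 by rewrite /F (subrr (K p.1)) expR0.
    by rewrite /along_t /pint (oriented_integral_FTC _ _ cF dF) FE F1.
  move=> e /d; apply: filterS => q; rewrite !Oint St.
  by congr (`|_| <= _); ring.
- move=> p; exact: (along_diff k_cont f_deriv f_le Om_init Om_deriv).
- by move=> p; exact: expR_gt0.
- by move=> p; apply/eqP => fp; have := f_sg p; rewrite fp mulr0 ltxx.
- exact: f_Pi.
- exact: low_side.
- exact: low_axis.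
Qed.

End Flow.

Lemma transport_exists : exists Th L Tht Lt f bb, transport a b o i Th L Tht Lt f bb.
Proof.
have [f [k [bb [kb [[cf ck cbb ckb] df dbb [[M fM] fsg] fPi]]]]] :=
  char_data a_C1 b_C1 a0_gt0 side_sq a_sg.
have /choice[w hw] : forall p : R * R, exists w : R -> R,
    w p.1 = p.2 /\ forall x : R, is_derive x 1 w (f (x, w x)).
  by move=> p; exact: (ode_exists cf ck df fM).
have := @transport_flow f k bb kb M cf ck cbb ckb df dbb fM fsg fPi
  (fun x p => w p x) (fun p => (hw p).1) (fun p => (hw p).2).
by do 6 eexists; eassumption.
Qed.

End Component.

(** * Row-valued limits, local C^1 regularity and chain rules *)

Section RowVectors.
Context {R : realType} {n : nat}.

Lemma rv_norm_le (x : 'rV[R]_n) (e : R) : 0 <= e ->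
  (forall j, `|x 0 j| <= e) -> `|x| <= e.
Proof.
move=> e0 hx; rewrite [`|x|]mx_normrE; apply: bigmax_le => // -[i j] _ /=.
by rewrite ord1.
Qed.

Lemma rv_coord_le (x : 'rV[R]_n) j : `|x 0 j| <= `|x|.
Proof. by rewrite [`|x|]mx_normrE; exact: (le_bigmax _ (fun k => `|x k.1 k.2|) (0, j)). Qed.

Lemma rv_cvg (T : Type) (F : set_system T) (g : T -> 'rV[R]_n) (l : 'rV[R]_n) :
  Filter F -> (forall j, g x 0 j @[x --> F] --> l 0 j) -> g x @[x --> F] --> l.
Proof.
move=> FF h; apply/cvgrPdist_le => e e0.
have : \forall x \near F, forall j, `|l 0 j - g x 0 j| <= e.
  by apply: filter_forall => j; move/cvgrPdist_le: (h j); exact.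
apply: filterS => x hx; apply: rv_norm_le; first exact: ltW.
by move=> j; rewrite !mxE; exact: hx.
Qed.

Lemma rv_cvg_coord (T : Type) (F : set_system T) (g : T -> 'rV[R]_n) (l : 'rV[R]_n) j :
  Filter F -> g x @[x --> F] --> l -> g x 0 j @[x --> F] --> l 0 j.
Proof.
move=> FF /cvgrPdist_le h; apply/cvgrPdist_le => e /h.
apply: filterS => x; apply: le_trans.
by have := rv_coord_le (l - g x) j; rewrite !mxE.
Qed.

End RowVectors.

Lemma cvg_within_comp (T U V : topologicalType) (B : set U)
    (g : T -> U) (k : U -> V) (F : set_system T) (y : U) (l : V) :
  Filter F -> g @ F --> y -> (\forall x \near F, B (g x)) ->
  k @ within B (nbhs y) --> l -> (k \o g) @ F --> l.
Proof.
move=> FF gF gB kl P /kl; rewrite /= /within/= => h.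
have h' := gF _ h.
by apply: filterS (filterI gB h') => x [Bx]; apply.
Qed.

Section C1.
Context {R : realType}.

Lemma cvg_sumr (T I : Type) (F : set_system T) (r : seq I) (g : I -> T -> R) (l : I -> R) :
  Filter F -> (forall k, g k x @[x --> F] --> l k) ->
  \sum_(k <- r) g k x @[x --> F] --> \sum_(k <- r) l k.
Proof.
move=> FF gl; elim: r => [|k r IH].
  by rewrite big_nil; under eq_fun do rewrite big_nil; exact: cvg_cst.
rewrite big_cons; under eq_fun do rewrite big_cons.
exact: (cvgD (gl k) IH).
Qed.

(** The derivative exists nearby but is continuous at [s] alone. This pointwise form suits an
    induction over labels; holding everywhere, it gives C^1 by [C1at_all]. *)
Definition C1at (g : R -> R) (s : R) := exists g' : R -> R,
  (\forall r \near s, is_derive (r : R) 1 g (g' r)) /\ {for s, continuous g'}.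

Lemma C1at_near (g k : R -> R) (s : R) :
  (\forall r \near s, g r = k r) -> C1at g s -> C1at k s.
Proof.
move=> gk [g' [dg cg]]; exists g'; split => //.
have := near_join gk; apply: filterS2 dg => r dg hr.
exact: near_eq_is_derive hr dg.
Qed.

Lemma C1at_cst (c s : R) : C1at (fun=> c) s.
Proof.
exists (fun=> 0); split; last exact: cvg_cst.
by near=> r; exact: is_derive_cst.
Unshelve. all: by end_near. Qed.

Lemma C1at_all (g : R -> R) : (forall s, C1at g s) ->
  (forall s : R, is_derive s 1 g (derive1 g s)) /\ continuous (derive1 g).
Proof.
move=> h; have d (s : R) : is_derive s 1 g (derive1 g s).
  have [g' [dg _]] := h s; rewrite derive1E; apply: derivableP.
  by have [] := nbhs_singleton dg.
split => // s; have [g' [dg cg]] := h s.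
have E : \forall r \near s, g' r = derive1 g r.
  apply: filterS dg => r dg; rewrite derive1E.
  by have [_ ->] := dg.
apply: cvg_trans (near_eq_cvg E) _.
by rewrite -(nbhs_singleton E).
Qed.

Lemma plane_diff_lip (F : R * R -> R) (p : R * R) (gx gt : R) :
  plane_diff F p gx gt ->
  \forall q \near p, `|F q - F p| <= (`|gx| + `|gt| + 1) * `|q - p|.
Proof.
move=> /(_ _ ltr01); apply: filterS => q hq.
have -> : F q - F p = (F q - F p - gx * (q.1 - p.1) - gt * (q.2 - p.2)) +
   (gx * (q.1 - p.1) + gt * (q.2 - p.2)) by ring.
rewrite (le_trans (ler_normD _ _))// addrC mulrDl lerD//.
rewrite (le_trans (ler_normD _ _))// mulrDl !normrM.
by rewrite lerD// ler_wpM2l// ?norm_fstB_le ?norm_sndB_le.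
Qed.

Lemma plane_diff_continuous (F : R * R -> R) (p : R * R) (gx gt : R) :
  plane_diff F p gx gt -> {for p, continuous F}.
Proof.
move=> dF; pose c := `|gx| + `|gt| + 1.
have c0 : 0 < c by rewrite ltr_pwDr.
apply: near_continuous => e e0; have h := near_dist p (divr_gt0 e0 c0).
apply: filterS2 (plane_diff_lip dF) h => q h1 h2; rewrite (le_trans h1)//.
by rewrite mulrC -ler_pdivlMr.
Qed.

Lemma plane_diff_comp (F : R * R -> R) (G : R -> R) (p : R * R) (gx gt d : R) :
  plane_diff F p gx gt -> is_derive (F p) 1 G d ->
  plane_diff (fun q => G (F q)) p (d * gx) (d * gt).
Proof.
move=> dF dG e e0.
pose c := `|gx| + `|gt| + 1.
have c0 : 0 < c by rewrite ltr_pwDr.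
have Flip : \forall q \near p, `|F q - F p| <= c * `|q - p| := plane_diff_lip dF.
have cF := plane_diff_continuous dF.
have /is_derive_epsP/(_ _ (divr_gt0 (divr_gt0 e0 (ltr0n R 2)) c0)) hG := dG.
have d1 : 0 < e / 2 / (`|d| + 1) by rewrite !divr_gt0// ltr_pwDr.
apply: filterS (filterI (near_comp cF hG) (filterI Flip (dF _ d1))) => q [h1 [h2 h3]].
have -> : G (F q) - G (F p) - d * gx * (q.1 - p.1) - d * gt * (q.2 - p.2) =
  (G (F q) - G (F p) - d * (F q - F p)) +
  d * (F q - F p - gx * (q.1 - p.1) - gt * (q.2 - p.2)) by ring.
rewrite (le_trans (ler_normD _ _))// [e]splitr mulrDl lerD//.
  rewrite (le_trans h1)//.
  apply: (@le_trans _ _ (e / 2 / c * (c * `|q - p|))).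
    by rewrite ler_wpM2l// !divr_ge0// ltW.
  by rewrite mulrA divfK// gt_eqF.
rewrite normrM; apply: (@le_trans _ _ ((`|d| + 1) * (e / 2 / (`|d| + 1) * `|q - p|))).
  by rewrite ler_pM// lerDl.
by rewrite mulrA [_ * (_ / _)]mulrC divfK// gt_eqF// ltr_pwDr.
Qed.

Lemma plane_diffM (F G : R * R -> R) (p : R * R) (fx ft gx gt : R) :
  plane_diff F p fx ft -> plane_diff G p gx gt ->
  plane_diff (fun q => F q * G q) p (fx * G p + F p * gx) (ft * G p + F p * gt).
Proof.
move=> dF dG e e0.
have cG := plane_diff_continuous dG.
pose c := `|fx| + `|ft| + 1.
have c0 : 0 < c by rewrite ltr_pwDr.
have k1 : 0 < e / 3 / (`|G p| + 1) by rewrite !divr_gt0// ltr_pwDr.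
have k2 : 0 < e / 3 / (`|F p| + 1) by rewrite !divr_gt0// ltr_pwDr.
have k3 : 0 < e / 3 / c by rewrite !divr_gt0.
have Flip : \forall q \near p, `|F q - F p| <= c * `|q - p| := plane_diff_lip dF.
apply: filterS (filterI (filterI (dF _ k1) (dG _ k2))
  (filterI Flip (continuous_near cG k3))) => q [[h1 h2] [h3 h4]].
have -> : F q * G q - F p * G p - (fx * G p + F p * gx) * (q.1 - p.1) -
    (ft * G p + F p * gt) * (q.2 - p.2) =
  G p * (F q - F p - fx * (q.1 - p.1) - ft * (q.2 - p.2)) +
  F p * (G q - G p - gx * (q.1 - p.1) - gt * (q.2 - p.2)) +
  (F q - F p) * (G q - G p) by ring.
have gen (A B x y : R) : 0 < B -> `|A| <= B -> `|x| <= e / 3 / B * y ->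
    `|A * x| <= e / 3 * y.
  move=> B0 AB xy; rewrite normrM (le_trans (ler_pM _ _ AB xy))//.
  by rewrite mulrA [_ * (_ / _)]mulrC divfK// gt_eqF.
rewrite (le_trans (ler_normD _ _))//.
have -> : e * `|q - p| = e / 3 * `|q - p| + e / 3 * `|q - p| + e / 3 * `|q - p| by field.
apply: lerD; last first.
  rewrite normrM (le_trans (ler_pM _ _ h3 h4))//.
  rewrite [leLHS](_ : _ = e / 3 * `|q - p|)//; field.
  by rewrite gt_eqF.
rewrite (le_trans (ler_normD _ _))//; apply: lerD.
  by apply: gen h1; rewrite ?ltr_pwDr// lerDl.
by apply: gen h2; rewrite ?ltr_pwDr// lerDl.
Qed.

Lemma plane_diff_t (F : R * R -> R) (x t gx gt : R) : plane_diff F (x, t) gx gt ->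
  is_derive t 1 (fun s => F (x, s)) gt.
Proof.
move=> dF; apply/is_derive_epsP => e e0.
have cs : {for t, continuous (fun s : R => (x, s))}.
  by apply: (@continuous_pair _ _ _ (cst x) id); [exact: cvg_cst|exact: cvg_id].
have := near_comp cs (dF _ e0); apply: filterS => s /=.
rewrite subrr mulr0 subr0 => /le_trans; apply.
have -> : (x, s) - (x, t) = (0, s - t) :> R * R by congr pair; rewrite /= subrr.
by rewrite prod_normE/= normr0 (max_idPr _).
Qed.

Lemma plane_diff_x (F : R * R -> R) (x t gx gt : R) : plane_diff F (x, t) gx gt ->
  is_derive x 1 (fun y => F (y, t)) gx.
Proof.
move=> dF; apply/is_derive_epsP => e e0.
have cs : {for x, continuous (fun y : R => (y, t))}.
  by apply: (@continuous_pair _ _ _ id (cst t)); [exact: cvg_id|exact: cvg_cst].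
have := near_comp cs (dF _ e0); apply: filterS => y /=.
rewrite subrr mulr0 subr0 => /le_trans; apply.
have -> : (y, t) - (x, t) = (y - x, 0) :> R * R by congr pair; rewrite /= subrr.
by rewrite prod_normE/= normr0 (max_idPl _).
Qed.

End C1.

Section ChainRule.
Context {R : realType} {n : nat}.

Lemma linear_funD (V W : lmodType R) (K : V -> W) (x y : V) :
  linear K -> K (x + y) = K x + K y.
Proof. by move=> lK; have := lK 1 x y; rewrite !scale1r. Qed.

Lemma linear_row (K : R * 'rV[R]_n -> R^o) (t : R) (x : 'rV[R]_n) : linear K ->
  K (t, x) = t * K (1, 0) + \sum_j x 0 j * K (0, delta_mx 0 j).
Proof.
move=> lK; have -> : (t, x) = t *: ((1, 0) : R * 'rV[R]_n) + (0, x).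
  by congr pair; rewrite /= ?scaler0 ?add0r// /GRing.scale/= mulr1 addr0.
rewrite lK; congr (_ + _); rewrite {1}(row_sum_delta x).
have K0 := linear_fun0 lK.
rewrite (big_morph (fun x => K (0, x)) (id1 := 0) (op1 := +%R)) //; last first.
  move=> u v; rewrite -(linear_funD _ _ lK); congr K.
  by congr pair; rewrite /= addr0.
apply: eq_bigr => j _.
have -> : (0, x 0 j *: delta_mx 0 j) = x 0 j *: ((0, delta_mx 0 j) : R * 'rV[R]_n).
  by congr pair; rewrite /= /GRing.scale/= mulr0.
by rewrite (linear_funZ _ _ lK).
Qed.

(** After subtraction of the linear part [A] only the remainder of [hj] is left, of order o(|r - s|)
    since [V r - V s] is O(|r - s|). The condition [0 < s] keeps the nearby points in the domain. *)
Lemma chain_row (hj : R * 'rV[R]_n -> R) (K : R * 'rV[R]_n -> R^o)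
    (V : R -> 'rV[R]_n) (c : 'I_n -> R) (s : R) : 0 < s -> linear K ->
  @diff_within R _ R^o (dom_h (n := n)) hj (s, V s) K ->
  (forall j, is_derive s 1 (fun r => V r 0 j) (c j)) ->
  is_derive s 1 (fun r => hj (r, V r)) (K (1, 0) + \sum_j c j * K (0, delta_mx 0 j)).
Proof.
move=> s0 lK dh dV.
pose A r := r * K (1, 0) + \sum_j V r 0 j * K (0, delta_mx 0 j).
have dA : is_derive s 1 A (K (1, 0) + \sum_j c j * K (0, delta_mx 0 j)).
  apply: is_deriveD.
    have := is_deriveM (is_derive_id s (1 : R)) (is_derive_cst (K (1, 0)) s (1 : R)).
    by move=> H; apply: is_derive_eq H _; rewrite /GRing.scale/= mulr0 add0r mulr1.
  have -> : (fun r => \sum_j V r 0 j * K (0, delta_mx 0 j)) =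
      \sum_j (fun r => V r 0 j * K (0, delta_mx 0 j)).
    by apply/funext => r; rewrite fct_sumE.
  apply: is_derive_sum => j.
  have := is_deriveM (dV j) (is_derive_cst (K (0, delta_mx 0 j)) s (1 : R)).
  by move=> H; apply: is_derive_eq H _; rewrite /GRing.scale/= mulr0 add0r mulrC.
pose B := \sum_j (`|c j| + 1).
have B0 : 0 <= B by apply: sumr_ge0 => j _; rewrite addr_ge0.
have VB : \forall r \near s, `|V r - V s| <= B * `|r - s|.
  have : \forall r \near s, forall j, `|V r 0 j - V s 0 j| <= (`|c j| + 1) * `|r - s|.
    apply: (@filter_forall R 'I_n (fun j r => `|V r 0 j - V s 0 j| <= (`|c j| + 1) * `|r - s|) (nbhs s)).
    move=> j; have /is_derive_epsP/(_ _ ltr01) := dV j; apply: filterS => r hr.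
    rewrite -[X in `|X|](subrK (c j * (r - s))) addrC mulrDl.
    by rewrite (le_trans (ler_normD _ _))// lerD// normrM.
  apply: filterS => r hr; apply: rv_norm_le; first by rewrite mulr_ge0.
  move=> j; rewrite !mxE (le_trans (hr j))// ler_wpM2r//.
  rewrite /B (bigD1 j)//= lerDl; apply: sumr_ge0 => l _; exact: addr_ge0.
have cV : V r @[r --> s] --> V s.
  apply: rv_cvg => j; exact: is_derive_continuous (dV j).
have cp : {for s, continuous (fun r => (r, V r))}.
  by apply: (@continuous_pair _ _ _ id V); [exact: cvg_id|exact: cV].
suff dr : is_derive s 1 (fun r => hj (r, V r) - A r) 0.
  have := is_deriveD dr dA; rewrite add0r.
  suff -> : (fun r => hj (r, V r) - A r) + A = (fun r => hj (r, V r)) by [].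
  by apply/funext => r; rewrite !fctE subrK.
apply/is_derive_epsP => e e0.
have e1 : 0 < e / (1 + B) by rewrite divr_gt0// ltr_pwDl.
have := dh _ e1; rewrite near_withinE => /(near_comp cp) h1.
have h2 : \forall r \near s, 0 <= r by apply: (@cvgr_ge _ _ _ _ id s cvg_id).
apply: filterS (filterI h1 (filterI h2 VB)) => r [hr1 [hr2 hr3]].
have := hr1 hr2.
have -> : (r, V r) - (s, V s) = (r - s, V r - V s) by [].
rewrite (linear_row _ _ lK) mul0r subr0.
have -> : \sum_j (V r - V s) 0 j * K (0, delta_mx 0 j) =
   \sum_j V r 0 j * K (0, delta_mx 0 j) - \sum_j V s 0 j * K (0, delta_mx 0 j).
  by rewrite -sumrB; apply: eq_bigr => j _; rewrite !mxE mulrBl.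
have -> : forall X Y k1 S1 S2 : R, X - Y - ((r - s) * k1 + (S1 - S2)) =
   X - (r * k1 + S1) - (Y - (s * k1 + S2)) by move=> *; ring.
move=> /le_trans; apply; rewrite prod_normE/=.
apply: (@le_trans _ _ (e / (1 + B) * ((1 + B) * `|r - s|))).
  rewrite ler_pM2l// ge_max mulrDl mul1r lerDl mulr_ge0//=.
  by rewrite (le_trans hr3)// lerDr.
by rewrite mulrA divfK// gt_eqF// ltr_pwDl.
Qed.

End ChainRule.

Lemma countable_preimage_inj (T U : Type) (A : set U) (g : T -> U) :
  injective g -> countable A -> countable (g @^-1` A).
Proof.
move=> ig /countable_injP[k ik]; apply/countable_injP; exists (k \o g).
by move=> x y; rewrite !inE => Ax Ay /ik; rewrite !inE => /(_ Ax Ay)/ig.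
Qed.

(** * C^1 functions with prescribed values that vanish near the ends of [0, 1] *)

Section Interpolation.
Context {R : realType}.

Definition C1fun (g : R -> R) := exists2 g' : R -> R, continuous g' &
  forall x : R, is_derive x 1 g (g' x).

Lemma C1fun_continuous g : C1fun g -> continuous g.
Proof. by move=> [g' _ dg] x; exact: is_derive_continuous (dg x). Qed.

Lemma C1fun_cst c : C1fun (fun=> c).
Proof.
by exists (fun=> 0) => x; [exact: cvg_cst|exact: is_derive_cst].
Qed.

Lemma C1fun_id : C1fun id.
Proof. by exists (fun=> 1) => x; [exact: cvg_cst|exact: is_derive_id]. Qed.

Lemma C1funD g k : C1fun g -> C1fun k -> C1fun (fun x => g x + k x).
Proof.
move=> [g' cg dg] [k' ck dk]; exists (fun x => g' x + k' x) => x.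
  by apply: cvgD; [exact: cg|exact: ck].
exact: (is_deriveD (dg x) (dk x)).
Qed.

Lemma C1funM g k : C1fun g -> C1fun k -> C1fun (fun x => g x * k x).
Proof.
move=> Cg Ck; have cg0 := C1fun_continuous Cg; have ck0 := C1fun_continuous Ck.
case: Cg Ck => [g' cg dg] [k' ck dk]; exists (fun x => g x * k' x + k x * g' x) => x.
  by apply: cvgD; apply: cvgM; [exact: cg0|exact: ck|exact: ck0|exact: cg].
exact: (is_deriveM (dg x) (dk x)).
Qed.

Lemma C1fun_comp g k : C1fun g -> C1fun k -> C1fun (fun x => g (k x)).
Proof.
move=> [g' cg dg] Ck; have ck0 := C1fun_continuous Ck.
case: Ck => [k' ck dk]; exists (fun x => g' (k x) * k' x) => x.
  apply: cvgM; last exact: ck.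
  by apply: (@continuous_comp _ _ _ k g'); [exact: ck0|exact: cg].
exact: (@is_derive1_comp _ g k x _ _ (dg _) (dk _)).
Qed.

(** Newton's scheme: a multiple of the product of the [x - z] over the earlier nodes corrects the
    value at the new node. *)
Lemma C1fun_interpolation (s : seq R) (v : R -> R) :
  exists2 g, C1fun g & forall y, y \in s -> g y = v y.
Proof.
elim: s => [|y s [g Cg gv]]; first by exists (fun=> 0); [exact: C1fun_cst|].
have [ys|ys] := boolP (y \in s).
  by exists g => // z; rewrite inE => /predU1P[->|]; exact: gv.
pose w x := \prod_(z <- s) (x - z).
have Cw : C1fun w.
  rewrite /w; elim: s {gv ys w} => [|z s IH].
    by under eq_fun do rewrite big_nil; exact: C1fun_cst.
  under eq_fun do rewrite big_cons; apply: C1funM IH.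
  by apply: C1funD; [exact: C1fun_id|exact: C1fun_cst].
have wy : w y != 0.
  rewrite /w prodf_seq_neq0; apply/allP => z zs /=.
  by rewrite subr_eq0; apply: contraNneq ys => ->.
exists (fun x => g x + (v y - g y) / w y * w x).
  by apply: C1funD => //; apply: C1funM => //; exact: C1fun_cst.
move=> z; rewrite inE => /predU1P[->|zs]; first by rewrite divfK// addrC subrK.
suff -> : w z = 0 by rewrite mulr0 addr0 gv.
by apply/eqP; rewrite /w prodf_seq_eq0; apply/hasP; exists z => //=; rewrite subrr.
Qed.

Definition sqpos (x : R) := Num.max x 0 ^+ 2.

Lemma sqpos_C1 : C1fun sqpos.
Proof.
have cmax : continuous (fun x : R => Num.max x 0).
  by move=> x; apply: (@continuous_max R R id (cst 0) x); [exact: cvg_id|exact: cvg_cst].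
exists (fun x => 2 * Num.max x 0) => x; first by apply: cvgM; [exact: cvg_cst|exact: cmax].
have dsq : is_derive x 1 (fun y : R => y * y) (2 * x).
  have := is_deriveM (is_derive_id x (1 : R)) (is_derive_id x (1 : R)).
  by move=> H; apply: is_derive_eq H _; rewrite /GRing.scale/=; ring.
have [x0|x0|x0] := ltrgtP x 0.
- rewrite mulr0; apply: near_eq_is_derive (is_derive_cst 0 x (1 : R)); near=> y.
  have y0 : y <= 0 by near: y; apply: (@cvgr_le _ _ _ _ id x cvg_id).
  by rewrite /sqpos (max_idPr y0) expr0n.
- apply: near_eq_is_derive dsq; near=> y.
  have y0 : 0 <= y by near: y; apply: (@cvgr_ge _ _ _ _ id x cvg_id).
  by rewrite /sqpos (max_idPl y0).
- subst x; apply: (@is_derive_glue _ sqpos (fun y : R => y * y) (fun=> 0)).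
  + by move=> y y0; rewrite /sqpos (max_idPl y0).
  + by move=> y y0; rewrite /sqpos (max_idPr y0) expr0n.
  + by apply: is_derive_eq (is_derive_cst 0 (0 : R) (1 : R)) _; rewrite ?mulr0.
Unshelve. all: by end_near. Qed.

Definition edge_bump (gam x : R) := sqpos (x - gam) * sqpos (1 - gam - x).

Lemma edge_bump_C1 gam : C1fun (edge_bump gam).
Proof.
apply: C1funM; apply: (C1fun_comp sqpos_C1).
  by apply: C1funD; [exact: C1fun_id|exact: C1fun_cst].
apply: C1funD; first exact: C1fun_cst.
by exists (fun=> -1) => x; [exact: cvg_cst|exact: is_deriveN (is_derive_id _ _)].
Qed.

Lemma edge_bump_eq0 gam x : x <= gam \/ 1 - gam <= x -> edge_bump gam x = 0.
Proof.
by rewrite /edge_bump /sqpos; case=> h; [rewrite (@max_idPr _ _ (x - gam) 0 _)|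
  rewrite (@max_idPr _ _ (1 - gam - x) 0 _)]; rewrite ?expr0n ?mul0r ?mulr0// subr_le0.
Qed.

Lemma edge_bump_gt0 gam x : gam < x < 1 - gam -> 0 < edge_bump gam x.
Proof.
by move=> /andP[h1 h2]; rewrite mulr_gt0// exprn_gt0// lt_max subr_gt0 ?h1 ?h2.
Qed.

End Interpolation.

(** Together with [h (t, 0) = 0], vanishing near both ends yields compatibility at the corners and
    zero inflow around the label 0. *)
Definition test_fun {R : realType} {n : nat} (psi : R -> 'rV[R]_n) (gam : R) :=
  [/\ 0 < gam < 2^-1, forall j, C1fun (fun x => psi x 0 j) &
      forall x, x <= gam \/ 1 - gam <= x -> psi x = 0].

Lemma test_fun_interpolation {R : realType} {n : nat} (ys : seq R)
    (phi : R -> 'rV[R]_n) : (forall y, y \in ys -> 0 < y < 1) ->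
  exists psi gam, test_fun psi gam /\ forall y, y \in ys -> psi y = phi y.
Proof.
move=> ys01.
have [gam g0 gys] : exists2 gam, 0 < gam < 2^-1 &
    forall y, y \in ys -> gam < y < 1 - gam.
  elim: ys ys01 => [|y ys IH] ys01.
    by exists 4^-1 => //; rewrite invr_gt0 ltr0n/= ltf_pV2 ?posrE// ltr_nat.
  have [z zs|gam /andP[g0 g1] gys] := IH; first by apply: ys01; rewrite inE zs orbT.
  have /andP[y0 y1] := ys01 y (mem_head _ _).
  exists (Num.min gam (Num.min (y / 2) ((1 - y) / 2))).
    rewrite !lt_min g0 !divr_gt0 ?subr_gt0//=.
    by rewrite (le_lt_trans _ g1)// ge_min lexx.
  move=> z; rewrite inE => /predU1P[->|/gys/andP[z0 z1]].
    set M := Num.min _ _; have h1 : M <= y / 2 by rewrite /M !ge_min lexx orbT.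
    have h2 : M <= (1 - y) / 2 by rewrite /M !ge_min lexx !orbT.
    by apply/andP; split; lra.
  set M := Num.min _ _; have h1 : M <= gam by rewrite /M ge_min lexx.
  by apply/andP; split; lra.
(* The prescribed values are divided by the bump, positive at the nodes, because the interpolant is
   multiplied by it afterwards. *)
have /choice[g hg] : forall j : 'I_n, exists g : R -> R, C1fun g /\
    forall y, y \in ys -> g y = phi y 0 j / edge_bump gam y.
  move=> j; have [g Cg gv] := C1fun_interpolation ys (fun y => phi y 0 j / edge_bump gam y).
  by exists g.
exists (fun x => \row_j (edge_bump gam x * g j x)), gam; split.
  split => //.
    move=> j; under eq_fun do rewrite mxE.
    by apply: C1funM; [exact: edge_bump_C1|exact: (hg j).1].
  by move=> x hx; apply/rowP => j; rewrite !mxE edge_bump_eq0// mul0r.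
move=> y ysy; apply/rowP => j; rewrite mxE (hg j).2// mulrC divfK//.
by rewrite gt_eqF// edge_bump_gt0// gys.
Qed.

(** * Density of test functions in L^2 *)

Section Density.
Context {R : realType}.
Local Notation mu := (@lebesgue_measure R).
Local Notation I01 := ([set` `]0 : R, 1[]).

(** Squared L^2 distance on ]0, 1[; squares add up over the components of a row. *)
Definition sqdist (f g : R -> R) : \bar R :=
  (\int[mu]_(x in I01) ((f x - g x) ^+ 2)%:E)%E.

Lemma measurable_sqdist (f g : R -> R) : measurable_fun I01 f -> measurable_fun I01 g ->
  measurable_fun I01 (fun x => ((f x - g x) ^+ 2)%:E).
Proof.
move=> mf mg; apply/measurable_EFinP; apply: measurable_funX.
exact: measurable_funB.
Qed.

Lemma sqdist_ge0 (f g : R -> R) : (0 <= sqdist f g)%E.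
Proof. by apply: integral_ge0 => x _; rewrite lee_fin sqr_ge0. Qed.

(** The inequality (x + y)^2 <= 2 x^2 + 2 y^2, the difference being (x - y)^2. *)
Lemma sqdist_trans (k f g : R -> R) : measurable_fun I01 f -> measurable_fun I01 k ->
  measurable_fun I01 g -> (sqdist f g <= 2%:E * sqdist f k + 2%:E * sqdist k g)%E.
Proof.
move=> mf mk mg; have mfk := measurable_sqdist mf mk; have mkg := measurable_sqdist mk mg.
have p0 (f1 g1 : R -> R) x : I01 x -> (0 <= ((f1 x - g1 x) ^+ 2)%:E)%E.
  by move=> _; rewrite lee_fin sqr_ge0.
rewrite /sqdist -!ge0_integralZl_EFin//; try exact: p0.
rewrite -ge0_integralD//; try (by move=> x Ix; rewrite mule_ge0// p0);
  try exact: measurable_funeM.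
apply: ge0_le_integral => //; first exact: p0.
- exact: measurable_sqdist.
- by apply: emeasurable_funD; exact: measurable_funeM.
- move=> x _; rewrite -!EFinM -EFinD lee_fin -subr_ge0.
  rewrite (_ : _ - _ = (f x - k x - (k x - g x)) ^+ 2) ?sqr_ge0//; ring.
Qed.

Lemma near_le_cvge0 (F : nat -> \bar R) (e : R) : 0 < e -> F k @[k --> \oo] --> 0%E ->
  \forall k \near \oo, (F k <= e%:E)%E.
Proof.
move=> e0 h; have h0 : nbhs (0%E : \bar R) [set y | (y < e%:E)%E].
  by apply: open_nbhs_nbhs; split; [exact: open_ereal_lt_ereal|rewrite /= lte_fin].
have h1 : \forall k \near \oo, (F k < e%:E)%E := h _ h0.
by apply: filterS h1 => k; exact: ltW.
Qed.

Lemma sqdist_dominated (f_ : nat -> R -> R) (f G : R -> R) :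
  (forall k, measurable_fun I01 (f_ k)) -> measurable_fun I01 f ->
  (forall x, I01 x -> f_ k x @[k --> \oo] --> f x) ->
  mu.-integrable I01 (EFin \o G) ->
  (forall k x, I01 x -> (f x - f_ k x) ^+ 2 <= G x) ->
  sqdist f (f_ k) @[k --> \oo] --> 0%E.
Proof.
move=> mf_ mf cvf iG fG.
have [] := @dominated_convergence _ _ _ mu I01 (measurable_itv _)
  (fun k x => ((f x - f_ k x) ^+ 2)%:E) (cst 0%E) (EFin \o G).
- by move=> k; exact: measurable_sqdist.
- exact: measurable_cst.
- apply: aeW => x Ix; apply: cvg_EFin; first by near=> k.
  have c0 : f x - f_ k x @[k --> \oo] --> (0 : R).
    by rewrite -(subrr (f x)); apply: cvgB; [exact: cvg_cst|exact: cvf].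
  by rewrite -[X in _ --> X](mulr0 (0 : R)); exact: (cvgM c0 c0).
- exact: iG.
- apply: aeW => x k Ix /=; rewrite lee_fin ger0_norm ?sqr_ge0//; exact: fG.
- by rewrite integral0.
Unshelve. all: by end_near. Qed.

Definition clamp (N x : R) : R := Num.max (- N) (Num.min x N).

Lemma clamp_norm N x : 0 <= N -> `|clamp N x| <= N.
Proof.
move=> N0; rewrite ler_norml /clamp le_max lexx/= ge_max ge_min lexx orbT andbT.
lra.
Qed.

Lemma clamp_id N x : `|x| <= N -> clamp N x = x.
Proof. by rewrite ler_norml /clamp => /andP[h1 h2]; rewrite (min_idPl h2) (max_idPr h1). Qed.

Lemma clamp_cases N x : 0 <= N ->
  [\/ x <= - N /\ clamp N x = - N, - N <= x <= N /\ clamp N x = x |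
      N <= x /\ clamp N x = N].
Proof.
move=> N0; have NN : - N <= N by lra.
have [/ltW h1|h1] := ltP x (- N).
  by apply: Or31; rewrite /clamp (min_idPl (le_trans h1 NN)) (max_idPl h1).
have [h2|/ltW h2] := leP x N.
  by apply: Or32; split; [apply/andP|rewrite clamp_id// ler_norml; apply/andP].
by apply: Or33; rewrite /clamp (min_idPr h2) (max_idPr NN).
Qed.

Lemma clamp_lip N x y : 0 <= N -> `|clamp N x - clamp N y| <= `|x - y|.
Proof.
move=> N0; have [h|h] := ler0P (x - y);
  have [[h1 ->]|[/andP[h1 h1'] ->]|[h1 ->]] := clamp_cases x N0;
  have [[h2 ->]|[/andP[h2 h2'] ->]|[h2 ->]] := clamp_cases y N0;
  rewrite ler_norml; apply/andP; split; lra.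
Qed.

Lemma clamp_continuous N : 0 <= N -> continuous (clamp N).
Proof.
move=> N0 x; apply/cvgrPdist_le => e e0.
have : \forall y \near x, `|x - y| <= e by apply/nbhs_normP; exists e => //= y /ltW.
by apply: filterS => y; apply: le_trans; exact: clamp_lip.
Qed.

Lemma measurable_clamp N (f : R -> R) : 0 <= N -> measurable_fun I01 f ->
  measurable_fun I01 (fun x => clamp N (f x)).
Proof.
move=> N0 mf; apply: (measurableT_comp _ mf).
exact: continuous_measurable_fun (clamp_continuous N0).
Qed.

(** Dominated convergence with majorant [f ^+ 2], since truncation moves a value by at most its
    absolute value. *)
Lemma sqdist_clamp (f : R -> R) (e : R) : measurable_fun I01 f ->
  (\int[mu]_(x in I01) ((f x) ^+ 2)%:E < +oo)%E -> 0 < e ->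
  exists2 N, 0 < N & (sqdist f (fun x => clamp N (f x)) <= e%:E)%E.
Proof.
move=> mf foo e0.
have h : sqdist f (fun x => clamp k.+1%:R (f x)) @[k --> \oo] --> 0%E.
  apply: (sqdist_dominated (G := fun x => f x ^+ 2)) => //.
  - by move=> k; exact: measurable_clamp.
  - move=> x _; apply: cvg_near_cst.
    have := archi_boundP (normr_ge0 (f x)); set N := Num.bound _ => hN.
    exists N => // k /= Nk; apply: clamp_id.
    by rewrite (le_trans (ltW hN))// ler_nat (leq_trans Nk).
  - apply/integrableP; split.
      by apply/measurable_EFinP; exact: measurable_funX.
    apply: le_lt_trans foo; rewrite le_eqVlt; apply/orP; left; apply/eqP.
    by apply: eq_integral => x _ /=; rewrite ger0_norm ?sqr_ge0.
  - move=> k x _; rewrite -(real_normK (num_real (f x))) -(real_normK (num_real (_ - _))).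
    rewrite ler_pXn2r ?nnegrE//.
    have N0 : 0 <= k.+1%:R :> R by [].
    have [[h1 ->]|[_ ->]|[h1 ->]] := clamp_cases (f x) N0.
    + by rewrite !ler0_norm; lra.
    + by rewrite subrr normr0.
    + by rewrite !ger0_norm; lra.
have /filter_ex[k hk] := near_le_cvge0 e0 h.
by exists k.+1%:R.
Qed.

(** For functions bounded by [N] the squared difference is at most [2 * N] times the difference, so
    approximation in L^1 is enough; clamping keeps the bound. *)
Lemma sqdist_continuous (f : R -> R) (N e : R) : 0 < N -> measurable_fun I01 f ->
  (forall x, `|f x| <= N) -> 0 < e ->
  exists g, [/\ continuous g, forall x, `|g x| <= N & (sqdist f g <= e%:E)%E].
Proof.
move=> N0 mf fN e0.
have fin : (mu I01 < +oo)%E by rewrite lebesgue_measure_itv/= lte_fin ltr01 ltry.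
have if1 : mu.-integrable I01 (EFin \o f).
  apply: measurable_bounded_integrable => //.
  exists N; split; first exact: num_real.
  by move=> M NM x _; rewrite /= (le_trans (fN x))// ltW.
have [g_ [cg ig h]] := approximation_continuous_integrable (measurable_itv _) fin if1.
have e1 : 0 < e / (2 * N) by rewrite divr_gt0// mulr_gt0.
have /filter_ex[k hk] := near_le_cvge0 e1 h.
exists (fun x => clamp N (g_ k x)); split.
- move=> x; apply: (@continuous_comp _ _ _ (g_ k) (clamp N)); first exact: cg.
  exact: clamp_continuous (ltW N0) _.
- by move=> x; exact: clamp_norm (ltW N0).
have mg : measurable_fun I01 (g_ k).
  exact: measurable_funTS (continuous_measurable_fun (cg k)).
apply: (@le_trans _ _ (\int[mu]_(x in I01) ((2 * N)%:E * `|(f x - g_ k x)%:E|))%E).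
  apply: ge0_le_integral => //.
  - by move=> x _; rewrite lee_fin sqr_ge0.
  - by apply: measurable_sqdist => //; exact: measurable_clamp (ltW N0) mg.
  - apply: measurable_funeM; apply: measurableT_comp => //.
    by apply/measurable_EFinP; exact: measurable_funB.
  - move=> x _; rewrite abse_EFin -EFinM lee_fin.
    rewrite -(real_normK (num_real (_ - _))) expr2; apply: ler_pM => //.
      rewrite (le_trans (ler_normB _ _))// mulr_natl mulr2n lerD//.
      exact: clamp_norm (ltW N0).
    by rewrite -{1}(clamp_id (fN x)); exact: clamp_lip (ltW N0).
rewrite ge0_integralZl_EFin//; last 2 first.
- apply: measurableT_comp => //.
  by apply/measurable_EFinP; exact: measurable_funB.
- by rewrite mulr_ge0// ltW.
apply: le_trans (lee_wpmul2l _ hk) _; first by rewrite lee_fin mulr_ge0// ltW.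
by rewrite -EFinM lee_fin mulrC divfK// gt_eqF// mulr_gt0.
Qed.

(** Equal to 0 where the bump vanishes and to 1 where the bump is at least 1 / (k + 1). The margin 1
    / (k + 3) is always below 1/2 and tends to 0. *)
Definition cutoff (k : nat) (x : R) : R :=
  1 - sqpos (1 - k.+1%:R * edge_bump k.+3%:R^-1 x).

Lemma sqpos_ge0 (x : R) : 0 <= sqpos x.
Proof. exact: sqr_ge0. Qed.

Lemma cutoff01 k x : 0 <= cutoff k x <= 1.
Proof.
have b0 : 0 <= edge_bump k.+3%:R^-1 x by rewrite mulr_ge0 ?sqpos_ge0.
rewrite /cutoff subr_ge0 gerBl sqpos_ge0 andbT /sqpos.
rewrite expr_le1// ?le_max ?lexx ?orbT// ge_max ler01 andbT gerBl mulr_ge0//.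
Qed.

Lemma cutoff_C1 k : C1fun (cutoff k).
Proof.
have C1N g : C1fun g -> C1fun (fun x : R => 1 - g x).
  move=> Cg; have := C1funD (C1fun_cst 1) (C1funM (C1fun_cst (- 1)) Cg).
  by congr C1fun; apply/funext => x; rewrite mulN1r.
apply: (C1N (fun x => sqpos _)); apply: (C1fun_comp sqpos_C1).
by apply: C1N; apply: C1funM; [exact: C1fun_cst|exact: edge_bump_C1].
Qed.

Lemma cutoff_eq0 k x : x <= k.+3%:R^-1 \/ 1 - k.+3%:R^-1 <= x -> cutoff k x = 0.
Proof.
move=> h; rewrite /cutoff edge_bump_eq0// mulr0 subr0 /sqpos (max_idPl _) ?ler01//.
by rewrite expr1n subrr.
Qed.

Lemma cutoff_eq1 x : 0 < x < 1 -> \forall k \near \oo, cutoff k x = 1.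
Proof.
move=> /andP[x0 x1].
have x2 : 0 < x / 2 by rewrite divr_gt0.
have x3 : 0 < (1 - x) / 2 by rewrite divr_gt0// subr_gt0.
pose beta := (x / 2) ^+ 2 * ((1 - x) / 2) ^+ 2.
have beta0 : 0 < beta by rewrite mulr_gt0// exprn_gt0.
have hle (c : R) : 0 < c -> \forall k \near \oo, k.+1%:R^-1 <= c.
  move=> c0; have := @cvg_harmonic R; move/cvgrPdist_le/(_ _ c0).
  by apply: filterS => k; rewrite sub0r normrN ger0_norm ?harmonic_ge0.
apply: filterS (filterI (hle _ x2) (filterI (hle _ x3) (hle _ beta0))) => k [h1 [h2 h3]].
have g1 : k.+3%:R^-1 <= k.+1%:R^-1 :> R by rewrite lef_pV2 ?posrE// ler_nat -addn2 leq_addr.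
rewrite /cutoff (_ : sqpos _ = 0) ?subr0//.
rewrite /sqpos (max_idPr _) ?expr0n// subr_le0.
have : beta <= edge_bump k.+3%:R^-1 x.
  have sq (y z : R) : 0 <= y -> y <= z -> y ^+ 2 <= sqpos z.
    move=> y0 yz; rewrite /sqpos (max_idPl _) ?ler_pXn2r ?nnegrE// (le_trans y0)//.
  have aux (z : R) : z <= x / 2 -> z <= (1 - x) / 2 ->
      x / 2 <= x - z /\ (1 - x) / 2 <= 1 - z - x by move=> *; split; lra.
  have [a1 a2] := aux _ (le_trans g1 h1) (le_trans g1 h2).
  by apply: ler_pM; rewrite ?sqr_ge0//; apply: sq; rewrite ?(ltW x2) ?(ltW x3).
move=> hb; apply: (@le_trans _ _ (k.+1%:R * beta)); last by rewrite ler_pM2l.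
by rewrite -ler_pdivrMl// mulr1.
Qed.

(** The difference quotients [A k] of a primitive are C^1, bounded by [N], and converge pointwise to
    [f]. The cutoffs make them vanish near the ends, and dominated convergence applies. *)
Lemma sqdist_C1 (f : R -> R) (N e : R) : continuous f ->
  (forall x, `|f x| <= N) -> 0 < e ->
  exists g gam, [/\ 0 < gam < 2^-1, C1fun g,
    forall x, x <= gam \/ 1 - gam <= x -> g x = 0 & (sqdist f g <= e%:E)%E].
Proof.
move=> cf fN e0; pose P := primitive f.
have dP (x : R) : is_derive x 1 P (f x) by exact: is_derive_primitive.
pose A (k : nat) x := k.+1%:R * (P (x + k.+1%:R^-1) - P x).
have k0 (k : nat) : 0 < k.+1%:R^-1 :> R by rewrite invr_gt0.
have AN k x : `|A k x| <= N.
  rewrite normrM ger0_norm// -ler_pdivlMl// mulrC.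
  rewrite -[X in N * X](ger0_norm (ltW (k0 k))) -[X in N * `|X|](addrK x) [_ + x]addrC.
  exact: (ler_dist_derive_cst (f := f)).
have AC1 k : C1fun (A k).
  have CP : C1fun P by exists f.
  apply: C1funM; first exact: C1fun_cst.
  have := C1funD (C1fun_comp CP (C1funD C1fun_id (C1fun_cst k.+1%:R^-1)))
     (C1funM (C1fun_cst (- 1)) CP).
  by congr C1fun; apply/funext => x; rewrite mulN1r.
have GC1 k : C1fun (fun x => cutoff k x * A k x) by apply: C1funM => //; exact: cutoff_C1.
have h : sqdist f (fun x => cutoff k x * A k x) @[k --> \oo] --> 0%E.
  apply: (sqdist_dominated (G := fun=> (2 * N) ^+ 2)).
  - move=> k; apply: measurable_funTS; apply: continuous_measurable_fun.
    exact: C1fun_continuous.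
  - exact: measurable_funTS (continuous_measurable_fun cf).
  - move=> x; rewrite /= in_itv/= => x01; apply/cvgrPdist_le => d d0.
    have ck : {for (0 : R), continuous (fun s => x + s)}.
      by apply: cvgD; [exact: cvg_cst|exact: cvg_id].
    have /is_derive_epsP/(_ _ d0) := dP x.
    rewrite -{1}[x]addr0 => /(near_comp ck)/cvg_harmonic.
    apply: filterS2 (cutoff_eq1 x01) => k -> /=.
    have -> : x + k.+1%:R^-1 - x = k.+1%:R^-1 :> R by rewrite addrAC subrr add0r.
    rewrite mul1r => h1; rewrite distrC.
    have -> : A k x - f x = k.+1%:R * (P (x + k.+1%:R^-1) - P x - f x * k.+1%:R^-1).
      by rewrite mulrBr mulrCA divff ?mulr1// pnatr_eq0.
    rewrite normrM ger0_norm// -ler_pdivlMl// (le_trans h1)//.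
    by rewrite ger0_norm ?(ltW (k0 k))// mulrC.
  - have fin : (mu I01 < +oo)%E by rewrite lebesgue_measure_itv/= lte_fin ltr01 ltry.
    apply: measurable_bounded_integrable => //.
    exists ((2 * N) ^+ 2); split; first exact: num_real.
    by move=> M NM x _; rewrite /= ger0_norm ?sqr_ge0// ltW.
  - move=> k x _; rewrite -(real_normK (num_real (_ - _))) ler_pXn2r ?nnegrE//; last first.
      by rewrite mulr_ge0// (le_trans (normr_ge0 (f 0))).
    rewrite (le_trans (ler_normB _ _))// mulr_natl mulr2n lerD//.
    have /andP[c0 c1] := cutoff01 k x.
    by rewrite normrM ger0_norm// (le_trans _ (AN k x))// ler_piMl.
have /filter_ex[k hk] := near_le_cvge0 e0 h.
exists (fun x => cutoff k x * A k x), k.+3%:R^-1; split => //.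
  by rewrite invr_gt0 ltr0n/= ltf_pV2 ?posrE// ltr_nat.
by move=> x hx; rewrite cutoff_eq0// mul0r.
Qed.

Lemma C1fun_dense (f : R -> R) (e : R) : measurable_fun I01 f ->
  (\int[mu]_(x in I01) ((f x) ^+ 2)%:E < +oo)%E -> 0 < e ->
  exists g gam, [/\ 0 < gam < 2^-1, C1fun g,
    forall x, x <= gam \/ 1 - gam <= x -> g x = 0 & (sqdist f g <= e%:E)%E].
Proof.
(* Two uses of [sqdist_trans] give 2/10 + 2 (2/10 + 2/10) = 1. *)
move=> mf foo e0; have e1 : 0 < e / 10 by rewrite divr_gt0.
have [N N0 h1] := sqdist_clamp mf foo e1.
have mc := measurable_clamp (ltW N0) mf.
have [g [cg gN h2]] := sqdist_continuous N0 mc (fun x => clamp_norm (f x) (ltW N0)) e1.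
have [k [gam [gam01 Ck k0 h3]]] := sqdist_C1 cg gN e1.
exists k, gam; split => //.
have mg : measurable_fun I01 g by exact: measurable_funTS (continuous_measurable_fun cg).
have mk : measurable_fun I01 k.
  exact: measurable_funTS (continuous_measurable_fun (C1fun_continuous Ck)).
apply: le_trans (sqdist_trans mf mc mk) _.
have p2 : (0 <= 2%:E :> \bar R)%E by rewrite lee_fin.
apply: (@le_trans _ _ (2%:E * (e / 10)%:E + 2%:E * (2%:E * (e / 10)%:E + 2%:E * (e / 10)%:E))%E).
  apply: leeD; apply: lee_wpmul2l => //.
  by apply: le_trans (sqdist_trans mc mg mk) _; apply: leeD; exact: lee_wpmul2l.
rewrite -!(EFinM, EFinD) lee_fin; lra.
Qed.

Lemma sqdistC (f g : R -> R) : sqdist f g = sqdist g f.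
Proof. by apply: eq_integral => x _; rewrite -sqrrN opprB. Qed.

Lemma vanish_dense (g : R -> R) : {within `[0, 1], continuous g} ->
  (forall c d, 0 <= c -> c < d -> d <= 1 -> exists2 x, c <= x <= d & g x = 0) ->
  forall x, 0 <= x <= 1 -> g x = 0.
Proof.
have tr (c z e : R) : 0 <= c -> c <= z <= e -> e <= 1 -> 0 <= z <= 1.
  by move=> ? /andP[? ?] ?; apply/andP; split; lra.
move=> /subspace_continuousP cg dense x0 x01; apply/eqP/negPn/negP => nz.
have x01' : `[0, 1]%classic x0 by rewrite /= in_itv.
have e0 : 0 < `|g x0| by rewrite normr_gt0.
move: (cg _ x01') => /cvgrPdist_lt/(_ _ e0); rewrite near_withinE.
move=> /nbhs_ballP[d /= d0 hd].
have d'0 : 0 < Num.min (d / 2) (2^-1) by rewrite lt_min divr_gt0//= invr_gt0.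
set d' := Num.min _ _ in d'0.
have [d'd d'2] : d' <= d / 2 /\ d' <= 2^-1 by rewrite /d' !ge_min !lexx orbT.
(* An interval with end point [x0] that remains in [0, 1]: to the right of [x0] on the first half,
   to the left on the second. *)
have [c [cd' c0 c1 c2]] : exists c : R, [/\ x0 - d' <= c, c + d' <= x0 + d', 0 <= c & c + d' <= 1].
  case/andP: x01 => x00 x01.
  case: (leP x0 2^-1) => hx; first by exists x0; split; lra.
  by exists (x0 - d'); split; lra.
have cc : c < c + d' by rewrite ltrDl.
have [x xc gx] := dense _ _ c1 cc c2.
have xin : `[0, 1]%classic x by rewrite /= in_itv/=; exact: tr c1 xc c2.
have xd : `|x0 - x| < d.
  by case/andP: xc => xc1 xc2; rewrite ltr_norml; apply/andP; split; lra.
by have := hd x xd xin; rewrite /from_subspace/= gx subr0 ltxx.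
Qed.

(** Otherwise, by [vanish_dense], some interval of positive length would contain no zero of [g],
    although [g] vanishes almost everywhere. *)
Lemma sqdist_eq0 (g : R -> R) : {within `[0, 1], continuous g} ->
  sqdist g (fun=> 0) = 0%E -> forall x, 0 <= x <= 1 -> g x = 0.
Proof.
move=> cg g0; apply: vanish_dense => // c d c0 cd d1.
have mg : measurable_fun I01 g.
  apply: subspace_continuous_measurable_fun => //.
  by apply: continuous_subspaceW cg; exact: subset_itv_oo_cc.
have m2 : measurable_fun I01 (fun x => ((g x - 0) ^+ 2)%:E) by exact: measurable_sqdist.
have : (\int[mu]_(x in I01) `|((g x - 0) ^+ 2)%:E| = 0)%E.
  by rewrite -[RHS]g0; apply: eq_integral => x _ /=; rewrite ger0_norm ?sqr_ge0.
move=> /(ae_eq_integral_abs mu (measurable_itv _) m2) ae.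
apply: contrapT => H.
have ng : mu.-negligible `](c : R), d[.
  apply: negligibleS ae => x /=; rewrite in_itv/= => /andP[cx xd] gx.
  apply: H; exists x; first by rewrite !ltW.
  have : I01 x by rewrite /= in_itv/= (le_lt_trans c0)// (lt_le_trans xd).
  by move=> /gx/eqP; rewrite eqe subr0 sqrf_eq0 => /eqP.
have : mu `]c, d[%classic = 0%E := (negligibleP mu (measurable_itv `]c, d[)).1 ng.
rewrite lebesgue_measure_itv/= lte_fin cd -EFinB => /eqP.
by rewrite eqe subr_eq0 gt_eqF.
Qed.

End Density.

Section DensityRow.
Context {R : realType} {n : nat}.

Lemma L2normE (f : R -> 'rV[R]_n) :
  L2norm f = sqrte (\sum_(j < n) sqdist (fun x => f x 0 j)%R (fun=> 0)%R)%E.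
Proof.
rewrite /L2norm; congr sqrte; apply: eq_bigr => j _.
by apply: eq_integral => x _; rewrite subr0.
Qed.

Lemma L2distE (f g : R -> 'rV[R]_n) :
  L2dist f g = sqrte (\sum_(j < n) sqdist (fun x => f x 0 j)%R (fun x => g x 0 j)%R)%E.
Proof.
rewrite /L2dist /L2norm; congr sqrte; apply: eq_bigr => j _.
by apply: eq_integral => x _; rewrite !mxE.
Qed.

Lemma sqrte_lty (x : \bar R) : (sqrte x < +oo)%E = (x < +oo)%E.
Proof. by case: x => [x||] //=; rewrite !ltry. Qed.

Lemma L2_coord (phi : R -> 'rV[R]_n) j : L2 phi ->
  (\int[lebesgue_measure]_(x in [set` `]0%R : R, 1%R[]) ((phi x 0 j) ^+ 2)%:E < +oo)%E.
Proof.
move=> [_]; rewrite /L2norm; set S := (\sum_(_ < _) _)%E => hS.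
have ge0 k : (0 <= \int[lebesgue_measure]_(x in [set` `]0%R : R, 1%R[]) ((phi x 0 k) ^+ 2)%:E)%E.
  by apply: integral_ge0 => x _; rewrite lee_fin sqr_ge0.
have : (S < +oo)%E by rewrite -sqrte_lty.
by apply: le_lt_trans; rewrite /S (bigD1 j)//= leeDl// sume_ge0.
Qed.

Lemma test_fun_dense (phi : R -> 'rV[R]_n) (e : R) : L2 phi -> 0 < e ->
  exists psi gam, test_fun psi gam /\ (L2dist psi phi <= e%:E)%E.
Proof.
(* The sum of [n] such terms is at most [e ^+ 2]; the denominator n + 1 also allows n = 0. *)
move=> Lphi e0; have d0 : 0 < e ^+ 2 / n.+1%:R by rewrite divr_gt0// exprn_gt0.
have /choice[g hg] : forall j, exists g : R -> R, exists gam, [/\ 0 < gam < 2^-1, C1fun g,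
    forall x, x <= gam \/ 1 - gam <= x -> g x = 0 &
    (sqdist (fun x => phi x 0 j)%R g <= (e ^+ 2 / n.+1%:R)%:E)%E].
  move=> j; apply: C1fun_dense d0; first exact: Lphi.1.
  exact: L2_coord.
(* Each component comes with its own margin; any small enough [gam] serves them all. *)
have : \forall gam \near (0 : R)^'+, [/\ 0 < gam, gam < 2^-1 & forall j,
    forall x, x <= gam \/ 1 - gam <= x -> g j x = 0].
  near=> gam; split.
  - by near: gam; exact: nbhs_right_gt.
  - by near: gam; apply: nbhs_right_lt; rewrite invr_gt0.
  near: gam; apply: filter_forall => j; have [gj [/andP[gj0 _] _ hj _]] := hg j.
  near=> gam => x hx; apply: hj.
  have : gam <= gj by near: gam; exact: nbhs_right_le.
  by case: hx => hx gg; [left|right]; lra.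
move=> /filter_ex[gam [gam0 gam2 hgam]].
exists (fun x => \row_j g j x), gam; split.
  split; first by rewrite gam0.
  - by move=> j; under eq_fun do rewrite mxE; have [? []] := hg j.
  - by move=> x hx; apply/rowP => j; rewrite !mxE hgam.
rewrite L2distE -[e%:E]/((e)%:E) -(ger0_norm (ltW e0)) -sqrtr_sqr.
rewrite -[(Num.sqrt _)%:E]/(sqrte (e ^+ 2)%:E) lee_sqrt; last by rewrite lee_fin sqr_ge0.
apply: (@le_trans _ _ (\sum_(j < n) (e ^+ 2 / n.+1%:R)%:E)%E).
  apply: lee_sum => j _; have [_ [_ _ _]] := hg j.
  move=> hj; apply: le_trans hj; rewrite le_eqVlt; apply/orP; left; apply/eqP.
  apply: eq_integral => x _; by rewrite mxE -sqrrN opprB.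
rewrite sumEFin lee_fin sumr_const card_ord -[leLHS]mulr_natl mulrA ler_pdivrMr//.
by rewrite mulrC ler_wpM2l ?sqr_ge0// ler_nat.
Unshelve. all: by end_near. Qed.

Lemma L2dist_coord (f g : R -> 'rV[R]_n) j : (forall e : R, 0 < e -> (L2dist f g <= e%:E)%E) ->
  sqdist (fun x => f x 0 j) (fun x => g x 0 j) = 0%E.
Proof.
move=> h; apply/eqP; rewrite eq_le sqdist_ge0 andbT; apply/lee_addgt0Pr => e e0.
rewrite add0e; have s0 : 0 < Num.sqrt e by rewrite sqrtr_gt0.
have := h _ s0; rewrite L2distE -[(Num.sqrt e)%:E]/(sqrte e%:E) lee_sqrt; last by rewrite lee_fin ltW.
by apply: le_trans; rewrite (bigD1 j)//= leeDl// sume_ge0// => k _; exact: sqdist_ge0.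
Qed.

Lemma L2norm_eq0 (f : R -> 'rV[R]_n) :
  L2norm f = 0%E <-> forall j, sqdist (fun x => f x 0 j)%R (fun=> 0)%R = 0%E.
Proof.
rewrite L2normE; split=> [f0 j|f0]; last by rewrite big1 ?sqrte0// => j _; exact: f0.
apply/eqP; rewrite eq_le sqdist_ge0 andbT.
have : (\sum_(j < n) sqdist (fun x => f x 0%R j) (fun=> 0%R) <= 0)%E.
  by rewrite -lee_sqrt// f0 sqrte0.
by apply: le_trans; rewrite (bigD1 j)//= leeDl// sume_ge0// => k _; exact: sqdist_ge0.
Qed.

Lemma test_fun_L2 (psi : R -> 'rV[R]_n) gam : test_fun psi gam -> L2 psi.
Proof.
move=> [_ C _]; have c j : continuous (fun x => psi x 0 j).
  exact: C1fun_continuous.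
split=> [j|]; first exact: measurable_funTS (continuous_measurable_fun (c j)).
rewrite /L2norm sqrte_lty; apply: lte_sum_pinfty => j _; apply: integrable_lty => //.
have ij : lebesgue_measure.-integrable `[0, 1] (EFin \o (fun x => psi x 0 j ^+ 2)).
  apply: continuous_compact_integrable; first exact: segment_compact.
  apply: continuous_subspaceT => x; rewrite /GRing.exp/=.
  by apply: cvgM; exact: c.
by apply: integrableS ij => //; exact: subset_itv_oo_cc.
Qed.

End DensityRow.

(** * The operator Q along characteristics *)

Section System.
Context {R : realType} {n : nat}.
Variable m : nat.
Variables (a b : 'I_n -> R * R -> R) (h : R * 'rV[R]_n -> 'rV[R]_n).
Variables Th L Tht Lt f bb : 'I_n -> R * R -> R.
Implicit Types (phi psi : R -> 'rV[R]_n) (u v w : R * R -> 'rV[R]_n).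
Implicit Types (x y s t T d : R) (j l : 'I_n) (p q : R * R) (k : nat).
Let o (j : 'I_n) : R := out_side R m j.
Let i (j : 'I_n) : R := in_side R m j.
Hypothesis tr : forall j, transport (a j) (b j) (out_side R m j) (in_side R m j)
  (Th j) (L j) (Tht j) (Lt j) (f j) (bb j).

Lemma sides j : (o j = 0 /\ i j = 1) \/ (o j = 1 /\ i j = 0).
Proof. by rewrite /o /i /out_side /in_side; case: ifP; [left|right]. Qed.

Lemma out01 j : 0 <= o j <= 1.
Proof. by case: (sides j) => -[-> _]; rewrite ?lexx ?ler01. Qed.

Lemma in01 j : 0 <= i j <= 1.
Proof. by case: (sides j) => -[_ ->]; rewrite ?lexx ?ler01. Qed.

Lemma Th_anti j x y t : 0 <= (i j - o j) * (y - x) -> Th j (y, t) <= Th j (x, t).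
Proof.
rewrite le_eqVlt => /predU1P[|/(tr_side (tr j) t)/ltW//].
by case: (sides j) => -[-> ->] e; rewrite (_ : y = x)//; move: e; lra.
Qed.

Lemma Th_le j x t : 0 <= x <= 1 -> Th j (x, t) <= t.
Proof.
move=> x01; rewrite -[leRHS](tr_out (tr j)) -/(o j); apply: Th_anti.
by move: x01; case: (sides j) => -[-> ->] /andP[]; lra.
Qed.

Lemma Th_in_le j x t : 0 <= x <= 1 -> Th j (i j, t) <= Th j (x, t).
Proof.
move=> x01; apply: Th_anti.
by move: x01; case: (sides j) => -[-> ->] /andP[]; lra.
Qed.

Lemma Th_in_lt j t : Th j (i j, t) < t.
Proof.
rewrite -[ltRHS](tr_out (tr j)); apply: (tr_side (tr j)).
by rewrite -/(i j) -/(o j); case: (sides j) => -[-> ->]; lra.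
Qed.

Lemma Th_inj j x y t : Th j (x, t) = Th j (y, t) -> x = y.
Proof.
move=> e; apply/eqP; case: (ltrgtP 0 ((i j - o j) * (y - x))) => [||/esym/eqP].
- by move/(tr_side (tr j) t); rewrite e ltxx.
- move=> h0; have : 0 < (i j - o j) * (x - y) by rewrite -[x - y]opprB mulrN oppr_gt0.
  by move/(tr_side (tr j) t); rewrite e ltxx.
- by case: (sides j) => -[-> ->] /eqP h0; apply/eqP; lra.
Qed.

Lemma Th_mono j x s t : s <= t -> Th j (x, s) <= Th j (x, t).
Proof.
by rewrite le_eqVlt => /predU1P[->//|/(tr_lt (tr j) x)/ltW].
Qed.

Lemma Th_onto j t s : Th j (i j, t) <= s <= t ->
  exists2 x, 0 <= x <= 1 & Th j (x, t) = s.
Proof.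
move=> /andP[s1 s2].
have [cTh _ _ _] := tr_cont (tr j).
have cx : continuous (fun x => Th j (x, t)).
  move=> x; apply: (@continuous_comp _ _ _ (fun x => (x, t)) (Th j)); last exact: cTh.
  by apply: (@continuous_pair _ _ _ id (cst t)); [exact: cvg_id|exact: cvg_cst].
have to : Th j (o j, t) = t by exact: (tr_out (tr j)).
have [x] : exists2 x, x \in `[(0 : R), 1] & Th j (x, t) = s.
  apply: IVT => //; first exact: continuous_subspaceT.
  by case: (sides j) => -[oE iE]; rewrite ge_min le_max;
    move: to s1; rewrite oE iE => ->; move=> ->; rewrite s2 ?orbT.
by rewrite in_itv/=; exists x.
Qed.

(* The foot on the initial axis of the characteristic of label [s < 0]. *)
Definition foot j (s : R) : R := xget 0 [set y | 0 <= y <= 1 /\ Th j (y, 0) = s].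

Lemma footP j y s : 0 <= y <= 1 -> Th j (y, 0) = s -> foot j s = y.
Proof.
move=> y01 yE; have : [set y | 0 <= y <= 1 /\ Th j (y, 0) = s] (foot j s).
  by apply: xgetPex; exists y.
by move=> [_ fE]; apply: (@Th_inj j _ _ 0); rewrite fE.
Qed.

Lemma foot_spec j s : Th j (i j, 0) <= s <= 0 ->
  0 <= foot j s <= 1 /\ Th j (foot j s, 0) = s.
Proof. by move/Th_onto => [y y01 yE]; rewrite (footP y01 yE). Qed.

(* Inflow data of the j-th component as a function of the label of the
   characteristic; the initial data play this role at negative times. *)
Definition inflow phi (w : R * R -> 'rV[R]_n) j (s : R) : R :=
  if 0 <= s then h (s, u_in m w s) 0 j
  else phi (foot j s) 0 j / expR (L j (foot j s, 0)).

(** On the axis branch the factor is exp(L p - L(foot)). Moving exp(-L(foot)) into [inflow] leaves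
    the same factor exp(L p) on both branches. *)
Lemma opQE phi w p j : Pi p ->
  opQ m a b h phi w p 0 j = expR (L j p) * inflow phi w j (Th j p).
Proof.
move=> Pp; rewrite mxE /inflow; case: leP => [T0|T0].
  have [lE oE cE] := tr_side_hit (tr j) Pp T0.
  by rewrite {1}lE eqxx mxE lE oE cE.
have [y [y01 yo yE lE cE]] := tr_axis_hit (tr j) Pp T0.
rewrite (footP y01 yE) lE (negbTE yo) cE expRD expRN; ring.
Qed.

(** [t - Th j (i j, t)] is the time spent crossing the strip; it is continuous and positive, hence
    bounded below on [0, T], and there are finitely many components. *)
Lemma delay T : 0 <= T -> exists2 d, 0 < d &
  forall j t, 0 <= t <= T -> Th j (i j, t) <= t - d.
Proof.
move=> T0.
have dj j : exists2 d, 0 < d & forall t, 0 <= t <= T -> Th j (i j, t) <= t - d.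
  have [cTh _ _ _] := tr_cont (tr j).
  have [||c _ hc] := @EVT_min R (fun t => t - Th j (i j, t)) 0 T => //.
    apply: continuous_subspaceT => t; apply: cvgB; first exact: cvg_id.
    apply: (@continuous_comp _ _ _ (fun t => (i j, t)) (Th j)); last exact: cTh.
    by apply: (@continuous_pair _ _ _ (cst (i j)) id); [exact: cvg_cst|exact: cvg_id].
  exists (c - Th j (i j, c)); first by rewrite subr_gt0 Th_in_lt.
  by move=> t tT; have := hc t; rewrite in_itv/= => /(_ tT); lra.
have : \forall d \near (0 : R)^'+, 0 < d /\ forall j t, 0 <= t <= T -> Th j (i j, t) <= t - d.
  near=> d; split; first by near: d; exact: nbhs_right_gt.
  near: d; apply: filter_forall => j; have [dd d0 hd] := dj j.
  near=> d => t tT; rewrite (le_trans (hd _ tT))// lerD2l lerN2.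
  by near: d; exact: nbhs_right_le.
by move=> /filter_ex[d [d0 hd]]; exists d.
Unshelve. all: by end_near. Qed.

Lemma Pi_in j t : 0 <= t -> Pi (i j, t).
Proof. by move=> t0; split => //; exact: in01. Qed.

Lemma inflow_ext phi psi w v j s : (forall x, 0 <= x <= 1 -> phi x = psi x) ->
  Th j (i j, 0) <= s ->
  (0 <= s -> u_in m w s = u_in m v s) -> inflow phi w j s = inflow psi v j s.
Proof.
move=> pp s0 wv; rewrite /inflow; case: leP => [h0|h0]; first by rewrite wv.
by rewrite pp//; apply: (foot_spec _).1; rewrite s0 ltW.
Qed.

(** Causality: a backward characteristic from [p] meets the inflow side no later than [p.2]. *)
Lemma opQ_ext phi psi w v p : (forall x, 0 <= x <= 1 -> phi x = psi x) ->
  Pi p -> (forall t, 0 <= t <= p.2 -> u_in m w t = u_in m v t) ->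
  opQ m a b h phi w p = opQ m a b h psi v p.
Proof.
case: p => x t pp [/= x01 t0] wv; apply/rowP => j; rewrite !opQE//; congr (_ * _).
apply: inflow_ext => // [|T0].
  by rewrite (le_trans _ (Th_in_le _ _ x01))// Th_mono.
by apply: wv; rewrite T0 Th_le.
Qed.

Lemma u_in_ext w v t : 0 <= t -> (forall p, Pi p -> p.2 <= t -> w p = v p) ->
  u_in m w t = u_in m v t.
Proof. by move=> t0 wv; apply/rowP => j; rewrite !mxE wv//; exact: Pi_in. Qed.

(** Each application of [Q] lengthens by [d] the time interval on which the traces depend on the
    initial data alone. That [k0] is uniform in the starting functions is essential: [Qpow_vanishes]
    asks for one exponent for all [w]. *)
Lemma iter_opQ_agree T : 0 <= T -> exists k0, forall k, (k0 <= k)%N ->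
  forall phi psi w v, (forall x, 0 <= x <= 1 -> phi x = psi x) ->
  forall p, Pi p -> p.2 <= T ->
  iter k (opQ m a b h phi) w p = iter k (opQ m a b h psi) v p.
Proof.
move=> T0; have [d d0 hd] := delay T0.
have key phi psi w v k : (forall x, 0 <= x <= 1 -> phi x = psi x) ->
    forall t, 0 <= t <= T -> t < k%:R * d ->
    u_in m (iter k (opQ m a b h phi) w) t = u_in m (iter k (opQ m a b h psi) v) t.
  move=> pp; elim: k => [|k IH] t tT tk.
    by move: tk tT; rewrite mul0r => tk /andP[t0 _]; move: (lt_le_trans tk t0); rewrite ltxx.
  have /andP[t0 tT'] := tT.
  apply/rowP => j; rewrite mxE [RHS]mxE /= !opQE; try exact: Pi_in.
  congr (_ * _); apply: inflow_ext => // [|T0']; first exact: Th_mono.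
  have le := hd j t tT; apply: IH.
    by rewrite T0' (le_trans (Th_le _ _ (in01 j)))//.
  by rewrite (le_lt_trans le)// ltrBlDr -[X in _ + X]mul1r -mulrDl natr1.
have := archi_boundP (divr_ge0 T0 (ltW d0)); set N := Num.bound _ => hN.
(* [N] applications settle the traces up to time [T]; one more carries them into the strip. *)
exists N.+1 => -[//|k] kN phi psi w v pp p Pp pT /=.
apply: opQ_ext => // t /andP[t0 tp]; apply: key => //.
  by rewrite t0 (le_trans tp).
move: hN; rewrite ltr_pdivrMr// => hN.
rewrite (le_lt_trans tp)// (le_lt_trans pT)// (lt_le_trans hN)//.
by rewrite ler_wpM2r ?ler_nat// ltW.
Qed.

Lemma iter_opQ_fix phi psi u k : (forall x, 0 <= x <= 1 -> phi x = psi x) ->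
  (forall p, Pi p -> u p = opQ m a b h psi u p) ->
  forall p, Pi p -> iter k (opQ m a b h phi) u p = u p.
Proof.
move=> pp uQ; elim: k => // k IH p Pp /=; rewrite [RHS]uQ//.
apply: opQ_ext => // t /andP[t0 _]; apply: u_in_ext => // q Pq _; exact: IH.
Qed.

Lemma Qpow_fix_zero phi u : Ch_Pi m h u -> (forall x, 0 <= x <= 1 -> u (x, 0) = phi x) ->
  (forall p, Pi p -> u p = opQ m a b h phi u p) ->
  forall T k, 0 < T -> (forall w, Ch_Pi m h w -> forall x : R, 0 <= x <= 1 ->
      iter k (opQ m a b h (fun y => w (y, 0))) w (x, T) = 0) ->
  forall x, 0 <= x <= 1 -> u (x, T) = 0.
Proof.
move=> Cu u0 uQ T k T0 hT x x01.
rewrite -(hT u Cu x x01); apply/esym.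
by apply: (iter_opQ_fix _ u0 uQ); split => //; exact: ltW.
Qed.

Hypothesis h_zero : forall t : R, 0 <= t -> h (t, 0) = 0.

Lemma vanish_forward phi u T : 0 <= T ->
  (forall p, Pi p -> u p = opQ m a b h phi u p) ->
  (forall x, 0 <= x <= 1 -> u (x, T) = 0) ->
  forall x t, 0 <= x <= 1 -> T <= t -> u (x, t) = 0.
Proof.
move=> T0 uQ uT x1 t1 x1in Tt1.
pose g := inflow phi u.
have uE p j : Pi p -> u p 0 j = expR (L j p) * g j (Th j p).
  by move=> Pp; rewrite {1}uQ// opQE.
have step0 j s : Th j (i j, T) <= s <= T -> g j s = 0.
  move=> /Th_onto[x x01 <-].
  have := uE (x, T) j (conj x01 T0); rewrite uT// mxE => /esym/eqP.
  by rewrite mulf_eq0 gt_eqF ?expR_gt0//= => /eqP.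
have t10 : 0 <= t1 by exact: le_trans Tt1.
have [d d0 hd] := delay t10.
(* For [s] beyond [T], the trace at time [s] only involves labels between [Th l (i l, T)] and
   [s - d], to which the induction hypothesis applies. *)
have step k j s : Th j (i j, T) <= s -> s <= t1 -> s < T + k%:R * d -> g j s = 0.
  elim: k j s => [|k IH] j s s1 st sk.
    by apply: step0; rewrite s1/=; move: sk; rewrite mul0r addr0 => /ltW.
  have [sT|/ltW Ts] := leP s T; first by apply: step0; rewrite s1.
  have s0 : 0 <= s by exact: le_trans Ts.
  rewrite /g /inflow s0.
  suff -> : u_in m u s = 0 by rewrite h_zero// mxE.
  apply/rowP => l; rewrite !mxE uE; last exact: Pi_in.
  rewrite IH ?mulr0//.
  - exact: Th_mono.
  - by rewrite (le_trans (Th_le _ _ (in01 l))).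
  - rewrite (le_lt_trans (hd l s _)) ?s0//.
    by rewrite ltrBlDr -addrA -[X in _ + (_ + X)]mul1r -mulrDl natr1.
have P1 : Pi (x1, t1) by split.
apply/rowP => j; rewrite mxE uE//.
have := archi_boundP (divr_ge0 t10 (ltW d0)); set N := Num.bound _.
rewrite ltr_pdivrMr// => hN.
rewrite (step N.+1) ?mulr0//.
- by rewrite (le_trans _ (Th_in_le _ _ x1in))// Th_mono.
- exact: Th_le.
- rewrite (le_lt_trans (Th_le _ _ x1in))// (lt_le_trans hN)//.
  by rewrite ler_wpDl// ler_wpM2r ?ler_nat// ltW.
Qed.

Lemma trace_Ch w : Ch_Pi m h w -> Ch m h (fun x => w (x, 0)).
Proof.
move=> [/subspace_continuousP cw cp]; split; last exact: cp.
apply/subspace_continuousP => x /=; rewrite in_itv/= => x01 P hP.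
have P0 : Pi (x, (0 : R)) by split => /=.
have := cw _ P0 _ hP; rewrite /= /within/= => H.
have cs : {for x, continuous (fun x : R => (x, (0 : R)))}.
  by apply: (@continuous_pair _ _ _ id (cst (0 : R))); [exact: cvg_id|exact: cvg_cst].
have := near_comp cs H; apply: filterS => s hs.
by rewrite /= in_itv/= => s01; apply: hs; split => /=.
Qed.

Lemma FTS_continuous_Qpow :
  (forall phi, Ch m h phi -> exists u, continuous_solution m a b h phi u) ->
  FTS_continuous m a b h <-> Qpow_vanishes m a b h.
Proof.
move=> ex; split.
- move=> [T [T0 hT]].
  have T1 : 0 <= T + 1 by rewrite addr_ge0// ltW.
  have [k0 hk] := iter_opQ_agree T1.
  (* Stabilization is only known for times strictly greater than [T], hence [T + 1]. *)
  exists (T + 1), k0; split; first by rewrite addr_gt0.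
  move=> w Cw x x01; have Cphi := trace_Ch Cw.
  have [u us] := ex _ Cphi; have [[Cu u0] uQ] := us.
  have P1 : Pi (x, T + 1) by split.
  rewrite (hk k0 (leqnn _) _ _ w u (fun _ _ => erefl))//.
  rewrite (iter_opQ_fix _ (fun _ _ => erefl) uQ)//.
  by apply: hT us _ _ x01 _ => //; rewrite ltrDl.
- move=> [T [k [T0 hT]]]; exists T; split => // phi u Cphi [[Cu u0] uQ] x t x01 Tt.
  apply: (vanish_forward (ltW T0) uQ) (x01) (ltW Tt).
  exact: (Qpow_fix_zero Cu u0 uQ T0 hT).
Qed.

(** At each point the iterates starting from 0 are eventually constant by [iter_opQ_agree], and
    their final value is a fixed point. No continuity of [phi] is involved. *)
Lemma fix_exists phi : exists u, forall p, Pi p -> u p = opQ m a b h phi u p.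
Proof.
pose K T := xget 0%N [set k0 | forall k, (k0 <= k)%N ->
  forall phi psi w v, (forall x, 0 <= x <= 1 -> phi x = psi x) ->
  forall p, Pi p -> p.2 <= T ->
  iter k (opQ m a b h phi) w p = iter k (opQ m a b h psi) v p].
have KP T : 0 <= T -> [set k0 | forall k, (k0 <= k)%N ->
  forall phi psi w v, (forall x, 0 <= x <= 1 -> phi x = psi x) ->
  forall p, Pi p -> p.2 <= T ->
  iter k (opQ m a b h phi) w p = iter k (opQ m a b h psi) v p] (K T).
  move=> /iter_opQ_agree[k0 hk0]; rewrite /K.
  by apply: (@xgetPex _ 0%N); exists k0.
pose q k := iter k (opQ m a b h phi) (fun=> 0).
pose u p := q (K p.2) p.
have const T k p : 0 <= T -> Pi p -> p.2 <= T -> (K T <= k)%N -> q k p = q (K T) p.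
  move=> T0 Pp pT /subnKC <-; rewrite /q iterD; apply/esym.
  exact: (KP T T0 (K T) (leqnn _)).
exists u => p Pp.
have p0 : 0 <= p.2 by case: Pp.
rewrite /u -(const p.2 (K p.2).+1)//=.
apply: opQ_ext => // t /andP[t0 tp]; apply: u_in_ext => // p' Pp' p't.
have p'0 : 0 <= p'.2 by case: Pp'.
rewrite -(const p.2 (maxn (K p.2) (K p'.2)) p')// ?leq_maxl ?(le_trans p't)//.
by rewrite -(const p'.2 (maxn (K p.2) (K p'.2)) p')// leq_maxr.
Qed.

(** At time 0 a point other than [o j] has a negative label and is its own foot. At the corner [o j]
    the label is 0 and the value comes from [h]; compatibility identifies it with the initial
    value. *)
Lemma fix_init phi u : trace_out m phi = h (0, trace_in m phi) ->
  (forall p, Pi p -> u p = opQ m a b h phi u p) ->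
  forall x, 0 <= x <= 1 -> u (x, 0) = phi x.
Proof.
move=> cp uQ.
have main x j : 0 <= x <= 1 -> x != o j -> u (x, 0) 0 j = phi x 0 j.
  move=> x01 xo; have P0 : Pi (x, (0 : R)) by split => /=.
  rewrite uQ// opQE// /inflow.
  have lt : Th j (x, 0) < 0.
    rewrite lt_neqAle Th_le// andbT; apply/eqP => e; move/eqP: xo; apply.
    by apply: (@Th_inj j _ _ 0); rewrite e (tr_out (tr j)).
  by rewrite leNgt lt/= (footP x01 erefl) mulrC divfK// gt_eqF// expR_gt0.
have inE : u_in m u 0 = trace_in m phi.
  apply/rowP => j; rewrite !mxE main//; first exact: in01.
  by have := sides j; rewrite /o /i => -[] [-> ->]; rewrite ?oner_eq0// eq_sym oner_eq0.
move=> x x01; apply/rowP => j; have [->|] := eqVneq x (o j); last exact: main.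
have P0 : Pi (o j, (0 : R)) by split => //=; exact: out01.
rewrite uQ// opQE// (tr_out (tr j)) (tr_Lout (tr j)) expR0 mul1r /inflow lexx inE -cp.
by rewrite mxE.
Qed.

Lemma in_row u phi t : 0 <= t -> (forall p, Pi p -> u p = opQ m a b h phi u p) ->
  u_in m u t = \row_j (expR (L j (i j, t)) * inflow phi u j (Th j (i j, t))).
Proof.
by move=> t0 uQ; apply/rowP => j; rewrite !mxE uQ ?opQE//; exact: Pi_in.
Qed.

(** * Continuity of the solution for data in C_h *)

Section Continuity.
Hypothesis h_cont : {within dom_h (n := n), continuous h}.
Variables (phi : R -> 'rV[R]_n) (u : R * R -> 'rV[R]_n).
Hypothesis phi_Ch : Ch m h phi.
Hypothesis uQ : forall p, Pi p -> u p = opQ m a b h phi u p.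

(** The labels of the characteristics that meet Pi. *)
Let D j : set R := [set s | Th j (i j, 0) <= s].
Let g := inflow phi u.

Lemma foot_cont j : {within `[Th j (i j, 0), 0], continuous (foot j)}.
Proof.
have [cTh _ _ _] := tr_cont (tr j).
have c0 : {within `[0 : R, 1], continuous (fun y : R => Th j (y, 0))}.
  apply: continuous_subspaceT => y.
  apply: (@continuous_comp _ _ _ (fun y => (y, (0 : R))) (Th j)); last exact: cTh.
  by apply: (@continuous_pair _ _ _ id (cst (0 : R))); [exact: cvg_id|exact: cvg_cst].
have fK : {in `[0 : R, 1], cancel (fun y : R => Th j (y, 0)) (foot j)}.
  by move=> y; rewrite in_itv/= => y01; exact: footP.
have := tr_out (tr j) 0; have := sides j; rewrite /o.
case=> -[oE iE]; rewrite oE iE => T0; rewrite -[X in `[_, X]]T0.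
  exact: (segment_can_ge_continuous ler01 c0 fK).
exact: (segment_can_le_continuous ler01 c0 fK).
Qed.

Lemma axis_cont j : {within `[Th j (i j, 0), 0],
  continuous (fun s => phi (foot j s) 0 j / expR (L j (foot j s, 0)))}.
Proof.
have [_ cL _ _] := tr_cont (tr j).
have [/subspace_continuousP cphi _] := phi_Ch.
have /subspace_continuousP cf := @foot_cont j.
apply/subspace_continuousP => s sI.
have foot01 s' : `[Th j (i j, 0), 0]%classic s' -> 0 <= foot j s' <= 1.
  by rewrite /= in_itv/= => /foot_spec[].
apply: cvgM.
  apply: (rv_cvg_coord (g := fun s => phi (foot j s))).
  apply: (@cvg_within_comp _ _ _ [set` `[0 : R, 1]] (foot j) phi) (cf _ sI) _ _.
    rewrite near_withinE; apply: nearW => s' /foot01 h01.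
    by rewrite /= in_itv.
  by apply: cphi; rewrite /= in_itv/= foot01.
apply: cvgV; first by rewrite gt_eqF// expR_gt0.
apply: (cvg_comp (foot j) (fun y => expR (L j (y, 0))) (cf _ sI)).
apply: (@continuous_comp _ _ _ (fun y => L j (y, 0)) (@expR R)); last exact: continuous_expR.
apply: (@continuous_comp _ _ _ (fun y => (y, (0 : R))) (L j)); last exact: cL.
by apply: (@continuous_pair _ _ _ id (cst (0 : R))); [exact: cvg_id|exact: cvg_cst].
Qed.

(** Induction by steps of length [d]: at a nonnegative label the inflow is [h] of a trace built from
    labels smaller by at least [d]; at a negative label it is read off the initial data. *)
Lemma inflow_cont T j s : 0 <= T -> Th j (i j, 0) <= s -> s <= T ->
  inflow phi u j s' @[s' --> within (D j) (nbhs s)] --> inflow phi u j s.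
Proof.
move=> T0; have [d d0 hd] := delay T0.
pose axis j s := phi (foot j s) 0 j / expR (L j (foot j s, 0)).
have axis_in j' s' : Th j' (i j', 0) <= s' -> s' <= 0 ->
    axis j' r @[r --> within `[Th j' (i j', 0), 0] (nbhs s')] --> axis j' s'.
  move=> h1 h2; have /subspace_continuousP := @axis_cont j'.
  by apply; rewrite /= in_itv/= h1.
have main k j' s' : Th j' (i j', 0) <= s' -> s' <= T -> s' < k%:R * d ->
    inflow phi u j' r @[r --> within (D j') (nbhs s')] --> inflow phi u j' s'.
  elim: k j' s' => [|k IH] j' s' h1 h2 h3.
    rewrite mul0r in h3.
    have -> : inflow phi u j' s' = axis j' s' by rewrite /inflow leNgt h3.
    have near0 : \forall r \near s', r <= 0.
      by apply: (@cvgr_le _ _ _ _ id s' cvg_id).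
    have E : \forall r \near within (D j') (nbhs s'), axis j' r = inflow phi u j' r.
      rewrite near_withinE; have : \forall r \near s', r < 0.
        by apply: (@cvgr_lt _ _ _ _ id s' cvg_id).
      by apply: filterS => r r0 _; rewrite /inflow leNgt r0.
    apply: cvg_trans (near_eq_cvg E) _.
    apply: (@cvg_within_comp _ _ _ `[Th j' (i j', 0), 0] id (axis j') _ s').
    - by apply: cvg_within.
    - rewrite near_withinE; apply: filterS near0 => r r0 Dr.
      by rewrite /= in_itv/= r0 andbT.
    - by apply: axis_in => //; exact: ltW.
  have [|s'0] := ltP s' 0.
    move=> s'0; apply: IH => //; rewrite (lt_le_trans s'0)//.
    by apply: mulr_ge0 => //; exact: ltW.
  pose H r := h (r, u_in m u r) 0 j'.
  have cin : u_in m u r @[r --> within [set r | 0 <= r] (nbhs s')] --> u_in m u s'.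
    apply: rv_cvg => l; rewrite (in_row s'0 uQ) mxE.
    have E : \forall r \near within [set r | 0 <= r] (nbhs s'),
        expR (L l (i l, r)) * inflow phi u l (Th l (i l, r)) = u_in m u r 0 l.
      by rewrite near_withinE; apply: nearW => r /= r0; rewrite (in_row r0 uQ) mxE.
    apply: cvg_trans (near_eq_cvg E) _.
    have [cTh cL _ _] := tr_cont (tr l).
    have cpair : continuous (fun r : R => (i l, r)).
      by move=> r; apply: (@continuous_pair _ _ _ (cst (i l)) id); [exact: cvg_cst|exact: cvg_id].
    apply: cvgM.
      apply: cvg_within_filter.
      apply: (@continuous_comp _ _ _ (fun r => L l (i l, r)) (@expR R)); last exact: continuous_expR.
      exact: (@continuous_comp _ _ _ (fun r => (i l, r)) (L l) _ (cpair _) (cL _)).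
    apply: (@cvg_within_comp _ _ _ (D l) (fun r => Th l (i l, r)) (inflow phi u l) _ (Th l (i l, s'))).
    - apply: cvg_within_filter.
      exact: (@continuous_comp _ _ _ (fun r => (i l, r)) (Th l) _ (cpair _) (cTh _)).
    - by rewrite near_withinE; apply: nearW => r /= r0; exact: Th_mono.
    - apply: IH; first exact: Th_mono.
        by rewrite (le_trans (Th_le _ _ (in01 l))).
      rewrite (le_lt_trans (hd l s' _)) ?s'0//.
      by rewrite ltrBlDr -[X in _ + X]mul1r -mulrDl natr1.
  have cH : H r @[r --> within [set r | 0 <= r] (nbhs s')] --> H s'.
    apply: (rv_cvg_coord (g := fun r => h (r, u_in m u r))).
    apply: (@cvg_within_comp _ _ _ (dom_h (n := n)) (fun r => (r, u_in m u r)) h _ (s', u_in m u s')).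
    - have cid : r @[r --> within [set r : R | 0 <= r] (nbhs s')] --> s'.
        by apply: cvg_within_filter; exact: cvg_id.
      exact: cvg_pair cid cin.
    - by rewrite near_withinE; apply: nearW.
    - by move/subspace_continuousP: h_cont; apply.
  have -> : inflow phi u j' s' = H s' by rewrite /inflow s'0.
  apply/cvgrPdist_le => e e0.
  have n1 : \forall r \near s', 0 <= r -> `|H s' - H r| <= e.
    by move/cvgrPdist_le/(_ _ e0): cH; rewrite near_withinE.
  rewrite near_withinE.
  (* Only the label 0 is at stake here: the limit from the axis equals the boundary value by
     compatibility. *)
  have n2 : \forall r \near s', r < 0 -> D j' r -> `|H s' - axis j' r| <= e.
    move: s'0; rewrite le_eqVlt => /predU1P[s'0|s'0]; last first.
      have : \forall r \near s', 0 < r by apply: (@cvgr_gt _ _ _ _ id s' cvg_id).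
      by apply: filterS => r r0 r0'; move: (lt_trans r0 r0'); rewrite ltxx.
    have -> : H s' = axis j' s'.
      have cp := phi_Ch.2; have u0 := fix_init cp uQ.
      rewrite /axis -s'0 (@footP j' (o j')) ?out01 ?(tr_out (tr j'))//.
      rewrite (tr_Lout (tr j')) expR0 divr1 /H.
      have -> : u_in m u 0 = trace_in m phi.
        by apply/rowP => l; rewrite !mxE u0//; exact: in01.
      by rewrite -cp mxE.
    have := axis_in j' s' h1; rewrite -s'0 lexx => /(_ isT)/cvgrPdist_le/(_ _ e0).
    rewrite near_withinE; apply: filterS => r hr r0 Dr; apply: hr.
    by rewrite /= in_itv/= Dr ltW.
  apply: filterS (filterI n1 n2) => r [hr1 hr2] Dr.
  by rewrite /inflow; case: (leP 0 r) => r0; [exact: hr1|exact: hr2].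
move=> h1 h2.
have := archi_boundP (divr_ge0 T0 (ltW d0)); set N := Num.bound _.
rewrite ltr_pdivrMr// => hN.
by apply: (main N) => //; exact: le_lt_trans hN.
Qed.

Lemma fix_Ch_Pi : Ch_Pi m h u.
Proof.
have cp := phi_Ch.2; have u0 := fix_init cp uQ.
split; last first.
  have -> : u_out m u 0 = trace_out m phi.
    by apply/rowP => j; rewrite !mxE u0//; exact: out01.
  rewrite cp; congr (h (_, _)); apply/esym.
  by apply/rowP => j; rewrite !mxE u0//; exact: in01.
apply/subspace_continuousP => p Pp.
rewrite -[from_subspace Pi u]/u; apply: rv_cvg => j; rewrite [u p]uQ// opQE//.
have E : \forall q \near within Pi (nbhs p),
    expR (L j q) * inflow phi u j (Th j q) = u q 0 j.
  by rewrite near_withinE; apply: nearW => q Pq; rewrite uQ// opQE.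
apply: cvg_trans (near_eq_cvg E) _.
have [cTh cL _ _] := tr_cont (tr j).
have [p01 p0] := Pp.
have ThD q : Pi q -> Th j (i j, 0) <= Th j q.
  case: q => x t [x01 t0].
  by rewrite (le_trans _ (Th_in_le _ _ x01))// Th_mono.
apply: cvgM.
  apply: cvg_within_filter.
  by apply: (@continuous_comp _ _ _ (L j) (@expR R)); [exact: cL|exact: continuous_expR].
apply: (@cvg_within_comp _ _ _ (D j) (Th j) (inflow phi u j) _ (Th j p)).
- by apply: cvg_within_filter; exact: cTh.
- by rewrite near_withinE; apply: nearW.
- by apply: (inflow_cont p0); [exact: ThD|case: p {Pp E ThD} p01 p0 => x t x01 _; exact: Th_le].
Qed.

End Continuity.

(** * C^1 solutions *)

Section C1Solution.
Hypothesis h_C1 : forall j, C1_on (W := R^o) (dom_h (n := n)) (fun z : R * 'rV[R]_n => h z 0 j).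

Lemma h_within_cont : {within dom_h (n := n), continuous h}.
Proof.
apply/subspace_continuousP => p Pp; rewrite -[from_subspace _ h]/h.
apply: rv_cvg => j; have [dh [hd _]] := h_C1 j.
have [lK dK] := hd p (conj Pp id).
pose C := `|dh p (1, 0)| + \sum_l `|dh p (0, delta_mx 0 l)| + 1.
have C0 : 0 < C by rewrite ltr_pwDr// addr_ge0// sumr_ge0.
have Kle (t : R) (x : 'rV[R]_n) : `|dh p (t, x)| <= (C - 1) * `|(t, x)|.
  rewrite (linear_row _ _ lK) (le_trans (ler_normD _ _))// /C addrK mulrDl lerD//.
    by rewrite normrM mulrC ler_wpM2l// prod_normE/= le_max lexx.
  rewrite (le_trans (ler_norm_sum _ _ _))// mulr_suml ler_sum// => l _.
  rewrite normrM mulrC ler_wpM2l// (le_trans (rv_coord_le _ _))//.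
  by rewrite prod_normE/= le_max lexx orbT.
apply/cvgrPdist_le => e e0.
have h1 : \forall q \near within (dom_h (n := n)) (nbhs p), `|p - q| <= e / C.
  have : \forall q \near nbhs p, `|p - q| <= e / C.
    by apply: cvgr_dist_le; [exact: cvg_id|exact: divr_gt0].
  exact: cvg_within.
apply: filterS (filterI h1 (dK _ ltr01)) => q [hq]; rewrite mul1r => hK.
rewrite distrC -[X in `|X|](subrK (dh p (q - p))).
rewrite distrC in hq; move: hq; rewrite ler_pdivlMr// mulrC => /(le_trans _); apply.
rewrite (le_trans (ler_normD _ _))//.
have -> : C * `|q - p| = `|q - p| + (C - 1) * `|q - p| by ring.
by rewrite lerD//; exact: Kle.
Qed.

Variables (psi : R -> 'rV[R]_n) (dpsi : 'I_n -> R -> R) (gam : R).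
Hypothesis psi_deriv : forall j (x : R), is_derive x 1 (fun y => psi y 0 j) (dpsi j x).
Hypothesis dpsi_cont : forall j, continuous (dpsi j).
Hypothesis gam01 : 0 < gam < 2^-1.
Hypothesis psi0 : forall x, x <= gam \/ 1 - gam <= x -> psi x = 0.

Lemma test_Ch : Ch m h psi.
Proof.
have [g0 g1] := andP gam01.
have ends x : x = 0 \/ x = 1 -> psi x = 0.
  by case=> ->; apply: psi0; [left; exact: ltW|right; lra].
split; last first.
  have -> : trace_out m psi = 0.
    apply/rowP => j; rewrite !mxE ends ?mxE//.
    by have := sides j; rewrite /o => -[] [-> _]; [left|right].
  have -> : trace_in m psi = 0.
    apply/rowP => j; rewrite !mxE ends ?mxE//.
    by have := sides j; rewrite /i => -[] [_ ->]; [right|left].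
  by rewrite h_zero.
apply: continuous_subspaceT => x; apply: rv_cvg => j.
exact: is_derive_continuous (psi_deriv j x).
Qed.

Lemma test_C1h : C1h m h psi.
Proof.
split; first exact: test_Ch.
exists (fun x (v : R^o) => (v : R) *: \row_j dpsi j x); split.
- move=> x [x01 _]; split; first by move=> k v w; rewrite scalerDl scalerA.
  move=> e e0; apply: cvg_within.
  have : \forall y \near x, forall j, `|psi y 0 j - psi x 0 j - dpsi j x * (y - x)| <= e * `|y - x|.
    apply: (@filter_forall R 'I_n (fun j y => `|psi y 0 j - psi x 0 j - dpsi j x * (y - x)| <= e * `|y - x|) (nbhs (x : R))).
    by move=> j; have /is_derive_epsP := psi_deriv j x; exact.
  apply: filterS => y hy; apply: rv_norm_le; first by rewrite mulr_ge0// ltW.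
  by move=> j; rewrite !mxE [X in _ - X]mulrC; exact: hy.
- move=> v; apply: continuous_subspaceT => x; apply: rv_cvg => j.
  rewrite !mxE; under eq_fun do rewrite !mxE.
  by apply: cvgM; [exact: cvg_cst|exact: dpsi_cont].
Qed.

Variable u : R * R -> 'rV[R]_n.
Hypothesis uQ : forall p, Pi p -> u p = opQ m a b h psi u p.

(** The points at distance [gam] from the exit side and from the inflow side. The labels of the
    points where [psi] is nonzero lie between those of [y1 j] and [y2 j]. *)
Let y1 j := i j + (o j - i j) * gam.
Let y2 j := o j + (i j - o j) * gam.

Lemma Th_y1 j : Th j (i j, 0) < Th j (y1 j, 0) < 0.
Proof.
have [g0 g1] := andP gam01.
apply/andP; split.
  apply: (tr_side (tr j)); rewrite -/(i j) -/(o j) /y1.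
  by case: (sides j) => -[-> ->]; lra.
rewrite -[ltRHS](tr_out (tr j)); apply: (tr_side (tr j)).
rewrite -/(i j) -/(o j) /y1.
by case: (sides j) => -[-> ->]; lra.
Qed.

Lemma Th_y2 j : Th j (y2 j, 0) < 0.
Proof.
have [g0 g1] := andP gam01.
rewrite -[ltRHS](tr_out (tr j)); apply: (tr_side (tr j)).
rewrite -/(i j) -/(o j) /y2.
by case: (sides j) => -[-> ->]; lra.
Qed.

Lemma test_zero j x : 0 <= x <= 1 ->
  Th j (x, 0) < Th j (y1 j, 0) \/ Th j (y2 j, 0) < Th j (x, 0) -> psi x = 0.
Proof.
move=> /andP[x0 x1] H; apply: psi0.
have anti y z : (i j - o j) * (z - y) < 0 \/ Th j (z, 0) <= Th j (y, 0).
  have [?|h0] := ltP ((i j - o j) * (z - y)) 0; first by left.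
  by right; exact: Th_anti.
case: H => lt.
  case: (anti (x) (y1 j)) => [|le]; last by move: (lt_le_trans lt le); rewrite ltxx.
  by rewrite /y1; case: (sides j) => -[-> ->] h0; [right|left]; lra.
case: (anti (y2 j) x) => [|le]; last by move: (lt_le_trans lt le); rewrite ltxx.
by rewrite /y2; case: (sides j) => -[-> ->] h0; [left|right]; lra.
Qed.

Lemma inflow_zero w j s : s < 0 ->
  s < Th j (y1 j, 0) \/ Th j (y2 j, 0) < s -> inflow psi w j s = 0.
Proof.
move=> s0 H; rewrite /inflow leNgt s0 /=.
suff -> : psi (foot j s) = 0 by rewrite mxE mul0r.
have [[y [y01 yE]]|no] := pselect (exists y, 0 <= y <= 1 /\ Th j (y, 0) = s).
  by rewrite (footP y01 yE); apply: (@test_zero j) => //; rewrite yE.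
(* When there is no foot, the default value 0 of [foot] is harmless because [psi] vanishes there. *)
have -> : foot j s = 0 by apply: xgetPN => y hy; apply: no; exists y.
by apply: psi0; left; case/andP: gam01 => /ltW.
Qed.

(** Up to time [d] the traces are fed from the zone near the exit side where [psi] vanishes, and
    labels in ]-d, 0[ start in the zone near the inflow side. The inflow is therefore zero on ]-d,
    d[. *)
Lemma small_time : exists2 d, 0 < d & forall l,
  (forall r, r < d -> Th l (i l, r) < Th l (y1 l, 0)) /\ Th l (y2 l, 0) < - d.
Proof.
suff : \forall d \near (0 : R)^'+, 0 < d /\ forall l,
    Th l (i l, d) < Th l (y1 l, 0) /\ Th l (y2 l, 0) < - d.
  move=> /filter_ex[d [d0 hd]]; exists d => // l; have [h1 h2] := hd l.
  by split => // r rd; rewrite (le_lt_trans _ h1)// Th_mono// ltW.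
apply: filterI; first exact: nbhs_right_gt.
apply: (@filter_forall R 'I_n (fun l d => Th l (i l, d) < Th l (y1 l, 0) /\ Th l (y2 l, 0) < - d) (0^'+)).
move=> l; apply: filterI; last first.
  have y20 : 0 < - Th l (y2 l, 0) by rewrite oppr_gt0 Th_y2.
  by apply: filterS (nbhs_right_lt y20) => d; rewrite ltrNr.
have [cTh _ _ _] := tr_cont (tr l).
have cT : {for 0, continuous (fun r : R => Th l (i l, r))}.
  apply: (@continuous_comp _ _ _ (fun r => (i l, r)) (Th l)); last exact: cTh.
  by apply: (@continuous_pair _ _ _ (cst (i l)) id); [exact: cvg_cst|exact: cvg_id].
have [h1 _] := andP (Th_y1 l).
apply: cvg_within.
exact: (cvgr_lt _ cT _ h1).
Qed.

Lemma in_zero t d : (forall l r, r < d -> Th l (i l, r) < Th l (y1 l, 0)) ->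
  0 <= t -> t < d -> u_in m u t = 0.
Proof.
move=> hd t0 td; rewrite (in_row t0 uQ); apply/rowP => l; rewrite !mxE.
have lt := hd l t td; have [_ y10] := andP (Th_y1 l).
by rewrite inflow_zero ?mulr0//; [exact: lt_trans y10|left].
Qed.

Lemma L_axis_deriv j (y : R) :
  is_derive y 1 (fun y => expR (- L j (y, 0)))
    (expR (- L j (y, 0)) * - (- bb j (y, 0) - f j (y, 0) * Lt j (y, 0))).
Proof.
apply: (@is_derive1_comp _ (@expR R) (fun y => - L j (y, 0))).
exact: is_deriveN (plane_diff_x (tr_Ldiff (tr j) (y, 0))).
Qed.

Lemma foot_deriv j (s : R) : Th j (i j, 0) < s < 0 ->
  is_derive s 1 (foot j) (- f j (foot j s, 0) * Tht j (foot j s, 0))^-1.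
Proof.
move=> /andP[s1 s2]; have sI : Th j (i j, 0) <= s <= 0 by rewrite !ltW.
have [y01 yE] := foot_spec sI; set y := foot j s in y01 yE *.
have yoo : 0 < y < 1.
  have yi : y != i j by apply/eqP => e; rewrite e in yE; rewrite yE ltxx in s1.
  have yo : y != o j by apply/eqP => e; rewrite e (tr_out (tr j)) in yE; rewrite yE ltxx in s2.
  case/andP: y01 => y0 y1'; rewrite !lt_neqAle y0 y1'/= !andbT.
  by move: yi yo; case: (sides j) => -[-> ->] yi yo; rewrite ?yi ?yo ?andbT// eq_sym ?yi ?yo.
rewrite -[X in is_derive X]yE.
apply: (@is_derive_inverse _ (fun x : R => Th j (x, 0)) (foot j)).
- have := near_in_itvoo (a := 0) (b := 1) (x := y); rewrite in_itv/= => /(_ yoo).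
  apply: filterS => x; rewrite in_itv/= => /andP[x0 x1].
  by apply: footP => //; rewrite !ltW.
- near=> x; exact: is_derive_continuous (plane_diff_x (tr_diff (tr j) (x, 0))).
- exact: (plane_diff_x (tr_diff (tr j) (y, 0))).
- by rewrite mulf_neq0// ?oppr_eq0 ?(tr_f (tr j))// gt_eqF// (tr_Tht (tr j)).
Unshelve. all: by end_near. Qed.

Lemma inflow_C1_left j s : s < 0 -> C1at (inflow psi u j) s.
Proof.
move=> s0.
have nears0 : \forall r \near s, r < 0 by apply: (@cvgr_lt _ _ _ _ id s cvg_id).
have [h1 h2] := andP (Th_y1 j).
have [le|gt] := leP s (Th j (i j, 0)).
  (* At the label of the exit corner [foot] stops being a smooth inverse, but the inflow is zero at
     all labels below that of [y1 j]. *)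
  apply: C1at_near (C1at_cst 0 s).
  have : \forall r \near s, r < Th j (y1 j, 0).
    by apply: (@cvgr_lt _ _ _ _ id s cvg_id); exact: le_lt_trans h1.
  by apply: filterS2 nears0 => r r0 r1; rewrite inflow_zero//; left.
have nears1 : \forall r \near s, Th j (i j, 0) < r.
  by apply: (@cvgr_gt _ _ _ _ id s cvg_id).
have nearsI : \forall r \near s, Th j (i j, 0) < r /\ r < 0 by exact: filterI.
pose Ex y := expR (- L j (y, 0)).
pose dE y := expR (- L j (y, 0)) * - (- bb j (y, 0) - f j (y, 0) * Lt j (y, 0)).
pose G y := psi y 0 j * Ex y.
pose dG y := dpsi j y * Ex y + psi y 0 j * dE y.
have dGP (y : R) : is_derive y 1 G (dG y).
  have := is_deriveM (psi_deriv j y) (L_axis_deriv j y).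
  by move=> H; apply: is_derive_eq H _; rewrite /GRing.scale/= /dG addrC mulrC [X in X + _]mulrC [in RHS]addrC; ring.
pose th y := - f j (y, 0) * Tht j (y, 0).
apply: (@C1at_near _ (fun r => G (foot j r))).
  apply: filterS nears0 => r r0.
  by rewrite /inflow leNgt r0 /= /G /Ex expRN.
exists (fun r => dG (foot j r) * (th (foot j r))^-1); split.
  apply: filterS nearsI => r [r1 r0].
  by apply: (@is_derive1_comp _ G (foot j)) (dGP _) _; apply: foot_deriv; rewrite r1 r0.
have cf : {for s, continuous (foot j)}.
  by apply: (@is_derive_continuous _ _ s); apply: foot_deriv; rewrite gt s0.
have cax (k : R * R -> R) : continuous k -> continuous (fun y => k (y, 0)).
  move=> ck y; apply: (@continuous_comp _ _ _ (fun y => (y, (0 : R))) k); last exact: ck.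
  by apply: (@continuous_pair _ _ _ id (cst (0 : R))); [exact: cvg_id|exact: cvg_cst].
have [cTh cL cTht cLt] := tr_cont (tr j); have [cff cbb] := tr_cont_coef (tr j).
have cEx : continuous Ex by move=> y; exact: is_derive_continuous (L_axis_deriv j y).
have cdE : continuous dE.
  move=> y; apply: cvgM; first exact: cEx.
  apply: cvgN; apply: cvgB; first by apply: cvgN; exact: cax.
  by apply: cvgM; exact: cax.
have cpsi : continuous (fun y => psi y 0 j) by move=> y; exact: is_derive_continuous (psi_deriv j y).
have cdG : continuous dG.
  move=> y; apply: cvgD; apply: cvgM; [exact: dpsi_cont|exact: cEx|exact: cpsi|exact: cdE].
have cth : continuous th.
  by move=> y; apply: cvgM; [apply: cvgN; exact: cax|exact: cax].
apply: (@continuous_comp _ _ _ (foot j) (fun y => dG y * (th y)^-1)); first exact: cf.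
apply: cvgM; first exact: cdG.
apply: cvgV; last exact: cth.
by rewrite mulf_neq0// ?oppr_eq0 ?(tr_f (tr j))// gt_eqF// (tr_Tht (tr j)).
Qed.

(** By [in_row] the trace near time [s] is a smooth expression in the inflow near the labels
    [Th l (i l, s)], and the chain rule for [h] carries the regularity over. *)
Lemma inflow_C1_step j s : 0 < s ->
  (forall l, C1at (inflow psi u l) (Th l (i l, s))) -> C1at (inflow psi u j) s.
Proof.
move=> s0 /choice[g' hg'].
pose V r := \row_l (expR (L l (i l, r)) * inflow psi u l (Th l (i l, r))).
pose c l r := expR (L l (i l, r)) * Lt l (i l, r) * inflow psi u l (Th l (i l, r)) +
  expR (L l (i l, r)) * (g' l (Th l (i l, r)) * Tht l (i l, r)).
have cax l (k : R * R -> R) : continuous k -> continuous (fun r => k (i l, r)).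
  move=> ck y; apply: (@continuous_comp _ _ _ (fun y => (i l, y)) k); last exact: ck.
  by apply: (@continuous_pair _ _ _ (cst (i l)) id); [exact: cvg_cst|exact: cvg_id].
have dV : \forall r \near s, forall l, is_derive (r : R) 1 (fun r => V r 0 l) (c l r).
  apply: (@filter_forall R 'I_n (fun l r => is_derive (r : R) 1 (fun r => V r 0 l) (c l r)) (nbhs s)).
  move=> l; have [cTh _ _ _] := tr_cont (tr l).
  apply: filterS (near_comp (cax l _ cTh s) (hg' l).1) => r dg.
  have dT := plane_diff_t (tr_diff (tr l) (i l, r)).
  have dL := plane_diff_t (tr_Ldiff (tr l) (i l, r)).
  have dEL := @is_derive1_comp _ (@expR R) (fun r => L l (i l, r)) r _ _ (is_derive_expR _) dL.
  have dgT := @is_derive1_comp _ (inflow psi u l) (fun r => Th l (i l, r)) r _ _ dg dT.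
  have := is_deriveM dEL dgT.
  have -> : (fun r => V r 0 l) = (@expR R \o (fun r => L l (i l, r))) * (inflow psi u l \o (fun r => Th l (i l, r))).
    by apply/funext => r'; rewrite mxE.
  by move=> H; apply: is_derive_eq H _; rewrite /GRing.scale/= /c addrC; congr (_ + _); ring.
have cc l : {for s, continuous (c l)}.
  have [cTh cL cTht cLt] := tr_cont (tr l).
  have cE : {for s, continuous (fun r => expR (L l (i l, r)))}.
    by apply: (@continuous_comp _ _ _ (fun r => L l (i l, r)) (@expR R)); [exact: cax|exact: continuous_expR].
  apply: cvgD.
    apply: cvgM; first by apply: cvgM; [exact: cE|exact: cax].
    apply: (@continuous_comp _ _ _ (fun r => Th l (i l, r)) (inflow psi u l)); first exact: cax.
    exact: is_derive_continuous (nbhs_singleton (hg' l).1).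
  apply: cvgM; first exact: cE.
  apply: cvgM; last exact: cax.
  by apply: (@continuous_comp _ _ _ (fun r => Th l (i l, r)) (g' l)); [exact: cax|exact: (hg' l).2].
have nears0 : \forall r \near s, 0 < r by apply: (@cvgr_gt _ _ _ _ id s cvg_id).
have [dh [hd hc]] := h_C1 j.
apply: (@C1at_near _ (fun r => h (r, V r) 0 j)).
  apply: filterS nears0 => r r0; rewrite /inflow ltW//.
  by rewrite (in_row (ltW r0) uQ).
exists (fun r => dh (r, V r) (1, 0) + \sum_l c l r * dh (r, V r) (0, delta_mx 0 l)); split.
  apply: filterS2 nears0 dV => r r0 dV.
  have Dr : dom_h (r, V r) by exact: ltW.
  have [lK dK] := hd (r, V r) (conj Dr id).
  exact: (chain_row r0 lK dK dV).
have cp : {for s, continuous (fun r => (r, V r))}.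
  apply: (@continuous_pair _ _ _ id V); first exact: cvg_id.
  by apply: rv_cvg => l; exact: is_derive_continuous (nbhs_singleton dV l).
have cdh (z : R * 'rV[R]_n) : {for s, continuous (fun r => dh (r, V r) z)}.
  have := hc z; rewrite setD0 => /subspace_continuousP cv.
  apply: (@cvg_within_comp _ _ _ (dom_h (n := n)) (fun r => (r, V r)) (fun z' : R * 'rV[R]_n => dh z' z) _ (s, V s)).
  - exact: cp.
  - by apply: filterS nears0 => r /ltW.
  - by apply: cv; exact: ltW.
apply: cvgD; first exact: cdh.
apply: cvg_sumr => l; apply: cvgM; [exact: cc|exact: cdh].
Qed.

Lemma inflow_C1 j s : C1at (inflow psi u j) s.
Proof.
have [d0 d00 hd0] := small_time.
pose T := Num.max s 0; have T0 : 0 <= T by rewrite le_max lexx orbT.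
have [d dpos hd] := delay T0.
have main k l r : r <= T -> r < k%:R * d -> C1at (inflow psi u l) r.
  elim: k l r => [|k IH] l r rT rk.
    by apply: inflow_C1_left; move: rk; rewrite mul0r.
  have [r0|r0] := ltP r 0; first exact: inflow_C1_left.
  have [rd|dr] := ltP r d0.
    apply: C1at_near (C1at_cst 0 r).
    have n1 : \forall x \near r, x < d0 by apply: (@cvgr_lt _ _ _ _ id r cvg_id).
    have n2 : \forall x \near r, - d0 < x.
      by apply: (@cvgr_gt _ _ _ _ id r cvg_id); rewrite (lt_le_trans _ r0)// oppr_lt0.
    apply: filterS2 n1 n2 => x x1 x2; apply/esym.
    have [x0|x0] := ltP x 0.
      by apply: inflow_zero => //; right; exact: lt_trans (hd0 l).2 x2.
    rewrite /inflow x0 (in_zero (fun l => (hd0 l).1) x0 x1) h_zero// mxE//.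
  have rpos : 0 < r by exact: lt_le_trans dr.
  apply: inflow_C1_step => // l'; apply: IH.
    by rewrite (le_trans (Th_le _ _ (in01 l'))).
  rewrite (le_lt_trans (hd l' r _)) ?r0//.
  by rewrite ltrBlDr -[X in _ + X]mul1r -mulrDl natr1.
have := archi_boundP (divr_ge0 T0 (ltW dpos)); set N := Num.bound _.
rewrite ltr_pdivrMr// => hN.
apply: (main N); first by rewrite le_max lexx.
by rewrite (le_lt_trans _ hN)// le_max lexx.
Qed.

Lemma test_solution : piecewise_C1_solution m a b h psi u.
Proof.
have [Cu _] := fix_Ch_Pi h_within_cont test_Ch uQ.
have u0 := fix_init test_Ch.2 uQ.
(* The inflow is C^1 on the whole line of labels, so there is no exceptional characteristic. *)
split => //; exists set0; split; first exact: countable0.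
split; first by move=> k [].
rewrite bigcup_set0 /=; split; last first.
  split; first by move=> x x01 _; exact: u0.
  move=> t t0 _ _; apply/rowP => j; rewrite !mxE.
  have Pp : Pi (out_side R m j, t) by split => //=; exact: out01.
  by rewrite uQ// opQE// (tr_out (tr j)) (tr_Lout (tr j)) expR0 mul1r /inflow t0.
have gC1 j := C1at_all (inflow_C1 j).
pose g j := inflow psi u j; pose g' j := derive1 (g j).
pose U j p := expR (L j p) * g j (Th j p).
pose ux j p := expR (L j p) * (- bb j p - f j p * Lt j p) * g j (Th j p) +
   expR (L j p) * (g' j (Th j p) * (- f j p * Tht j p)).
pose ut j p := expR (L j p) * Lt j p * g j (Th j p) +
   expR (L j p) * (g' j (Th j p) * Tht j p).
have dU j p : plane_diff (U j) p (ux j p) (ut j p).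
  have dE := plane_diff_comp (tr_Ldiff (tr j) p) (is_derive_expR (L j p)).
  have dg := plane_diff_comp (tr_diff (tr j) p) ((gC1 j).1 (Th j p)).
  exact: plane_diffM dE dg.
have cE j : continuous (fun p => expR (L j p)).
  have [_ cL _ _] := tr_cont (tr j).
  by move=> p; apply: (@continuous_comp _ _ _ (L j) (@expR R)); [exact: cL|exact: continuous_expR].
have cgT j : continuous (fun p => g j (Th j p)).
  have [cTh _ _ _] := tr_cont (tr j).
  move=> p; apply: (@continuous_comp _ _ _ (Th j) (g j)); first exact: cTh.
  exact: is_derive_continuous ((gC1 j).1 (Th j p)).
have cg'T j : continuous (fun p => g' j (Th j p)).
  have [cTh _ _ _] := tr_cont (tr j).
  by move=> p; apply: (@continuous_comp _ _ _ (Th j) (g' j)); [exact: cTh|exact: (gC1 j).2].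
have cux j : continuous (ux j).
  have [cTh cL cTht cLt] := tr_cont (tr j); have [cff cbb] := tr_cont_coef (tr j).
  move=> p; apply: cvgD; apply: cvgM.
  - apply: cvgM; first exact: cE.
    apply: cvgB; first by apply: cvgN; exact: cbb.
    by apply: cvgM; [exact: cff|exact: cLt].
  - exact: cgT.
  - exact: cE.
  - apply: cvgM; first exact: cg'T.
    by apply: cvgM; [apply: cvgN; exact: cff|exact: cTht].
have cut j : continuous (ut j).
  have [cTh cL cTht cLt] := tr_cont (tr j).
  move=> p; apply: cvgD; apply: cvgM.
  - by apply: cvgM; [exact: cE|exact: cLt].
  - exact: cgT.
  - exact: cE.
  - by apply: cvgM; [exact: cg'T|exact: cTht].
have uE p j : Pi p -> u p 0 j = U j p by move=> Pp; rewrite uQ// opQE.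
exists (fun p (v : R * R) => \row_j (v.1 * ux j p + v.2 * ut j p)); split.
  split.
    move=> p [Pp _]; split.
      by move=> k v w; apply/rowP => j; rewrite !mxE /= /GRing.scale/=; ring.
    move=> e e0.
    have : \forall q \near p, forall j, `|U j q - U j p - ux j p * (q.1 - p.1) - ut j p * (q.2 - p.2)| <= e * `|q - p|.
      apply: (@filter_forall _ 'I_n (fun j q => `|U j q - U j p - ux j p * (q.1 - p.1) - ut j p * (q.2 - p.2)| <= e * `|q - p|) (nbhs p)).
      by move=> j; exact: dU.
    rewrite near_withinE; apply: filterS => q hq Pq.
    apply: rv_norm_le; first by rewrite mulr_ge0// ltW.
    move=> j; rewrite !mxE !uE//; apply: le_trans (hq j).
    rewrite le_eqVlt; apply/orP; left; apply/eqP; congr (`|_|).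
    by rewrite /=; ring.
  move=> v; apply: continuous_subspaceT => p; apply: rv_cvg => j.
  rewrite mxE; under eq_fun do rewrite mxE.
  apply: cvgD; apply: cvgM; [exact: cvg_cst|exact: cux|exact: cvg_cst|exact: cut].
move=> p [Pp _] j; rewrite !mxE /= uE//.
have [fE bE] := tr_Pi (tr j) Pp.
have f0 := tr_f (tr j) p.
have a0 : a j p != 0 by rewrite -invr_eq0 -fE.
(* With [f = 1 / a] the terms in [Tht] and [Lt] cancel, since labels are constant along
   characteristics; what remains is [- bb * a * U], which the term in [b] compensates. *)
have -> : b j p = bb j p * a j p by rewrite bE divfK.
have -> : bb j p * a j p = bb j p / f j p by rewrite fE invrK.
have -> : a j p = (f j p)^-1 by rewrite fE invrK.
rewrite /ux /ut /U; field.
exact: f0.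
Qed.

End C1Solution.

(** * Characteristics that avoid the corners *)

(* Times [t] at which the tree of characteristics starting from the trace at
   time [t] reaches a corner of Pi. *)
Fixpoint corner_times k : set R :=
  if k is k'.+1
  then [set t | corner_times k' t \/ 0 <= t /\ exists j, corner_times k' (Th j (i j, t))]
  else [set 0].

Let bad : set R := \bigcup_k corner_times k.

Lemma bad_countable : countable bad.
Proof.
apply: bigcup_countable => // k _; elim: k => [|k IH] /=; first exact: countable1.
(* [None] stands for the times already reached at the previous level, [Some j] for one more passage
   along a j-th characteristic, whose label is injective in time. *)
have cF : countable (\bigcup_(z in [set: option 'I_n])
    if z is Some j then (fun t => Th j (i j, t)) @^-1` corner_times k else corner_times k).
  apply: bigcup_countable => // -[j|] _ //; apply: countable_preimage_inj => //.
  move=> s t e; apply/eqP; case: (ltrgtP s t) => // /(tr_lt (tr j) (i j));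
    by rewrite e ltxx.
apply: sub_countable cF; apply: subset_card_le => t [kt|[t0 [j kt]]].
  by exists None.
by exists (Some j).
Qed.

Definition is_fix phi u := forall p, Pi p -> u p = opQ m a b h phi u p.

(** The points lie strictly inside ]0, 1[, so that a test function can take any prescribed values
    there. *)
Definition determines (A : Type) (ys : seq R) (ev : (R * R -> 'rV[R]_n) -> A) :=
  (forall y, y \in ys -> 0 < y < 1) /\
  forall phi psi u v, is_fix phi u -> is_fix psi v ->
    (forall y, y \in ys -> phi y = psi y) -> ev u = ev v.

(** One edge of the backward tree: it ends either on the inflow side, where [H] continues, or at a
    foot. The foot is not the exit corner because [0 < t], nor the inflow corner because the label
    is negative. *)
Lemma node_determined x t j : 0 <= x <= 1 -> 0 < t ->
  (0 <= Th j (x, t) -> exists ys, determines ys (fun u => u_in m u (Th j (x, t)))) ->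
  exists ys, determines ys (fun u => u (x, t) 0 j).
Proof.
move=> x01 t0 H; have Pp : Pi (x, t) by split => //=; exact: ltW.
have [T0|T0] := leP 0 (Th j (x, t)).
  have [ys [ys01 hys]] := H T0; exists ys; split => // phi psi u v fu fv e.
  rewrite [u _]fu// [v _]fv// !opQE//; congr (_ * _).
  by rewrite /inflow T0 (hys _ _ _ _ fu fv e).
have lt : Th j (i j, 0) < Th j (x, t).
  by rewrite (lt_le_trans (tr_lt (tr j) (i j) t0))// Th_in_le.
have sI : Th j (i j, 0) <= Th j (x, t) <= 0 by rewrite !ltW.
have [y01 yE] := foot_spec sI.
exists [:: foot j (Th j (x, t))]; split.
  move=> y; rewrite inE => /eqP ->; set z := foot _ _ in y01 yE *.
  have zi : z != i j by apply/eqP => e; rewrite e in yE; rewrite yE ltxx in lt.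
  have zo : z != o j by apply/eqP => e; rewrite e (tr_out (tr j)) in yE; rewrite -yE ltxx in T0.
  case/andP: y01 => y0 y1; rewrite !lt_neqAle y0 y1/= !andbT.
  by move: zi zo; case: (sides j) => -[-> ->] zi zo; rewrite ?zi ?zo ?andbT// eq_sym ?zi ?zo.
move=> phi psi u v fu fv e.
rewrite [u _]fu// [v _]fv// !opQE//; congr (_ * _).
by rewrite /inflow leNgt T0 /= e// inE.
Qed.

Lemma row_determined (A : 'I_n -> (R * R -> 'rV[R]_n) -> R) :
  (forall j, exists ys, determines ys (A j)) ->
  exists ys, determines ys (fun u => \row_j A j u).
Proof.
move=> /choice[ys hys]; exists (flatten [seq ys j | j <- enum 'I_n]); split.
  by move=> y /flatten_mapP[j _ yj]; exact: (hys j).1.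
move=> phi psi u v fu fv e; apply/rowP => j; rewrite !mxE.
apply: (hys j).2 fu fv _ => y yj; apply: e; apply/flatten_mapP; exists j => //.
by rewrite mem_enum.
Qed.

Lemma trace_determined t : 0 <= t -> ~ bad t ->
  exists ys, determines ys (fun u => u_in m u t).
Proof.
move=> t0 tbad; have [d d0 hd] := delay t0.
have main k s : 0 <= s -> s <= t -> ~ bad s -> s < k%:R * d ->
    exists ys, determines ys (fun u => u_in m u s).
  elim: k s => [|k IH] s s0 st sbad sk.
    by move: sk; rewrite mul0r ltNge s0.
  (* Time 0 on a lateral side would be a corner, which [bad] excludes from level 0 on. *)
  have spos : 0 < s.
    rewrite lt_neqAle s0 andbT; apply/eqP => e; apply: sbad.
    by exists 0%N => //=; rewrite -e.
  apply: (row_determined (A := fun j u => u (i j, s) 0 j)) => j.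
  apply: node_determined (in01 j) spos _ => T0.
  apply: IH => //.
  - by rewrite (le_trans (Th_le _ _ (in01 j))).
  - by move=> [k' _ bk]; apply: sbad; exists k'.+1 => //=; right; split=> //; exists j.
  - rewrite (le_lt_trans (hd j s _)) ?s0//.
    by rewrite ltrBlDr -[X in _ + X]mul1r -mulrDl natr1.
have := archi_boundP (divr_ge0 t0 (ltW d0)); set N := Num.bound _.
by rewrite ltr_pdivrMr// => hN; exact: (main N).
Qed.

Lemma point_determined x t : 0 <= x <= 1 -> 0 < t ->
  (forall j, ~ bad (Th j (x, t))) -> exists ys, determines ys (fun u => u (x, t)).
Proof.
move=> x01 t0 nb.
have [ys [ys01 hys]] : exists ys, determines ys (fun u => \row_j u (x, t) 0 j).
  apply: row_determined => j; apply: node_determined => // T0.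
  exact: trace_determined.
exists ys; split => // phi psi u v fu fv e.
have /rowP E := hys _ _ _ _ fu fv e.
by apply/rowP => j; have := E j; rewrite !mxE.
Qed.

(** For fixed [t] the label is injective in [x], so the excluded abscissas are countable and cannot
    fill an interval of positive length. *)
Lemma generic_dense t (c d : R) : c < d ->
  exists2 x, c <= x <= d & forall j, ~ bad (Th j (x, t)).
Proof.
move=> cd; apply: contrapT => H.
have cU : countable (\bigcup_(j in [set: 'I_n]) (fun x => Th j (x, t)) @^-1` bad).
  apply: bigcup_countable => // j _; apply: countable_preimage_inj.
    by move=> x y; exact: Th_inj.
  exact: bad_countable.
have sub : `[c, d]%classic `<=` \bigcup_(j in [set: 'I_n]) (fun x => Th j (x, t)) @^-1` bad.
  move=> x /=; rewrite in_itv/= => xcd; apply: contrapT => nx; apply: H; exists x => // j bj.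
  by apply: nx; exists j.
have := countable_lebesgue_measure0 (sub_countable (subset_card_le sub) cU).
rewrite lebesgue_measure_itv/= lte_fin cd -EFinB => /eqP.
by rewrite eqe subr_eq0 gt_eqF.
Qed.

Lemma slice_cont u t j : {within Pi, continuous u} -> 0 <= t ->
  {within `[0, 1], continuous (fun x => u (x, t) 0 j)}.
Proof.
move=> /subspace_continuousP cu t0; apply/subspace_continuousP => x.
rewrite /= in_itv/= => x01; have Pp : Pi (x, t) by [].
apply: (@rv_cvg_coord _ _ _ _ (fun s => u (s, t))).
apply: (@cvg_within_comp _ _ _ Pi (fun s => (s, t)) u _ (x, t)).
- apply: cvg_within_filter.
  by apply: (@continuous_pair _ _ _ id (cst t)); [exact: cvg_id|exact: cvg_cst].
- by rewrite near_withinE; apply: nearW => s; rewrite /= in_itv.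
- exact: cu.
Qed.

Lemma vanish_by_test T : 0 < T -> {within dom_h (n := n), continuous h} ->
  (forall psi gam v, test_fun psi gam -> is_fix psi v ->
     forall x, 0 <= x <= 1 -> v (x, T) = 0) ->
  forall phi u, Ch m h phi -> is_fix phi u -> forall x, 0 <= x <= 1 -> u (x, T) = 0.
Proof.
have in01_trans (c z e : R) : 0 <= c -> c <= z <= e -> e <= 1 -> 0 <= z <= 1.
  by move=> ? /andP[? ?] ?; apply/andP; split; lra.
move=> T0 ch Htest phi u Cphi fu x0 x01.
have gen x : 0 <= x <= 1 -> (forall j, ~ bad (Th j (x, T))) -> u (x, T) = 0.
  move=> xin nb; have [ys [ys01 hys]] := point_determined xin T0 nb.
  have [psi [gam [tpsi e]]] := test_fun_interpolation phi ys01.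
  have [v fv] := fix_exists psi.
  rewrite -(Htest psi gam v tpsi fv x xin); apply: (hys phi psi) => // y ysy.
  by rewrite e.
have [cu _] := fix_Ch_Pi ch Cphi fu.
apply/rowP => j; rewrite mxE.
suff H : forall x, 0 <= x <= 1 -> u (x, T) 0 j = 0 by exact: H.
apply: (vanish_dense (slice_cont cu (ltW T0))).
move=> c d c0 cd d1; have [x xcd nb] := generic_dense T cd.
by exists x => //; rewrite (gen x (in01_trans _ _ _ c0 xcd d1) nb) mxE.
Qed.

(** * The equivalence for L^2-generalized solutions *)

Section L2Part.
Hypothesis h_C1 : forall j, C1_on (W := R^o) (dom_h (n := n)) (fun z : R * 'rV[R]_n => h z 0 j).

Lemma test_fun_C1h psi gam : test_fun psi gam -> C1h m h psi.
Proof.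
move=> [gam01 C psi0].
have /choice[dpsi hd] : forall j, exists g' : R -> R, continuous g' /\
    forall x : R, is_derive x 1 (fun x => psi x 0 j) (g' x).
  by move=> j; have [g' cg dg] := C j; exists g'.
exact: (test_C1h (fun j x => (hd j).2 x) (fun j => (hd j).1) gam01 psi0).
Qed.

Lemma test_fun_solution psi gam u : test_fun psi gam -> is_fix psi u ->
  piecewise_C1_solution m a b h psi u.
Proof.
move=> [gam01 C psi0] fu.
have /choice[dpsi hd] : forall j, exists g' : R -> R, continuous g' /\
    forall x : R, is_derive x 1 (fun x => psi x 0 j) (g' x).
  by move=> j; have [g' cg dg] := C j; exists g'.
exact: (test_solution h_C1 (fun j x => (hd j).2 x) (fun j => (hd j).1) gam01 psi0 fu).
Qed.

Lemma FTS_L2_Qpow :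
  (forall phi, L2 phi -> exists u : R -> R -> 'rV[R]_n, L2_generalized_solution m a b h phi u) ->
  FTS_L2 m a b h <-> Qpow_vanishes m a b h.
Proof.
move=> ex; have ch := h_within_cont h_C1; split.
- move=> [T [T0 hT]].
  have T10 : 0 < T + 1 by rewrite addr_gt0.
  have T1 : 0 <= T + 1 by exact: ltW.
  have [k0 hk] := iter_opQ_agree T1.
  exists (T + 1), k0; split => // w Cw x x01; have Cphi := trace_Ch Cw.
  have [u fu] := fix_exists (fun y => w (y, 0)).
  have P1 : Pi (x, T + 1) by split.
  rewrite (hk k0 (leqnn _) _ _ w u (fun _ _ => erefl))//.
  rewrite (iter_opQ_fix _ (fun _ _ => erefl) fu)//.
  apply: (vanish_by_test T10 ch _ Cphi fu x01) => psi gam v tpsi fv y y01.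
  have Lpsi := test_fun_L2 tpsi; have Cpsi := test_fun_C1h tpsi.
  have [ug gen] := ex _ Lpsi.
  have [[cv _] [[Lu _] lim]] := (fix_Ch_Pi ch Cpsi.1 fv, gen).
  (* The constant sequence [psi] is an admissible approximation of itself, so at time [T + 1] the
     generalized solution is at L^2 distance 0 from [v]. *)
  have d0 (e : R) : 0 < e -> (L2dist (fun y => v (y, T + 1)%R) (ug (T + 1)%R) <= e%:E)%E.
    move=> e0.
    have z0 : (fun l : nat => L2dist psi psi) @ \oo --> 0%E.
      have -> : (fun l : nat => L2dist psi psi) = cst 0%E; last exact: cvg_cst.
      apply/funext => l; apply/L2norm_eq0 => j; rewrite /sqdist integral0_eq// => z _.
      by rewrite !mxE subrr subr0 expr0n.
    have /filter_ex[l] := lim (fun=> psi) (fun=> v) (fun=> Cpsi) z0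
      (fun=> test_fun_solution tpsi fv) _ T10 _ e0.
    by apply; rewrite T1 lexx.
  have u0 : L2norm (ug (T + 1)) = 0%E by apply: hT Lpsi gen _ _; rewrite ltrDl.
  apply/rowP => j; rewrite mxE.
  apply: (sqdist_eq0 (slice_cont cv T1)) y01.
  have mv : measurable_fun [set` `]0 : R, 1[] (fun y : R => v (y, T + 1) 0 j).
    apply: subspace_continuous_measurable_fun => //.
    by apply: continuous_subspaceW (slice_cont cv T1); exact: subset_itv_oo_cc.
  apply/eqP; rewrite eq_le sqdist_ge0 andbT.
  apply: le_trans (sqdist_trans mv ((Lu _ T1).1 j) (measurable_cst _)) _.
  by rewrite (L2dist_coord j d0) ((L2norm_eq0 _).1 u0 j) !mule0 adde0.
- move=> [T [k [T0 hT]]]; exists T; split => // phi u Lphi [[Lu _] lim] t Tt.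
  have t0 : 0 < t := lt_trans T0 Tt.
  have inv0 (l : nat) : 0 < l.+1%:R^-1 :> R by rewrite invr_gt0.
  have /choice[psi hpsi] : forall l : nat, exists psi : R -> 'rV[R]_n,
      exists gam, test_fun psi gam /\ (L2dist psi phi <= (l.+1%:R^-1)%:E)%E.
    by move=> l; exact: test_fun_dense.
  have /choice[v fv] : forall l : nat, exists v, is_fix (psi l) v.
    by move=> l; exact: fix_exists.
  have Cpsi (l : nat) : C1h m h (psi l) by have [gam [tl _]] := hpsi l; exact: test_fun_C1h tl.
  have v0 (l : nat) x : 0 <= x <= 1 -> v l (x, t) = 0.
    move=> x01; apply: (vanish_forward (ltW T0) (fv l)) (x01) (ltW Tt).
    have Cv := fix_Ch_Pi ch (Cpsi l).1 (fv l).
    exact: (Qpow_fix_zero Cv (fix_init (Cpsi l).1.2 (fv l)) (fv l) T0 hT).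
  apply/L2norm_eq0 => j; rewrite sqdistC.
  have -> : sqdist (fun=> 0) (fun x => u t x 0 j) =
      sqdist (fun x => (fun=> 0 : 'rV[R]_n) x 0 j) (fun x => u t x 0 j).
    by apply: eq_integral => x _; rewrite mxE.
  apply: L2dist_coord => e e0.
  have psi_phi : (fun l : nat => L2dist (psi l) phi) @ \oo --> 0%E.
    apply: (@squeeze_cvge _ _ _ _ (cst 0%E) _ (fun l : nat => (l.+1%:R^-1)%:E)).
    - by apply: nearW => l; rewrite sqrte_ge0/=; have [gam []] := hpsi l.
    - exact: cvg_cst.
    - exact: cvge_harmonic.
  have sol (l : nat) : piecewise_C1_solution m a b h (psi l) (v l).
    by have [gam [tl _]] := hpsi l; exact: test_fun_solution tl (fv l).
  have /filter_ex[l] := lim psi v Cpsi psi_phi sol t t0 e e0.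
  move=> /(_ t); rewrite lexx ltW// => /(_ isT); apply: le_trans.
  rewrite le_eqVlt; apply/orP; left; apply/eqP.
  rewrite !L2distE; congr sqrte; apply: eq_bigr => l' _.
  apply: eq_integral => x; rewrite inE/= in_itv/= => /andP[x0 x1].
  by rewrite v0 ?ltW.
Qed.

End L2Part.
End System.

Theorem theorem1p7 (R : realType) (n m : nat)
  (a b : 'I_n -> R * R -> R) (h : R * 'rV[R]_n -> 'rV[R]_n) (a0 : R)
  (n_ge2 : (2 <= n)%N) (m_le_n : (m <= n)%N)
  (a0_gt0 : 0 < a0)
  (a_pos : forall (j : 'I_n) (p : R * R), (j < m)%N -> Pi p -> a0 <= a j p)
  (a_neg : forall (j : 'I_n) (p : R * R), (m <= j)%N -> Pi p -> a j p <= - a0)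
  (a_C1 : forall j : 'I_n, C1_on (W := R^o) Pi (a j))
  (b_C1 : forall j : 'I_n, C1_on (W := R^o) Pi (b j))
  (h_C1 : forall j : 'I_n, C1_on (W := R^o) (@dom_h R n) (fun p => h p 0 j))
  (h_growth : growth_condition h)
  (h_zero : forall t : R, 0 <= t -> h (t, 0) = 0) :
  ((forall phi, L2 phi -> exists u, L2_generalized_solution m a b h phi u) ->
     (FTS_L2 m a b h <-> Qpow_vanishes m a b h)) /\
  ((forall phi, Ch m h phi -> exists u, continuous_solution m a b h phi u) ->
     (FTS_continuous m a b h <-> Qpow_vanishes m a b h)).
Proof.
(* The six functions are packed into nested pairs, so that a single [choice] selects them for all
   components. *)
have tr_ex (j : 'I_n) : exists D : ((R * R -> R) * (R * R -> R)) *
    ((R * R -> R) * (R * R -> R)) * ((R * R -> R) * (R * R -> R)),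
    transport (a j) (b j) (out_side R m j) (in_side R m j)
      D.1.1.1 D.1.1.2 D.1.2.1 D.1.2.2 D.2.1 D.2.2.
  have oi : (out_side R m j = 0 /\ in_side R m j = 1) \/
      (out_side R m j = 1 /\ in_side R m j = 0).
    by rewrite /out_side /in_side; case: ifP; [left|right].
  have a_sg p : Pi p -> a0 <= (in_side R m j - out_side R m j) * a j p.
    move=> Pp; rewrite /out_side /in_side; case: ltnP => jm.
      by rewrite subr0 mul1r a_pos.
    by rewrite sub0r mulN1r lerNr a_neg.
  have [Th [L [Tht [Lt [f [bb tr]]]]]] :=
    transport_exists oi (a_C1 j) (b_C1 j) a0_gt0 a_sg.
  by exists (Th, L, (Tht, Lt), (f, bb)).
have [D tr] := choice tr_ex.
split; first exact: (FTS_L2_Qpow tr h_zero h_C1).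
exact: (FTS_continuous_Qpow tr h_zero).
Qed.
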